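(* Let $\mathbb K$ be a field and let $\triangle$ be a simplicial complex on a finite vertex set, with Stanley-Reisner ring $\mathbb K[\triangle]$. Then $$\mathrm H^j(\operatorname{Spec}\mathbb K[\triangle],\mathcal O^* )=0\quad\text{for all }j\ge1,$$ where $\mathcal O^*$ is the sheaf of units of the structure sheaf and cohomology is taken in the Zariski topology.
   Context: A simplicial complex $\triangle$ on a finite set $V$ is a set of subsets of $V$ (faces) closed under taking subsets and containing all singletons of $V$. Its Stanley-Reisner ring is $\mathbb K[\triangle]=\mathbb K[X_v\mid v\in V]/(\prod_{v\in H}X_v\mid H\subseteq V,\ H\notin\triangle)$. *)

(* Defs.v *)
From HB Require Import structures.
From mathcomp Require Import all_boot all_algebra.
From mathcomp Require Import boolp classical_sets topology_structure.
From mathcomp Require Import mpoly.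
From mathcomp Require Import ring.

Set Implicit Arguments.
Unset Strict Implicit.
Unset Printing Implicit Defensive.

Import GRing.Theory.
Local Open Scope ring_scope.
Local Open Scope quotient_scope.
Local Open Scope classical_set_scope.

(* Two consecutive maps A -> B -> C suffice: H is the kernel of [g] modulo the
   cocycles that lie in the image of [f] (for a complex, the whole image). *)

Section Cohomology.
Variables (A B C : zmodType) (f : {additive A -> B}) (g : {additive B -> C}).

Definition in_ker : {pred B} := fun x => g x == 0.

Fact in_ker_zmod_closed : zmod_closed in_ker.
Proof.
split=> [|x y]; rewrite !unfold_in ?raddf0 // => /eqP gx /eqP gy.
by rewrite raddfB gx gy subrr.
Qed.
HB.instance Definition _ := GRing.isZmodClosed.Build B in_ker in_ker_zmod_closed.

Record cocycle := Cocycle { cocycle_val :> B; cocycleP : cocycle_val \in in_ker }.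
HB.instance Definition _ := [isSub for cocycle_val].
HB.instance Definition _ := [Choice of cocycle by <:].
HB.instance Definition _ := [SubChoice_isSubZmodule of cocycle by <:].

Definition coboundary : {pred cocycle} :=
  fun z => `[< exists y : A, f y = cocycle_val z >].

Fact coboundary_zmod_closed : zmod_closed coboundary.
Proof.
split=> [|x y]; rewrite !unfold_in.
  by apply/asboolP; exists 0; rewrite raddf0.
move=> /asboolP [a fa] /asboolP [b fb]; apply/asboolP.
by exists (a - b); rewrite raddfB fa fb.
Qed.
HB.instance Definition _ :=
  GRing.isZmodClosed.Build cocycle coboundary coboundary_zmod_closed.

Definition cohomology_group : zmodType := Quotient.quot coboundary.

End Cohomology.

Section Opens.
Variable X : topologicalType.

Record opens := Opens { opens_set :> set X; opensP : open opens_set }.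

Definition opens_setT : opens := Opens openT.

Definition sheaf_axiom (F : opens -> Type)
    (res : forall U V : opens, V `<=` U -> F U -> F V) : Prop :=
  forall (U : opens) (I : Type) (W : I -> opens) (WU : forall i, W i `<=` U),
    U `<=` \bigcup_i W i ->
    forall s : forall i, F (W i),
      (forall i j (T : opens) (Ti : T `<=` W i) (Tj : T `<=` W j),
          res _ _ Ti (s i) = res _ _ Tj (s j)) ->
      exists! t : F U, forall i, res _ _ (WU i) t = s i.

Record sheaf := Sheaf {
  sec :> opens -> zmodType;
  res : forall U V : opens, V `<=` U -> {additive sec U -> sec V};
  res_id : forall (U : opens) (UU : U `<=` U) (s : sec U), res UU s = s;
  res_comp : forall (U V W : opens) (VU : V `<=` U) (WV : W `<=` V)
    (WU : W `<=` U) (s : sec U), res WV (res VU s) = res WU s;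
  sheafP : sheaf_axiom (fun U V (VU : V `<=` U) => res VU : sec U -> sec V) }.

Record ring_sheaf := RingSheaf {
  rsec :> opens -> comPzRingType;
  rres : forall U V : opens, V `<=` U -> {rmorphism rsec U -> rsec V};
  rres_id : forall (U : opens) (UU : U `<=` U) (s : rsec U), rres UU s = s;
  rres_comp : forall (U V W : opens) (VU : V `<=` U) (WV : W `<=` V)
    (WU : W `<=` U) (s : rsec U), rres WV (rres VU s) = rres WU s;
  rsheafP : sheaf_axiom (fun U V (VU : V `<=` U) => rres VU : rsec U -> rsec V) }.

Record sheaf_hom (F G : sheaf) := SheafHom {
  sheaf_map :> forall U : opens, {additive F U -> G U};
  sheaf_map_res : forall (U V : opens) (VU : V `<=` U) (s : F U),
    sheaf_map V (res F VU s) = res G VU (sheaf_map U s) }.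

Definition sheaf_mono (F G : sheaf) (phi : sheaf_hom F G) : Prop :=
  forall U : opens, injective (phi U).

(* Exactness at G as sheaves: the kernel of [psi] is the image sheaf of [phi], whose
   sections are those that lift along [phi] locally. *)
Definition sheaf_exact (F G H : sheaf) (phi : sheaf_hom F G) (psi : sheaf_hom G H)
    : Prop :=
  forall (U : opens) (s : G U),
    psi U s = 0 <->
    forall x, opens_set U x -> exists (W : opens) (WU : W `<=` U) (t : F W),
      opens_set W x /\ phi W t = res G WU s.

Definition injective_sheaf (E : sheaf) : Prop :=
  forall (F G : sheaf) (i : sheaf_hom F G) (phi : sheaf_hom F E),
    sheaf_mono i ->
    exists psi : sheaf_hom G E, forall (U : opens) (s : F U), psi U (i U s) = phi U s.

Record injective_resolution (F : sheaf) := InjectiveResolution {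
  ir_term : nat -> sheaf;
  ir_aug : sheaf_hom F (ir_term 0);
  ir_diff : forall n, sheaf_hom (ir_term n) (ir_term n.+1);
  ir_injective : forall n, injective_sheaf (ir_term n);
  ir_aug_mono : sheaf_mono ir_aug;
  ir_exact0 : sheaf_exact ir_aug (ir_diff 0);
  ir_exactS : forall n, sheaf_exact (ir_diff n) (ir_diff n.+1) }.

(* H^j(X, F), the j-th right derived functor of global sections, computed by the
   injective resolution [E] of F; it does not depend on [E] up to isomorphism.  In
   degree 0 the incoming map is 0. *)
Definition sheaf_cohomology (F : sheaf) (E : injective_resolution F) (j : nat)
    : zmodType :=
  match j with
  | 0 => cohomology_group (\0 : {additive ir_term E 0 opens_setT -> ir_term E 0 opens_setT})
           (ir_diff E 0 opens_setT)
  | n.+1 => cohomology_group (ir_diff E n opens_setT) (ir_diff E n.+1 opens_setT)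
  end.

End Opens.

(* The multiplicative group of units of A, as a [zmodType]: its addition is the
   multiplication of A. *)
Section UnitGroup.
Variable A : comPzRingType.

Record unit_group := UnitGroup {
  uval : A; uinv : A; uvalK : uval * uinv = 1 }.

HB.instance Definition _ := gen_eqMixin unit_group.
HB.instance Definition _ := gen_choiceMixin unit_group.

Lemma uval_inj : injective uval.
Proof.
move=> [x y xy] [x' y' xy'] /= e; subst x'.
have e : y = y' by rewrite -[LHS]mulr1 -xy' mulrA [y * x]mulrC xy mul1r.
by subst y'; congr UnitGroup; exact: Prop_irrelevance.
Qed.

Definition unit_one := UnitGroup (mulr1 (1 : A)).

Definition unit_inv (x : unit_group) : unit_group :=
  UnitGroup (etrans (mulrC _ _) (uvalK x)).

Fact unit_mul_subproof (x y : unit_group) :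
  (uval x * uval y) * (uinv x * uinv y) = 1.
Proof. by rewrite mulrACA !uvalK mulr1. Qed.

Definition unit_mul (x y : unit_group) := UnitGroup (unit_mul_subproof x y).

Fact unit_mulA : associative unit_mul.
Proof. by move=> x y z; apply: uval_inj; exact: mulrA. Qed.
Fact unit_mulC : commutative unit_mul.
Proof. by move=> x y; apply: uval_inj; exact: mulrC. Qed.
Fact unit_mul1 : left_id unit_one unit_mul.
Proof. by move=> x; apply: uval_inj; exact: mul1r. Qed.
Fact unit_mulV : left_inverse unit_one unit_inv unit_mul.
Proof. by move=> x; apply: uval_inj; rewrite /= mulrC uvalK. Qed.

HB.instance Definition _ :=
  GRing.isZmodule.Build unit_group unit_mulA unit_mulC unit_mul1 unit_mulV.

End UnitGroup.

Section UnitMap.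
Variables (A B : comPzRingType) (f : {rmorphism A -> B}).

Fact unit_map_subproof (x : unit_group A) : f (uval x) * f (uinv x) = 1.
Proof. by rewrite -rmorphM uvalK rmorph1. Qed.

Definition unit_map (x : unit_group A) : unit_group B :=
  UnitGroup (unit_map_subproof x).

Fact unit_map_is_zmod_morphism : zmod_morphism unit_map.
Proof. by move=> x y; apply: uval_inj; exact: rmorphM. Qed.
HB.instance Definition _ :=
  GRing.isZmodMorphism.Build (unit_group A) (unit_group B) unit_map
    unit_map_is_zmod_morphism.

End UnitMap.

Section UnitsSheaf.
Variables (X : topologicalType) (O : ring_sheaf X).

Let usec (U : opens X) : zmodType := unit_group (O U).
Let ures (U V : opens X) (VU : V `<=` U) : {additive usec U -> usec V} :=
  unit_map (rres O VU).

Fact units_res_id (U : opens X) (UU : U `<=` U) (s : usec U) : ures UU s = s.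
Proof. by apply: uval_inj; exact: rres_id. Qed.

Fact units_res_comp (U V W : opens X) (VU : V `<=` U) (WV : W `<=` V)
  (WU : W `<=` U) (s : usec U) : ures WV (ures VU s) = ures WU s.
Proof. by apply: uval_inj; exact: rres_comp. Qed.

Fact units_sheaf_axiom :
  sheaf_axiom (fun U V (VU : V `<=` U) => ures VU : usec U -> usec V).
Proof.
move=> U I W WU cov s comp.
have [i j T Ti Tj|a [aE aU]] := rsheafP WU cov (s := fun i => uval (s i)).
  by have := comp i j T Ti Tj => /(congr1 (@uval _)).
have [i j T Ti Tj|b [bE bU]] := rsheafP WU cov (s := fun i => uinv (s i)).
  by have := comp i j T Ti Tj => /(congr1 (@uinv _)).
have [i j T Ti Tj|c [cE cU]] := rsheafP WU cov (s := fun i => (1 : O (W i))).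
  by rewrite !rmorph1.
have ab : a * b = 1.
  rewrite -(cU 1) => [|i]; last by rewrite rmorph1.
  by symmetry; apply: cU => i; rewrite rmorphM aE bE uvalK.
exists (UnitGroup ab); split=> [i|t tE]; apply: uval_inj => /=; first exact: aE.
by apply: aU => i; rewrite -tE.
Qed.

Definition units_sheaf : sheaf X :=
  Sheaf units_res_id units_res_comp units_sheaf_axiom.

End UnitsSheaf.

Record Spec (A : comPzRingType) := PrimeIdeal {
  prime_set :> A -> Prop;
  prime0 : prime_set 0;
  primeD : forall x y, prime_set x -> prime_set y -> prime_set (x + y);
  primeMl : forall a x, prime_set x -> prime_set (a * x);
  prime1 : ~ prime_set 1;
  primeM : forall x y, prime_set (x * y) -> prime_set x \/ prime_set y }.

Section Zariski.
Variable A : comPzRingType.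

HB.instance Definition _ := gen_eqMixin (Spec A).
HB.instance Definition _ := gen_choiceMixin (Spec A).

Definition zero_locus (S : set A) : set (Spec A) := [set p : Spec A | S `<=` prime_set p].

Definition zariski_open : set (set (Spec A)) :=
  [set U | exists S : set A, ~` U = zero_locus S].

Fact zariski_openT : zariski_open setT.
Proof.
exists setT; rewrite setCT; apply/seteqP; split=> // p pT.
by case: (prime1 (pT 1 I)).
Qed.

Fact zariski_openI : setI_closed zariski_open.
Proof.
move=> U V [S US] [T VT].
exists [set x | exists s t, [/\ S s, T t & x = s * t]].
rewrite setCI US VT; apply/seteqP; split=> [p [Sp|Tp] _ [s [t [Ss Tt ->]]]|p STp].
- by rewrite mulrC; apply: primeMl; exact: Sp.
- by apply: primeMl; exact: Tp.
apply: contrapT => /not_orP [/existsNP[s /not_implyP[Ss ps]]].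
move=> /existsNP[t /not_implyP[Tt pt]].
by case: (primeM (STp (s * t) (ex_intro _ s (ex_intro _ t (And3 Ss Tt erefl))))).
Qed.

Fact zariski_open_bigU (J : Type) (f : J -> set (Spec A)) :
  (forall i, zariski_open (f i)) -> zariski_open (\bigcup_i f i).
Proof.
move=> /choice [S fS]; exists (\bigcup_i S i); rewrite setC_bigcup.
apply/seteqP; split=> [p fp x [i _ Six]|p Sp i _].
  by have := fp i I; rewrite fS; apply.
by rewrite fS => x Six; apply: Sp; exists i.
Qed.

HB.instance Definition _ := isOpenTopological.Build (Spec A)
  zariski_openT zariski_openI zariski_open_bigU.

End Zariski.

Section Localization.
Variables (A : comPzRingType) (p : Spec A).

Record frac := Frac { fnum : A; fden : A; fdenP : ~ p fden }.

HB.instance Definition _ := gen_eqMixin frac.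
HB.instance Definition _ := gen_choiceMixin frac.

Lemma primeNM x y : ~ p x -> ~ p y -> ~ p (x * y).
Proof. by move=> px py /primeM []. Qed.

Definition frac_eqv (x y : frac) : bool :=
  `[< exists2 u, ~ p u & u * (fnum x * fden y) = u * (fnum y * fden x) >].

Fact frac_eqv_equiv : equiv_class_of frac_eqv.
Proof.
split=> [x|x y|y x z].
- by apply/asboolP; exists 1 => //; exact: prime1.
- by apply/asboolP/asboolP => -[u pu e]; exists u.
move=> /asboolP [u pu e] /asboolP [v pv e']; apply/asboolP.
exists (u * v * fden y); first exact: primeNM (primeNM pu pv) (@fdenP y).
have -> : u * v * fden y * (fnum x * fden z) =
  u * (fnum x * fden y) * (v * fden z) by ring.
rewrite e.
have -> : u * (fnum y * fden x) * (v * fden z) =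
  v * (fnum y * fden z) * (u * fden x) by ring.
by rewrite e'; ring.
Qed.
Canonical frac_eqv_rel := EquivRelPack frac_eqv_equiv.
Canonical frac_eqv_encModRel := defaultEncModRel frac_eqv.

Definition localization := {eq_quot frac_eqv}.


Definition fracl (x : frac) : localization := \pi x.

Lemma fraclE (x y : frac) :
  fracl x = fracl y <->
  exists2 u, ~ p u & u * (fnum x * fden y) = u * (fnum y * fden x).
Proof.
split=> [/eqP|e]; last by apply/eqP; rewrite /fracl piE; apply/asboolP.
by rewrite /fracl piE => /asboolP.
Qed.

Lemma fracl_eq (x y : frac) :
  fnum x * fden y = fnum y * fden x -> fracl x = fracl y.
Proof. by move=> e; apply/fraclE; exists 1; [exact: prime1|rewrite e]. Qed.

Lemma fraclP (P : localization -> Prop) : (forall x, P (fracl x)) -> forall z, P z.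
Proof. by move=> Pf z; rewrite -[z]reprK; exact: Pf. Qed.

Definition frac_add (x y : frac) := Frac (fnum x * fden y + fnum y * fden x)
  (primeNM (@fdenP x) (@fdenP y)).
Definition frac_mul (x y : frac) := Frac (fnum x * fnum y)
  (primeNM (@fdenP x) (@fdenP y)).
Definition frac_opp (x : frac) := Frac (- fnum x) (@fdenP x).
Definition frac_of (a : A) := Frac a (@prime1 A p).

Definition loc_add (x y : localization) := fracl (frac_add (repr x) (repr y)).
Definition loc_mul (x y : localization) := fracl (frac_mul (repr x) (repr y)).
Definition loc_opp (x : localization) := fracl (frac_opp (repr x)).

Lemma repr_fracl (x : frac) : exists2 u, ~ p u &
  u * (fnum (repr (fracl x)) * fden x) = u * (fnum x * fden (repr (fracl x))).
Proof. by apply/fraclE; rewrite /fracl reprK. Qed.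

Lemma fraclD (x y : frac) : loc_add (fracl x) (fracl y) = fracl (frac_add x y).
Proof.
have [u pu eu] := repr_fracl x; have [v pv ev] := repr_fracl y.
apply/fraclE; exists (u * v); first exact: primeNM.
move: eu ev => /=; set x' := repr _; set y' := repr _ => eu ev.
transitivity (u * (fnum x' * fden x) * (v * fden y * fden y')
  + v * (fnum y' * fden y) * (u * fden x * fden x')); first by ring.
by rewrite eu ev; ring.
Qed.

Lemma fraclM (x y : frac) : loc_mul (fracl x) (fracl y) = fracl (frac_mul x y).
Proof.
have [u pu eu] := repr_fracl x; have [v pv ev] := repr_fracl y.
apply/fraclE; exists (u * v); first exact: primeNM.
move: eu ev => /=; set x' := repr _; set y' := repr _ => eu ev.
transitivity (u * (fnum x' * fden x) * (v * (fnum y' * fden y))); first by ring.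
by rewrite eu ev; ring.
Qed.

Lemma fraclN (x : frac) : loc_opp (fracl x) = fracl (frac_opp x).
Proof.
have [u pu eu] := repr_fracl x; apply/fraclE; exists u => //=.
by rewrite !mulNr !mulrN eu.
Qed.

Fact loc_addA : associative loc_add.
Proof.
elim/fraclP=> x; elim/fraclP=> y; elim/fraclP=> z; rewrite !fraclD.
by apply: fracl_eq => /=; ring.
Qed.
Fact loc_addC : commutative loc_add.
Proof.
elim/fraclP=> x; elim/fraclP=> y; rewrite !fraclD.
by apply: fracl_eq => /=; ring.
Qed.
Fact loc_add0 : left_id (fracl (frac_of 0)) loc_add.
Proof. by elim/fraclP=> x; rewrite fraclD; apply: fracl_eq => /=; ring. Qed.
Fact loc_addN : left_inverse (fracl (frac_of 0)) loc_opp loc_add.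
Proof. by elim/fraclP=> x; rewrite fraclN fraclD; apply: fracl_eq => /=; ring. Qed.
Fact loc_mulA : associative loc_mul.
Proof.
elim/fraclP=> x; elim/fraclP=> y; elim/fraclP=> z; rewrite !fraclM.
by apply: fracl_eq => /=; ring.
Qed.
Fact loc_mulC : commutative loc_mul.
Proof.
elim/fraclP=> x; elim/fraclP=> y; rewrite !fraclM.
by apply: fracl_eq => /=; ring.
Qed.
Fact loc_mul1 : left_id (fracl (frac_of 1)) loc_mul.
Proof. by elim/fraclP=> x; rewrite fraclM; apply: fracl_eq => /=; ring. Qed.
Fact loc_mulD : left_distributive loc_mul loc_add.
Proof.
elim/fraclP=> x; elim/fraclP=> y; elim/fraclP=> z.
rewrite fraclD !fraclM fraclD.
by apply: fracl_eq => /=; ring.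
Qed.

HB.instance Definition _ := Choice.on localization.
HB.instance Definition _ :=
  GRing.isZmodule.Build localization loc_addA loc_addC loc_add0 loc_addN.
HB.instance Definition _ :=
  GRing.Zmodule_isComPzRing.Build localization loc_mulA loc_mulC loc_mul1 loc_mulD.

End Localization.

Section StructureSheaf.
Variable A : comPzRingType.

Definition locally_fraction (U : opens (Spec A))
    (s : forall p : Spec A, opens_set U p -> localization p) : Prop :=
  forall p, opens_set U p ->
  exists (W : opens (Spec A)) (a f : A), opens_set W p /\
    forall q (Uq : opens_set U q), opens_set W q ->
    exists fq : ~ q f, s q Uq = fracl (Frac a fq).

Record section (U : opens (Spec A)) := Section {
  germ :> forall p : Spec A, opens_set U p -> localization p;
  germP : locally_fraction germ }.

HB.instance Definition _ U := gen_eqMixin (section U).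
HB.instance Definition _ U := gen_choiceMixin (section U).

Lemma section_eq U (s t : section U) : (forall p Up, s p Up = t p Up) -> s = t.
Proof.
case: s t => [s sP] [t tP] /= e.
have {}e : s = t by apply: functional_extensionality_dep => p; apply: funext.
by subst t; congr Section; exact: Prop_irrelevance.
Qed.

Definition opens_setI (X : topologicalType) (U V : opens X) : opens X :=
  Opens (openI (opensP U) (opensP V)).

Section Operations.
Variable U : opens (Spec A).

Fact section_cst_subproof (a : A) :
  locally_fraction (fun p (_ : opens_set U p) => fracl (frac_of p a)).
Proof.
move=> p Up; exists U, a, 1; split=> // q Uq _; exists (@prime1 A q).
exact: fracl_eq.
Qed.
Definition section_cst a := Section (section_cst_subproof a).

Fact section_add_subproof (s t : section U) :
  locally_fraction (fun p Up => s p Up + t p Up).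
Proof.
move=> p Up; have [W [a [f [Wp sE]]]] := germP s Up.
have [W' [b [g [W'p tE]]]] := germP t Up.
exists (opens_setI W W'), (a * g + b * f), (f * g); split=> // q Uq [Wq W'q].
have [fq ->] := sE q Uq Wq; have [gq ->] := tE q Uq W'q.
by exists (primeNM fq gq); rewrite [LHS]fraclD; exact: fracl_eq.
Qed.
Definition section_add s t := Section (section_add_subproof s t).

Fact section_mul_subproof (s t : section U) :
  locally_fraction (fun p Up => s p Up * t p Up).
Proof.
move=> p Up; have [W [a [f [Wp sE]]]] := germP s Up.
have [W' [b [g [W'p tE]]]] := germP t Up.
exists (opens_setI W W'), (a * b), (f * g); split=> // q Uq [Wq W'q].
have [fq ->] := sE q Uq Wq; have [gq ->] := tE q Uq W'q.
by exists (primeNM fq gq); rewrite [LHS]fraclM; exact: fracl_eq.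
Qed.
Definition section_mul s t := Section (section_mul_subproof s t).

Fact section_opp_subproof (s : section U) :
  locally_fraction (fun p Up => - s p Up).
Proof.
move=> p Up; have [W [a [f [Wp sE]]]] := germP s Up.
exists W, (- a), f; split=> // q Uq Wq; have [fq ->] := sE q Uq Wq.
by exists fq; rewrite [LHS]fraclN; exact: fracl_eq.
Qed.
Definition section_opp s := Section (section_opp_subproof s).

Fact section_addA : associative section_add.
Proof. by move=> s t r; apply: section_eq => p Up; exact: addrA. Qed.
Fact section_addC : commutative section_add.
Proof. by move=> s t; apply: section_eq => p Up; exact: addrC. Qed.
Fact section_add0 : left_id (section_cst 0) section_add.
Proof. by move=> s; apply: section_eq => p Up; exact: add0r. Qed.
Fact section_addN : left_inverse (section_cst 0) section_opp section_add.
Proof. by move=> s; apply: section_eq => p Up; exact: addNr. Qed.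
Fact section_mulA : associative section_mul.
Proof. by move=> s t r; apply: section_eq => p Up; exact: mulrA. Qed.
Fact section_mulC : commutative section_mul.
Proof. by move=> s t; apply: section_eq => p Up; exact: mulrC. Qed.
Fact section_mul1 : left_id (section_cst 1) section_mul.
Proof. by move=> s; apply: section_eq => p Up; exact: mul1r. Qed.
Fact section_mulD : left_distributive section_mul section_add.
Proof. by move=> s t r; apply: section_eq => p Up; exact: mulrDl. Qed.

HB.instance Definition _ := GRing.isZmodule.Build (section U)
  section_addA section_addC section_add0 section_addN.
HB.instance Definition _ := GRing.Zmodule_isComPzRing.Build (section U)
  section_mulA section_mulC section_mul1 section_mulD.

End Operations.

Section Restriction.
Variables (U V : opens (Spec A)) (VU : V `<=` U).

Fact section_res_subproof (s : section U) :
  locally_fraction (fun p (Vp : opens_set V p) => s p (VU Vp)).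
Proof.
move=> p Vp; have [W [a [f [Wp sE]]]] := germP s (VU Vp).
by exists W, a, f; split=> // q Vq Wq; exact: sE.
Qed.
Definition section_res (s : section U) : section V := Section (section_res_subproof s).

Fact section_res_is_zmod_morphism : zmod_morphism section_res.
Proof. by move=> s t; exact: section_eq. Qed.
Fact section_res_is_monoid_morphism : monoid_morphism section_res.
Proof. by split=> [|s t]; exact: section_eq. Qed.

HB.instance Definition _ := GRing.isZmodMorphism.Build (section U) (section V)
  section_res section_res_is_zmod_morphism.
HB.instance Definition _ := GRing.isMonoidMorphism.Build (section U) (section V)
  section_res section_res_is_monoid_morphism.

End Restriction.

Fact section_res_id (U : opens (Spec A)) (UU : U `<=` U) (s : section U) :
  section_res UU s = s.
Proof. by apply: section_eq => p Up /=; congr (s p _); exact: Prop_irrelevance. Qed.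

Fact section_res_comp (U V W : opens (Spec A)) (VU : V `<=` U) (WV : W `<=` V)
  (WU : W `<=` U) (s : section U) :
  section_res WV (section_res VU s) = section_res WU s.
Proof. by apply: section_eq => p Up /=; congr (s p _); exact: Prop_irrelevance. Qed.

Fact section_sheaf_axiom :
  sheaf_axiom (fun U V (VU : V `<=` U) => @section_res U V VU).
Proof.
move=> U J W WU cov s comp.
have comp' i j p (Wi : opens_set (W i) p) (Wj : opens_set (W j) p) :
    s i p Wi = s j p Wj.
  have [sl sr] : opens_setI (W i) (W j) `<=` W i /\ opens_setI (W i) (W j) `<=` W j.
    by split=> q [].
  have e := comp i j (opens_setI (W i) (W j)) sl sr.
  have := congr1 (fun t : section (opens_setI (W i) (W j)) => t p (conj Wi Wj)) e.
  by rewrite /= (Prop_irrelevance (sl _ _) Wi) (Prop_irrelevance (sr _ _) Wj).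
have cov' p (Up : opens_set U p) : {i : J | opens_set (W i) p}.
  by apply: cid; have [i _ Wi] := cov p Up; exists i.
pose t p Up := s (projT1 (cov' p Up)) p (projT2 (cov' p Up)).
have tE i p Up Wi : t p Up = s i p Wi by exact: comp'.
have tP : locally_fraction t.
  move=> p Up; have [i Wi] := cov' p Up.
  have [T [a [f [Tp sE]]]] := germP (s i) Wi.
  exists (opens_setI (W i) T), a, f; split=> // q Uq [Wq Tq].
  by rewrite (tE i q Uq Wq); exact: sE.
exists (Section tP); split=> [i|r rE]; apply: section_eq => p Wp /=.
  exact: tE.
have [i Wi] := cov' p Wp; rewrite (tE i p Wp Wi) -rE /=.
by congr (r p _); exact: Prop_irrelevance.
Qed.

Definition structure_sheaf : ring_sheaf (Spec A) :=
  @RingSheaf (Spec A) (fun U => section U : comPzRingType)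
    (fun U V VU => @section_res U V VU : {rmorphism section U -> section V})
    section_res_id section_res_comp section_sheaf_axiom.

End StructureSheaf.

Record simplicial_complex (V : finType) := SimplicialComplex {
  faces :> {set {set V}};
  faces_sub : forall F G : {set V}, F \in faces -> G \subset F -> G \in faces;
  faces_vertex : forall v : V, [set v]%SET \in faces }.

Section StanleyReisner.
Variables (K : fieldType) (V : finType) (D : simplicial_complex V).

(* The polynomial ring K[X_v | v in V] is {mpoly K[#|V|]}, the elements of V being
   numbered by [enum_rank]. *)
Definition face_monomial (H : {set V}) : {mpoly K[#|V|]} :=
  \prod_(v in H) 'X_(enum_rank v).

Definition SR_ideal : {pred {mpoly K[#|V|]}} :=
  fun f => `[< exists c : {set V} -> {mpoly K[#|V|]},
    f = \sum_(H | H \notin faces D) c H * face_monomial H >].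

Fact SR_ideal_zmod_closed : zmod_closed SR_ideal.
Proof.
split=> [|_ _ /asboolP[c ->] /asboolP[d ->]]; apply/asboolP.
  by exists (fun=> 0); rewrite big1 // => H _; rewrite mul0r.
exists (fun H => c H - d H); rewrite -sumrB.
by apply: eq_bigr => H _; rewrite mulrBl.
Qed.
HB.instance Definition _ :=
  GRing.isZmodClosed.Build {mpoly K[#|V|]} SR_ideal SR_ideal_zmod_closed.

Lemma SR_idealMl (a f : {mpoly K[#|V|]}) : f \in SR_ideal -> a * f \in SR_ideal.
Proof.
move=> /asboolP[c ->]; apply/asboolP; exists (fun H => a * c H).
by rewrite mulr_sumr; apply: eq_bigr => H _; rewrite mulrA.
Qed.

(* The library's quotient by an ideal requires the ideal to be proper, which fails
   for the complex without faces on the empty vertex set; hence the multiplication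
   is put on the quotient group here. *)
Definition SR_ring := Quotient.quot SR_ideal.
HB.instance Definition _ := GRing.Zmodule.on SR_ring.

Definition SR_pi (f : {mpoly K[#|V|]}) : SR_ring := \pi f.

Definition SR_mul (x y : SR_ring) : SR_ring := SR_pi (repr x * repr y).

Lemma SR_piE f g : (SR_pi f = SR_pi g) <-> (f - g \in SR_ideal).
Proof. by rewrite Quotient.idealrBE; split=> [/eqP|/eqP]. Qed.

Lemma SR_piP (P : SR_ring -> Prop) : (forall f, P (SR_pi f)) -> forall x, P x.
Proof. by move=> Pf x; rewrite -[x]reprK; exact: Pf. Qed.

Lemma SR_piM f g : SR_mul (SR_pi f) (SR_pi g) = SR_pi (f * g).
Proof.
have Hf : repr (SR_pi f) - f \in SR_ideal by apply/SR_piE; exact: reprK.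
have Hg : repr (SR_pi g) - g \in SR_ideal by apply/SR_piE; exact: reprK.
apply/SR_piE; move: Hf Hg; set f' := repr _; set g' := repr _ => Hf Hg.
have -> : f' * g' - f * g = g' * (f' - f) + f * (g' - g) by ring.
by apply: rpredD; exact: SR_idealMl.
Qed.

Lemma SR_piD f g : SR_pi (f + g) = SR_pi f + SR_pi g.
Proof. exact: raddfD. Qed.

Fact SR_mulA : associative SR_mul.
Proof.
by elim/SR_piP=> f; elim/SR_piP=> g; elim/SR_piP=> h; rewrite !SR_piM mulrA.
Qed.
Fact SR_mulC : commutative SR_mul.
Proof. by elim/SR_piP=> f; elim/SR_piP=> g; rewrite !SR_piM mulrC. Qed.
Fact SR_mul1 : left_id (SR_pi 1) SR_mul.
Proof. by elim/SR_piP=> f; rewrite SR_piM mul1r. Qed.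
Fact SR_mulD : left_distributive SR_mul +%R.
Proof.
elim/SR_piP=> f; elim/SR_piP=> g; elim/SR_piP=> h.
by rewrite -SR_piD !SR_piM mulrDl SR_piD.
Qed.

HB.instance Definition _ :=
  GRing.Zmodule_isComPzRing.Build SR_ring SR_mulA SR_mulC SR_mul1 SR_mulD.

End StanleyReisner.

(* Main.v *)
Require Import Defs.
From HB Require Import structures.
From mathcomp Require Import all_boot all_algebra.
From mathcomp Require Import boolp classical_sets functions topology_structure.
From mathcomp Require Import mpoly.
From mathcomp Require Import ring zify.

(* Cohomology is computed by dimension shifting along the functorial embedding of a sheaf F
   into its sheaf of discontinuous sections, with quotient Q F: [acyclic F] says that global
   sections lift along each of these steps.  In a short exact sequence this property passes
   between the terms as the long exact sequence predicts, flasque sheaves have it, and it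
   forces any injective (hence flasque) resolution to be exact on global sections.

   For a polynomial ring, or any factorial domain B, the units of B are the kernel of the
   flasque sheaf of rational functions mapping onto the sheaf of Cartier divisors, and every
   Cartier divisor on an open set is principal.  If a complex is the union of a face F and a
   smaller complex D', then K[D] is the fibre product of K[F] and K[D'] over K[D' /\ F], which
   gives an exact sequence 1 -> O*(D) -> O*(F) x O*(D') -> O*(D' /\ F) -> 1.  It is exact on
   global sections because K[D' /\ F] is a retract of K[D'], via X_v -> 0 for v outside F.  The
   theorem follows by induction on the number of faces. *)

Set Implicit Arguments.
Unset Strict Implicit.
Unset Printing Implicit Defensive.

Import GRing.Theory.
Local Open Scope ring_scope.

(** * Factorial domains *)

(** All sheaves live on the one space Spec K[D]. The units of a quotient A/J are encoded as the
    units of A modulo those congruent to 1 modulo J, which avoids closed immersions and direct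
    images: a union of complexes then gives a Mayer-Vietoris sequence for subgroups of a single
    sheaf. Subcomplexes appear only as lists of faces, through the common kernel of the restrictions
    to them, so intersecting with F is a [map] over the list.

    The one non-formal point in the gluing is surjectivity on global sections, without which the
    connecting map could create classes in H^1. The retraction is realised as an endomorphism of the
    whole ring K[D]; the self-map of the spectrum that it induces fixes the closed set of the
    intersection pointwise, so a section there can be pulled back along it.

    Cohomology is given by an arbitrary injective resolution. Extending the identity along the
    Godement embedding shows its terms flasque, and nothing else about them is used. *)

Section Factorial.
Variable B : idomainType.
Implicit Types c x y z : B.

Definition divides c x : Prop := exists z, x = z * c.

Definition prime_elt c : Prop :=
  [/\ c != 0, c \isn't a GRing.unit &
      forall x y, divides c (x * y) -> divides c x \/ divides c y].

Inductive factored : B -> Prop :=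
| FactoredUnit u : u \is a GRing.unit -> factored u
| FactoredMul c x : prime_elt c -> factored x -> factored (c * x).

(** Since the factors are prime and not merely irreducible, uniqueness of factorizations is
    automatic. *)
Definition factorial_domain : Prop := forall x, x != 0 -> factored x.

Lemma divides_mull c x y : divides c y -> divides c (x * y).
Proof. by case=> z ->; exists (x * z); rewrite mulrA. Qed.

Lemma divides_unit c u : u \is a GRing.unit -> divides c u -> c \is a GRing.unit.
Proof. by move=> uu [z e]; move: uu; rewrite e unitrM => /andP[]. Qed.

Lemma prime_elt_ndvd_unit c u : prime_elt c -> u \is a GRing.unit -> ~ divides c u.
Proof. by move=> [_ /negP cu _] uu /(divides_unit uu). Qed.

(** If d = z * c and d divided z, cancelling d would make c a unit; so d divides the other factor
    c. *)
Lemma prime_elt_assoc c d : prime_elt c -> prime_elt d -> divides c d -> divides d c.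
Proof.
move=> [c0 /negP cu cP] [d0 /negP du dP] [z e].
have /dP [[w ew]|//] : divides d (z * c) by rewrite -e; exists 1; rewrite mul1r.
case: cu; apply/unitrPr; exists w; apply: (mulfI d0).
by rewrite mulr1 {2}e ew; ring.
Qed.

(** The c-adic valuation, by induction on the factorization: a prime factor d raises the exponent
    exactly when it is associate to c. *)
Lemma factored_pow c x : prime_elt c -> factored x ->
  exists i x0, x = c ^+ i * x0 /\ ~ divides c x0.
Proof.
move=> cp; elim=> [u uu|d y dp _ [i [y0 [-> cy0]]]].
  by exists 0%N, u; rewrite expr0 mul1r; split=> //; exact: prime_elt_ndvd_unit.
have [c0 cu cP] := cp.
case: (pselect (divides c d)) => [cd|cd]; last first.
  exists i, (d * y0); split; first by rewrite mulrCA.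
  by move/cP => [].
have [w cE] := prime_elt_assoc cp dp cd; case: cd => z dE.
have zw : z * w = 1.
  have [d0 _ _] := dp; apply: (mulIf d0); rewrite mul1r {2}dE cE; ring.
exists i.+1, (z * y0); split; first by rewrite dE exprS; ring.
move=> [v e]; apply: cy0; exists (w * v).
by rewrite -mulrA -e mulrA [w * z]mulrC zw mul1r.
Qed.

Lemma dividesB c x y : divides c x -> divides c y -> divides c (x - y).
Proof. by move=> [z ->] [w ->]; exists (z - w); rewrite mulrBl. Qed.

Lemma factoredM x y : factored x -> factored y -> factored (x * y).
Proof.
elim=> [u uu|c z cp _ IH] fy; last by rewrite -mulrA; apply: FactoredMul => //; exact: IH.
elim: fy => [v vu|c z cp _ IH]; first by apply: FactoredUnit; rewrite unitrM uu.
by rewrite mulrCA; exact: FactoredMul.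
Qed.

End Factorial.

Lemma field_factorial (K : fieldType) : factorial_domain K.
Proof. by move=> x x0; apply: FactoredUnit; rewrite unitfE. Qed.

Lemma iso_factorial (R S : idomainType) (f : {rmorphism R -> S}) (g : S -> R) :
  cancel f g -> cancel g f -> factorial_domain R -> factorial_domain S.
Proof.
move=> fK gK fact y y0; rewrite -[y]gK.
have : factored (g y).
  by apply: fact; apply: contraNneq y0 => e; rewrite -[y]gK e rmorph0.
elim=> [u uu|c x [c0 cu cP] _ IH]; first by apply: FactoredUnit; exact: rmorph_unit.
rewrite rmorphM; apply: FactoredMul => //; split.
- by apply: contraNneq c0 => e; rewrite -[c]fK e -(rmorph0 f) fK.
- apply: contra cu => /unitrPr[z e]; apply/unitrPr; exists (g z).
  by apply: (can_inj fK); rewrite rmorphM gK e rmorph1.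
- have fdiv z : divides (f c) z <-> divides c (g z).
    split=> -[w e]; [exists (g w)|exists (f w)].
      by apply: (can_inj fK); rewrite rmorphM !gK.
    by rewrite -[z]gK e rmorphM.
  move=> a b; rewrite !fdiv => h; apply: cP; move: h.
  suff -> : g (a * b) = g a * g b by [].
  by apply: (can_inj fK); rewrite rmorphM !gK.
Qed.

(** * Gauss's lemma and factoriality of R[X] *)

Section Gauss.
Variable R : idomainType.
Hypothesis factR : factorial_domain R.
Implicit Types (c d : R) (p q s : {poly R}).

Lemma dividesCP c p : divides c%:P p <-> forall i, divides c p`_i.
Proof.
split=> [[q ->] i|/choice[f fE]]; first by exists q`_i; rewrite coefMC.
exists (\poly_(i < size p) f i); apply/polyP => i; rewrite coefMC coef_poly.
by case: ltnP => [_|/(nth_default 0) ->]; rewrite ?mul0r.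
Qed.

(** Gauss's lemma: take the least i and j for which c does not divide [p]_i[and]q[_j]. In the
    coefficient of degree i + j of p * q every other term is divisible by c. *)
Lemma prime_eltC c : prime_elt c -> prime_elt c%:P.
Proof.
move=> [c0 cu cP]; split; first by rewrite polyC_eq0.
  by rewrite poly_unitE size_polyC c0 coefC.
have ex p : ~ divides c%:P p -> exists2 i, ~ divides c p`_i &
    forall j, (j < i)%N -> divides c p`_j.
  move=> /dividesCP/existsNP[k ck].
  have exk : exists i, `[< ~ divides c p`_i >] by exists k; exact/asboolP.
  case: (ex_minnP exk) => i /asboolP ci imin; exists i => // j ji; apply: contrapT => cj.
  by move/asboolP: cj => /imin; rewrite leqNgt ji.
move=> p q /dividesCP pq; apply: contrapT => /not_orP[/ex[i ci imin] /ex[j cj jmin]].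
suff : divides c (p`_i * q`_j) by case/cP.
have io : (i < (i + j).+1)%N by rewrite ltnS leq_addr.
have := pq (i + j)%N; rewrite coefM (bigD1 (Ordinal io)) //= addKn.
set r := \sum_(_ < _ | _) _ => pqr; suff cr : divides c r.
  by rewrite -[_ * _](addrK r); exact: dividesB.
apply: (big_ind (divides c)) => [|x y cx cy|k ki].
- by exists 0; rewrite mul0r.
- by rewrite -[y]opprK; apply: dividesB => //; rewrite -sub0r; apply: dividesB => //;
    exists 0; rewrite mul0r.
have [ki'|ik|kE] := ltngtP (k : nat) i.
- by rewrite mulrC; apply: divides_mull; apply: imin.
- by apply: divides_mull; apply: jmin; have := ltn_ord k; lia.
- by case/eqP: ki; apply: val_inj.
Qed.

Lemma factoredC c : factored c -> factored c%:P.
Proof.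
elim=> [u uu|d x dp _ IH]; first by apply: FactoredUnit; exact: rmorph_unit.
by rewrite polyCM; apply: FactoredMul => //; exact: prime_eltC.
Qed.

(** Testing divisibility by prime constants avoids contents, that is, gcds of coefficients in R. *)
Definition primitive p : Prop := forall c, prime_elt c -> ~ divides c%:P p.

Lemma primitive_mulr p q : primitive (p * q) -> primitive q.
Proof. by move=> h c cp cq; apply: (h c cp); exact: divides_mull. Qed.

(* The second hypothesis ensures that the primes dividing p are among the factors of l,
   with multiplicity. *)
Lemma primitive_part_aux l : factored l -> forall p w, lead_coef p = l * w ->
  (forall c, prime_elt c -> divides c%:P p -> ~ divides c w) ->
  exists d p0, [/\ p = d%:P * p0, factored d & primitive p0].
Proof.
elim=> [u uu|c x cp _ IH] p w lE pw.
  exists 1, p; rewrite mul1r; split=> //; first by apply: FactoredUnit; exact: unitr1.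
  move=> d dp dvp; apply: (pw d dp dvp); have [_ _ dP] := dp.
  have /dP[du|//] : divides d (u * w) by rewrite -lE lead_coefE; exact: ((dividesCP d p).1 dvp).
  by case: (prime_elt_ndvd_unit dp uu du).
case: (pselect (divides c%:P p)) => [[q pE]|cNp].
  have [|d dp dq|d [p0 [qE fd p0P]]] := IH q w.
  - have [c0 _ _] := cp; apply: (mulIf c0).
    by have := lE; rewrite pE lead_coefM lead_coefC => ->; ring.
  - by apply: pw => //; rewrite pE mulrC; exact: divides_mull.
  - by exists (c * d), p0; rewrite pE qE polyCM; split; [ring|exact: FactoredMul|].
(* Here c does not divide p, so it moves from the unprocessed part of the leading coefficient into
   the cofactor w. *)
apply: (IH p (c * w)) => [|d dp dq]; first by rewrite lE; ring.
have [_ _ dP] := dp; case/dP => [/(prime_elt_assoc dp cp) cd|]; last exact: pw.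
apply: cNp; case: cd => z dE; case: dq => r ->; rewrite dE polyCM mulrA.
by apply: divides_mull; exists 1; rewrite mul1r.
Qed.

Lemma primitive_part p : p != 0 ->
  exists d p0, [/\ p = d%:P * p0, factored d & primitive p0].
Proof.
move=> p0; have fl : factored (lead_coef p) by apply: factR; rewrite lead_coef_eq0.
apply: (primitive_part_aux fl (w := 1)).
- by rewrite mulr1.
- by move=> c cp _; apply: prime_elt_ndvd_unit => //; exact: unitr1.
Qed.

(** Brings a factorization over the fraction field down to R: each prime factor of d divides s or g
    by [prime_eltC], and cancelling it there keeps the sizes. *)
Lemma cancel_scale_factors d : factored d -> forall p s g, d%:P * p = s * g ->
  exists s' g', [/\ p = s' * g', size s' = size s & size g' = size g].
Proof.
elim=> [u uu|c x cp _ IH] p s g e.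
  exists ((u^-1)%:P * s), g; split=> //; last first.
    by rewrite mul_polyC size_scale // invr_eq0; apply: contraTneq uu => ->; rewrite unitr0.
  by rewrite -mulrA -e mulrA -polyCM mulVr // mul1r.
have [c0 _ _] := cp; have cP0 : c%:P != 0 :> {poly R} by rewrite polyC_eq0.
have [_ _ /(_ s g)[]] := prime_eltC cp.
- by rewrite -e; exists (x%:P * p); rewrite polyCM; ring.
- move=> [s1 sE]; have [|s' [g' [-> s's g'g]]] := IH p s1 g.
    by apply: (mulIf cP0); rewrite -mulrA mulrAC -sE mulrC -e polyCM; ring.
  by exists s', g'; rewrite sE [s1 * _]mulrC mul_polyC size_scale.
- move=> [g1 gE]; have [|s' [g' [-> s's g'g]]] := IH p s g1.
    by apply: (mulIf cP0); rewrite -[RHS]mulrA -gE -e polyCM; ring.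
  by exists s', g'; rewrite gE [g1 * _]mulrC mul_polyC size_scale.
Qed.

(** Each prime factor of d divides q * p but not the primitive p, so it can be cancelled from q. *)
Lemma primitive_cancel d : factored d -> forall p q b, primitive p ->
  d%:P * b = q * p -> divides p b.
Proof.
elim=> [u uu|c x cp _ IH] p q b pp e.
  by exists ((u^-1)%:P * q); rewrite -mulrA -e mulrA -polyCM mulVr // mul1r.
have [c0 _ _] := cp; have cP0 : c%:P != 0 :> {poly R} by rewrite polyC_eq0.
have [_ _ /(_ q p)[]] := prime_eltC cp; last by move/(pp c cp).
  by rewrite -e; exists (x%:P * b); rewrite polyCM; ring.
move=> [q1 qE]; apply: (IH p q1) => //.
by apply: (mulIf cP0); rewrite [RHS]mulrAC -qE -e polyCM; ring.
Qed.

(* A primitive polynomial without factors of smaller degree is irreducible over the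
   fraction field; in mathcomp, %| on {poly R} is divisibility over the fraction field. *)
Lemma primitive_prime p : (1 < size p)%N -> primitive p ->
  (forall a b, p = a * b -> (size a <= 1)%N \/ (size b <= 1)%N) -> prime_elt p.
Proof.
move=> p1 pp irr; have p0 : p != 0 by rewrite -size_poly_gt0 ltnW.
split=> // [|a b [r abE]].
  by rewrite poly_unitE; apply/negP => /andP[/eqP e]; rewrite e in p1.
have divE f : (p %| f)%R -> divides p f.
  move=> /Pdiv.Idomain.dvdpP[[d q] /= d0 e].
  by apply: (primitive_cancel (factR d0) pp (q := q)); rewrite mul_polyC.
have [cop|ncop] := boolP (coprimep p a).
  right; apply: divE; rewrite -(Gauss_dvdpr _ cop) abE.
  exact: dvdp_mull.
left; apply: divE; have /Pdiv.Idomain.dvdpP[[d q] /= d0 e] := dvdp_gcdl p a.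
(* The relation between p and its gcd with a holds over the fraction field; it becomes a
   factorization in R with the same degrees. A constant cofactor makes p divide a, while a constant
   gcd contradicts non-coprimality. *)
have [|s' [g' [pE ss gg]]] := cancel_scale_factors (factR d0) (p := p) (s := q) (g := gcdp p a).
  by rewrite mul_polyC.
apply: dvdp_trans (dvdp_gcdr p a).
have q0 : q != 0.
  by apply: contraNneq p0 => q0; move/eqP: e;
    rewrite q0 mul0r -mul_polyC mulf_eq0 polyC_eq0 (negbTE d0).
case: (irr _ _ pE); rewrite ?ss ?gg => sz.
  have /size_poly1P[k k0 qE] : size q == 1%N by rewrite eqn_leq sz size_poly_gt0.
  apply/Pdiv.Idomain.dvdpP; exists (k, d%:P); rewrite //=.
  by rewrite mul_polyC e qE mul_polyC.
case/negP: ncop; rewrite coprimep_def eqn_leq sz size_poly_gt0 gcdp_eq0.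
by rewrite (negbTE p0).
Qed.

Lemma primitive_factored p : p != 0 -> primitive p -> factored p.
Proof.
have [n] := ubnP (size p); elim: n p => // n IH p sn p0 pp.
case: (leqP (size p) 1) => p1.
  have pE := size1_polyC p1; rewrite pE; apply: factoredC; apply: factR.
  by rewrite -polyC_eq0 -pE.
case: (pselect (forall a b, p = a * b -> (size a <= 1)%N \/ (size b <= 1)%N)) => [irr|].
  rewrite -[p]mulr1; apply: FactoredMul; first exact: primitive_prime.
  by apply: FactoredUnit; exact: unitr1.
move=> /existsNP[a /existsNP[b /not_implyP[pE /not_orP[/negP sa /negP sb]]]].
rewrite -!ltnNge in sa sb; move: p0; rewrite pE mulf_eq0 negb_or => /andP[a0 b0].
have sab : size p = (size a + size b).-1 by rewrite pE size_mul.
apply: factoredM; apply: IH => //.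
- lia.
- by apply: (@primitive_mulr b); rewrite mulrC -pE.
- lia.
- by apply: (@primitive_mulr a); rewrite -pE.
Qed.

Lemma poly_factorial : factorial_domain {poly R}.
Proof.
move=> p p0; have [d [q [pE fd qP]]] := primitive_part p0.
rewrite pE; apply: factoredM; first exact: factoredC.
apply: primitive_factored => //; apply: contraNneq p0 => q0.
by rewrite pE q0 mulr0.
Qed.

End Gauss.

(** * Polynomials in n + 1 variables as univariate polynomials over those in n variables *)

Lemma mpoly_rmorph_ext n (R : comNzRingType) (S : pzRingType)
    (f g : {rmorphism {mpoly R[n]} -> S}) :
  (forall c, f c%:MP = g c%:MP) -> (forall i, f 'X_i = g 'X_i) -> f =1 g.
Proof.
move=> fgC fgX p; rewrite [p]mpolyE !rmorph_sum; apply: eq_bigr => m _.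
rewrite -mul_mpolyC !rmorphM fgC mpolyXE_id !rmorph_prod; congr (_ * _).
by apply: eq_bigr => i _; rewrite !rmorphXn fgX.
Qed.

Section Muni.
Variables (n : nat) (R : comNzRingType).

Lemma muniX_max : muni ('X_ord_max : {mpoly R[n.+1]}) = 'X.
Proof.
rewrite /muni mmapX mmap1U; case: splitP => // j /= e.
by have := ltn_ord j; rewrite -e ltnn.
Qed.

Lemma muniX_widen (i : 'I_n) :
  muni ('X_(widen_ord (leqnSn n) i) : {mpoly R[n.+1]}) = ('X_i)%:P.
Proof.
rewrite /muni mmapX mmap1U; case: splitP => [j /= e|j /= e].
  by congr (('X__)%:P); exact: val_inj.
by have := ltn_ord i; rewrite e ord1 addn0 ltnn.
Qed.

Lemma muni_mwiden (c : {mpoly R[n]}) : muni (mwiden c) = c%:P.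
Proof.
have h : (@muni n R) \o (@mwiden n R) =1 polyC.
  apply: mpoly_rmorph_ext => [a|i] /=; first by rewrite mwidenC muniC.
  by rewrite mwidenX mnmwiden1 muniX_widen.
exact: h.
Qed.

Definition poly_mpoly (p : {poly {mpoly R[n]}}) : {mpoly R[n.+1]} :=
  (map_poly (@mwiden n R) p).['X_ord_max].

Fact poly_mpoly_is_zmod_morphism : zmod_morphism poly_mpoly.
Proof. by move=> p q; rewrite /poly_mpoly rmorphB hornerD hornerN. Qed.
Fact poly_mpoly_is_monoid_morphism : monoid_morphism poly_mpoly.
Proof.
by split=> [|p q]; rewrite /poly_mpoly ?rmorph1 ?hornerC // rmorphM hornerM.
Qed.
HB.instance Definition _ := GRing.isZmodMorphism.Build _ _ poly_mpoly
  poly_mpoly_is_zmod_morphism.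
HB.instance Definition _ := GRing.isMonoidMorphism.Build _ _ poly_mpoly
  poly_mpoly_is_monoid_morphism.

Lemma poly_mpolyC c : poly_mpoly c%:P = mwiden c.
Proof. by rewrite /poly_mpoly map_polyC hornerC. Qed.

Lemma poly_mpolyX : poly_mpoly 'X = 'X_ord_max.
Proof. by rewrite /poly_mpoly map_polyX hornerX. Qed.

Lemma poly_mpolyK : cancel poly_mpoly (@muni n R).
Proof.
elim/poly_ind => [|p c IH]; first by rewrite !rmorph0.
by rewrite rmorphD rmorphM /= poly_mpolyC poly_mpolyX rmorphD rmorphM /= IH muniX_max
  muni_mwiden.
Qed.

Lemma muniK : cancel (@muni n R) poly_mpoly.
Proof.
have h : poly_mpoly \o @muni n R =1 idfun; last exact: h.
apply: mpoly_rmorph_ext => [a|i] /=.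
  by rewrite muniC poly_mpolyC mwidenC.
case: (unliftP ord_max i) => [j|] ->; last by rewrite muniX_max poly_mpolyX.
rewrite (_ : lift ord_max j = widen_ord (leqnSn n) j); last first.
  by apply: val_inj; exact: lift_max.
by rewrite muniX_widen poly_mpolyC mwidenX mnmwiden1.
Qed.

End Muni.

Lemma mpoly0_factorial (K : fieldType) : factorial_domain {mpoly K[0]}.
Proof.
have fK : cancel (@mpolyC 0 K) (mcoeff 0) by move=> c; rewrite mcoeffC eqxx mulr1.
have gK : cancel (mcoeff 0) (@mpolyC 0 K).
  move=> p; apply/mpolyP => m; rewrite mcoeffC.
  by rewrite (_ : m = 0%MM) ?eqxx ?mulr1 //; apply/mnmP => -[].
exact: (iso_factorial fK gK (@field_factorial K)).
Qed.
Lemma mpolyS_factorial (K : fieldType) n :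
  factorial_domain {mpoly K[n]} -> factorial_domain {mpoly K[n.+1]}.
Proof.
move=> IH.
have h : factorial_domain {poly {mpoly K[n]}} by exact: poly_factorial.
exact: (iso_factorial (@poly_mpolyK n K) (@muniK n K) h).
Qed.

Lemma mpoly_factorial n (K : fieldType) : factorial_domain {mpoly K[n]}.
Proof. by elim: n => [|n IH]; [exact: mpoly0_factorial|exact: mpolyS_factorial]. Qed.

(** * Exact sequences of sheaves and the Godement embedding *)

Local Open Scope quotient_scope.
Local Open Scope classical_set_scope.

Section Sheaves.
Variable X : topologicalType.
Implicit Types (U V W T : opens X) (F G H : sheaf X) (x y : X).

Lemma setI_subl U V : opens_setI U V `<=` U. Proof. by move=> x []. Qed.
Lemma setI_subr U V : opens_setI U V `<=` V. Proof. by move=> x []. Qed.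
Lemma subT U : U `<=` opens_setT X. Proof. by []. Qed.

Lemma res_irr F U V (VU VU' : V `<=` U) (s : F U) : res F VU s = res F VU' s.
Proof. by rewrite (Prop_irrelevance VU VU'). Qed.

Lemma res2 F U V W (VU : V `<=` U) (WV : W `<=` V) (s : F U) :
  res F WV (res F VU s) = res F (subset_trans WV VU) s.
Proof. exact: res_comp. Qed.

Lemma sheaf_sep F U (s t : F U) :
  (forall x, opens_set U x -> exists W (WU : W `<=` U),
     opens_set W x /\ res F WU s = res F WU t) -> s = t.
Proof.
move=> loc; pose I := {x | opens_set U x}.
have cW (i : I) : {W : opens X & {WU : W `<=` U |
    opens_set W (projT1 i) /\ res F WU s = res F WU t}}.
  case: i => x Ux; have /cid[W /cid h] := loc x Ux; by exists W.
pose W i := projT1 (cW i); pose WU i : W i `<=` U := projT1 (projT2 (cW i)).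
have WP i : opens_set (W i) (projT1 i) /\ res F (WU i) s = res F (WU i) t.
  exact: (projT2 (projT2 (cW i))).
have cov : U `<=` \bigcup_i W i.
  by move=> x Ux; exists (exist _ x Ux) => //; case: (WP (exist _ x Ux)).
have [|r [_ rU]] := sheafP WU cov (s := fun i => res F (WU i) s).
  by move=> i j T Ti Tj; rewrite !res2; exact: res_irr.
by rewrite -(rU s) // (rU t) // => i; case: (WP i).
Qed.

(** The predicate P describes a compatible family without an index set; the glued section restricts
    to every member of P inside U, not only to those of the cover chosen in the proof. *)
Lemma sheaf_glue F U (P : forall W, F W -> Prop) :
  (forall x, opens_set U x -> exists W (WU : W `<=` U) (t : F W), opens_set W x /\ P W t) ->
  (forall W W' (t : F W) (t' : F W'), P W t -> P W' t' ->
     forall T (TW : T `<=` W) (TW' : T `<=` W'), res F TW t = res F TW' t') ->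
  exists t : F U, forall W (WU : W `<=` U) (t' : F W), P W t' -> res F WU t = t'.
Proof.
move=> loc comp; pose I := {x | opens_set U x}.
have cW (i : I) : {W : opens X & {WU : W `<=` U & {t : F W |
    opens_set W (projT1 i) /\ P W t}}}.
  by case: i => x Ux; have /cid[W /cid[WU /cid h]] := loc x Ux; exists W, WU.
pose W i := projT1 (cW i); pose WU i : W i `<=` U := projT1 (projT2 (cW i)).
pose t i : F (W i) := projT1 (projT2 (projT2 (cW i))).
have WP i : opens_set (W i) (projT1 i) /\ P (W i) (t i).
  exact: (projT2 (projT2 (projT2 (cW i)))).
have cov : U `<=` \bigcup_i W i.
  by move=> x Ux; exists (exist _ x Ux) => //; case: (WP (exist _ x Ux)).
have [|r [rE _]] := sheafP WU cov (s := t).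
  by move=> i j T Ti Tj; apply: comp; [case: (WP i)|case: (WP j)].
exists r => V VU t' Pt'; apply: sheaf_sep => x Vx.
pose i : I := exist _ x (VU x Vx); have [Wx Pt] := WP i.
exists (opens_setI V (W i)), (@setI_subl _ _); split; first by split.
rewrite res2 -(comp _ _ _ _ Pt Pt' _ (@setI_subr _ _)) -rE res2.
exact: res_irr.
Qed.

(** Only a subpresheaf of subgroups: no gluing is required, because the quotient below sees its
    germs alone. This admits images of sheaf maps. *)
Record subpre G := SubPre {
  sp :> forall U, G U -> Prop;
  sp0 : forall U, sp (0 : G U);
  spB : forall U (s t : G U), sp s -> sp t -> sp (s - t);
  sp_res : forall U V (VU : V `<=` U) (s : G U), sp s -> sp (res G VU s) }.
Arguments sp {G} _ U _.

Section SubPre.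
Variables (G : sheaf X) (N : subpre G).

Lemma spN U (s : G U) : N U s -> N U (- s).
Proof. by move=> Ns; rewrite -sub0r; apply: spB => //; exact: sp0. Qed.

Lemma spD U (s t : G U) : N U s -> N U t -> N U (s + t).
Proof. by move=> Ns Nt; rewrite -[t]opprK; apply: spB => //; exact: spN. Qed.

End SubPre.

(* The stalk at [x] of the presheaf quotient G/N. *)
Section Stalk.
Variables (G : sheaf X) (N : subpre G) (x : X).

Record pregerm := Pregerm {
  pg_dom : opens X; pg_in : opens_set pg_dom x; pg_val : G pg_dom }.

HB.instance Definition _ := gen_eqMixin pregerm.
HB.instance Definition _ := gen_choiceMixin pregerm.

Definition germ_eqv (g h : pregerm) : bool :=
  `[< exists T (Tg : T `<=` pg_dom g) (Th : T `<=` pg_dom h),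
      opens_set T x /\ N T (res G Tg (pg_val g) - res G Th (pg_val h)) >].

Fact germ_eqv_equiv : equiv_class_of germ_eqv.
Proof.
split=> [g|g h|h g k].
- apply/asboolP; exists (pg_dom g), (@subset_refl _ _), (@subset_refl _ _).
  by split; [exact: pg_in|rewrite subrr; exact: sp0].
- by apply/asboolP/asboolP => -[T [Tg [Th [Tx NT]]]]; exists T, Th, Tg;
    rewrite -opprB; split=> //; exact: spN.
move=> /asboolP[T [Tg [Th [Tx NT]]]] /asboolP[S [Sg [Sh [Sx NS]]]].
apply/asboolP; exists (opens_setI T S).
exists (subset_trans (@setI_subl T S) Tg), (subset_trans (@setI_subr T S) Sh).
split; first by split.
have := spD (sp_res (@setI_subl T S) NT) (sp_res (@setI_subr T S) NS).
rewrite !raddfB /= !res2.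
by rewrite (res_irr (subset_trans (@setI_subr T S) Sg)
  (subset_trans (@setI_subl T S) Th)) addrA subrK.
Qed.
Canonical germ_eqv_rel := EquivRelPack germ_eqv_equiv.
Canonical germ_eqv_encModRel := defaultEncModRel germ_eqv.

Definition stalk := {eq_quot germ_eqv}.

Definition germ_at U (Ux : opens_set U x) (s : G U) : stalk := \pi_stalk (Pregerm Ux s).

Lemma germ_atE U V (Ux : opens_set U x) (Vx : opens_set V x) (s : G U) (t : G V) :
  germ_at Ux s = germ_at Vx t <->
  exists T (TU : T `<=` U) (TV : T `<=` V),
    opens_set T x /\ N T (res G TU s - res G TV t).
Proof.
split=> [/eqP|e]; last by apply/eqP; rewrite /germ_at piE; apply/asboolP.
by rewrite /germ_at piE => /asboolP.
Qed.

Lemma germ_atP (P : stalk -> Prop) :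
  (forall U (Ux : opens_set U x) s, P (germ_at Ux s)) -> forall z, P z.
Proof.
by move=> h z; rewrite -[z]reprK; case: (repr z) => U Ux s; exact: h.
Qed.

Lemma germ_res U V (VU : V `<=` U) (Vx : opens_set V x) (Ux : opens_set U x) (s : G U) :
  germ_at Vx (res G VU s) = germ_at Ux s.
Proof.
apply/germ_atE; exists V, (@subset_refl _ _), VU; split=> //.
by rewrite res_id subrr; exact: sp0.
Qed.

Definition germ_add (a b : stalk) : stalk :=
  germ_at (conj (pg_in (repr a)) (pg_in (repr b)) :
      opens_set (opens_setI (pg_dom (repr a)) (pg_dom (repr b))) x)
    (res G (@setI_subl _ _) (pg_val (repr a)) + res G (@setI_subr _ _) (pg_val (repr b))).

Definition germ_opp (a : stalk) : stalk :=
  germ_at (pg_in (repr a)) (- pg_val (repr a)).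

Lemma repr_germ U (Ux : opens_set U x) (s : G U) :
  germ_at (pg_in (repr (germ_at Ux s))) (pg_val (repr (germ_at Ux s))) = germ_at Ux s.
Proof. by rewrite -[RHS]reprK /germ_at; case: (repr _). Qed.

Lemma germ_addE U (Ux : opens_set U x) (s t : G U) :
  germ_add (germ_at Ux s) (germ_at Ux t) = germ_at Ux (s + t).
Proof.
have /germ_atE[S [Sl [Sr [Sx NS]]]] := repr_germ Ux s.
have /germ_atE[T [Tl [Tr [Tx NT]]]] := repr_germ Ux t.
apply/germ_atE; exists (opens_setI S T).
have lP : opens_setI S T `<=` opens_setI (pg_dom (repr (germ_at Ux s)))
    (pg_dom (repr (germ_at Ux t))).
  by move=> y [Sy Ty]; exact: (conj (Sl y Sy) (Tl y Ty)).
exists lP, (subset_trans (@setI_subl S T) Sr); split; first by split.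
have := spD (sp_res (@setI_subl S T) NS) (sp_res (@setI_subr S T) NT).
rewrite !raddfB !raddfD /= !res2 addrACA -!opprD.
rewrite (res_irr (subset_trans (@setI_subr S T) Tr) (subset_trans (@setI_subl S T) Sr) t).
rewrite (res_irr (subset_trans lP _) (subset_trans (@setI_subl S T) Sl)).
by rewrite (res_irr (subset_trans lP _) (subset_trans (@setI_subr S T) Tl)) opprD.
Qed.

Lemma germ_oppE U (Ux : opens_set U x) (s : G U) :
  germ_opp (germ_at Ux s) = germ_at Ux (- s).
Proof.
have /germ_atE[S [Sl [Sr [Sx NS]]]] := repr_germ Ux s.
apply/germ_atE; exists S, Sl, Sr; split=> //.
by rewrite !raddfN -opprD; exact: spN.
Qed.

Lemma germ_at2 (a b : stalk) : exists U (Ux : opens_set U x) s t,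
  a = germ_at Ux s /\ b = germ_at Ux t.
Proof.
elim/germ_atP: a => U Ux s; elim/germ_atP: b => V Vx t.
exists (opens_setI U V), (conj Ux Vx), (res G (@setI_subl _ _) s),
  (res G (@setI_subr _ _) t).
by rewrite !(germ_res _ _ Ux) !(germ_res _ _ Vx).
Qed.

Fact germ_addC : commutative germ_add.
Proof.
by move=> a b; have [U [Ux [s [t [-> ->]]]]] := germ_at2 a b; rewrite !germ_addE addrC.
Qed.
Fact germ_addA : associative germ_add.
Proof.
move=> a b c; have [U [Ux [s [t [-> ->]]]]] := germ_at2 a b.
elim/germ_atP: c => V Vx r.
pose W := opens_setI U V; pose Wx : opens_set W x := conj Ux Vx.
rewrite -(germ_res (@setI_subl U V) Wx) -(germ_res (@setI_subl U V) Wx Ux t).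
by rewrite -(germ_res (@setI_subr U V) Wx) !germ_addE addrA.
Qed.
Definition germ0 : stalk := @germ_at (opens_setT X) I 0.
Lemma germ0E U (Ux : opens_set U x) : germ_at Ux 0 = germ0.
Proof.
by rewrite /germ0 -(germ_res (@subT U) Ux) raddf0.
Qed.
Fact germ_add0 : left_id germ0 germ_add.
Proof. by elim/germ_atP=> U Ux s; rewrite -(germ0E Ux) germ_addE add0r. Qed.
Fact germ_addN : left_inverse germ0 germ_opp germ_add.
Proof. by elim/germ_atP=> U Ux s; rewrite germ_oppE germ_addE addNr germ0E. Qed.

HB.instance Definition _ := Choice.on stalk.
HB.instance Definition _ :=
  GRing.isZmodule.Build stalk germ_addA germ_addC germ_add0 germ_addN.

Fact germ_at_is_zmod_morphism U (Ux : opens_set U x) : zmod_morphism (germ_at Ux).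
Proof. by move=> s t; rewrite -germ_addE -germ_oppE. Qed.
HB.instance Definition _ U (Ux : opens_set U x) :=
  GRing.isZmodMorphism.Build (G U) stalk (germ_at Ux) (germ_at_is_zmod_morphism Ux).

Lemma germ_eq0 U (Ux : opens_set U x) (s : G U) : germ_at Ux s = 0 <->
  exists W (WU : W `<=` U), opens_set W x /\ N W (res G WU s).
Proof.
rewrite -(raddf0 (germ_at Ux)); split=> [/germ_atE[T [TU [TV [Tx]]]]|].
  by rewrite raddf0 subr0; exists T, TU.
by case=> W [WU [Wx Ns]]; apply/germ_atE; exists W, WU, WU; rewrite raddf0 subr0.
Qed.

End Stalk.

End Sheaves.

Arguments sp {X G} _ U _.

(** * Sheaves of discontinuous sections of a family of groups *)

Section Sky.
Variables (X : topologicalType) (M : X -> zmodType).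
Implicit Types U V W : opens X.

Record sky U := Sky { sky_at :> forall x, opens_set U x -> M x }.

HB.instance Definition _ U := gen_eqMixin (sky U).
HB.instance Definition _ U := gen_choiceMixin (sky U).

Lemma sky_eq U (s t : sky U) : (forall x Ux, s x Ux = t x Ux) -> s = t.
Proof.
case: s t => [s] [t] /= e; congr Sky.
by apply: functional_extensionality_dep => x; apply: funext.
Qed.

Lemma sky_irr U (s : sky U) x (Ux Ux' : opens_set U x) : s x Ux = s x Ux'.
Proof. by rewrite (Prop_irrelevance Ux Ux'). Qed.

Section Operations.
Variable U : opens X.

Definition sky_zero : sky U := Sky (fun _ _ => 0).
Definition sky_add (s t : sky U) : sky U := Sky (fun x Ux => s x Ux + t x Ux).
Definition sky_opp (s : sky U) : sky U := Sky (fun x Ux => - s x Ux).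

Fact sky_addA : associative sky_add.
Proof. by move=> s t r; apply: sky_eq => x Ux; exact: addrA. Qed.
Fact sky_addC : commutative sky_add.
Proof. by move=> s t; apply: sky_eq => x Ux; exact: addrC. Qed.
Fact sky_add0 : left_id sky_zero sky_add.
Proof. by move=> s; apply: sky_eq => x Ux; exact: add0r. Qed.
Fact sky_addN : left_inverse sky_zero sky_opp sky_add.
Proof. by move=> s; apply: sky_eq => x Ux; exact: addNr. Qed.

HB.instance Definition _ :=
  GRing.isZmodule.Build (sky U) sky_addA sky_addC sky_add0 sky_addN.

End Operations.

Definition sky_res U V (VU : V `<=` U) (s : sky U) : sky V :=
  Sky (fun x Vx => s x (VU x Vx)).

Fact sky_res_is_zmod_morphism U V (VU : V `<=` U) : zmod_morphism (sky_res VU).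
Proof. by move=> s t; exact: sky_eq. Qed.
HB.instance Definition _ U V (VU : V `<=` U) :=
  GRing.isZmodMorphism.Build (sky U) (sky V) (sky_res VU) (sky_res_is_zmod_morphism VU).

Fact sky_res_id U (UU : U `<=` U) (s : sky U) : sky_res UU s = s.
Proof. by apply: sky_eq => x Ux /=; exact: sky_irr. Qed.

Fact sky_res_comp U V W (VU : V `<=` U) (WV : W `<=` V) (WU : W `<=` U) (s : sky U) :
  sky_res WV (sky_res VU s) = sky_res WU s.
Proof. by apply: sky_eq => x Ux /=; exact: sky_irr. Qed.

Fact sky_sheaf_axiom : sheaf_axiom (fun U V (VU : V `<=` U) => @sky_res U V VU).
Proof.
move=> U J W WU cov s comp.
have comp' i j p (Wi : opens_set (W i) p) (Wj : opens_set (W j) p) :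
    s i p Wi = s j p Wj.
  have e := comp i j (opens_setI (W i) (W j)) (@setI_subl _ _ _) (@setI_subr _ _ _).
  have := congr1 (fun t : sky (opens_setI (W i) (W j)) => t p (conj Wi Wj)) e.
  by rewrite /= (sky_irr _ _ Wi) (sky_irr _ _ Wj).
have cov' p (Up : opens_set U p) : {i : J | opens_set (W i) p}.
  by apply: cid; have [i _ Wi] := cov p Up; exists i.
exists (Sky (fun p Up => s (projT1 (cov' p Up)) p (projT2 (cov' p Up)))).
split=> [i|r rE]; apply: sky_eq => p Wp /=; first exact: comp'.
have [i Wi] := cov' p Wp; rewrite -rE /=; exact: sky_irr.
Qed.

Definition sky_sheaf : sheaf X :=
  @Sheaf X (fun U => sky U : zmodType)
    (fun U V VU => @sky_res U V VU : {additive sky U -> sky V})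
    sky_res_id sky_res_comp sky_sheaf_axiom.

Lemma sky_res_onto U V (VU : V `<=` U) (s : sky V) : exists t, sky_res VU t = s.
Proof.
exists (Sky (fun x (_ : opens_set U x) => match pselect (opens_set V x) with
  | left Vx => s x Vx | right _ => 0 end)).
by apply: sky_eq => x Vx /=; case: pselect => // Vx'; exact: sky_irr.
Qed.

End Sky.

(** * Quotient sheaves *)

Section Coker.
Variables (X : topologicalType) (G : sheaf X) (N : subpre G).
Implicit Types U V W : opens X.

(** The sheafification of G/N, realised inside the product of the stalks as the families that
    locally come from a section of G. *)
Definition loc_germ U : {pred sky (stalk N) U} := fun s =>
  `[< forall x, opens_set U x -> exists W (WU : W `<=` U) (g : G W),
      opens_set W x /\ forall y (Wy : opens_set W y), s y (WU y Wy) = germ_at N Wy g >].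

Fact loc_germ_zmod_closed U : zmod_closed (@loc_germ U).
Proof.
split=> [|s t]; rewrite !unfold_in.
  apply/asboolP => x Ux.
  by exists U, (@subset_refl _ _), 0; split=> // y Wy /=; rewrite raddf0.
move=> /asboolP sP /asboolP tP; apply/asboolP => x Ux.
have [W [WU [g [Wx sE]]]] := sP x Ux; have [V [VU [h [Vx tE]]]] := tP x Ux.
exists (opens_setI W V), (subset_trans (@setI_subl _ W V) WU).
exists (res G (@setI_subl _ W V) g - res G (@setI_subr _ W V) h); split=> [//|y [Wy Vy]].
rewrite raddfB /= !(germ_res _ _ _ Wy) !(germ_res _ _ _ Vy) /= -sE -tE.
by congr (_ - _); exact: sky_irr.
Qed.
HB.instance Definition _ U :=
  GRing.isZmodClosed.Build (sky (stalk N) U) (@loc_germ U) (@loc_germ_zmod_closed U).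

Record coker U := Coker { coker_val :> sky (stalk N) U; cokerP : coker_val \in @loc_germ U }.
HB.instance Definition _ U := [isSub for @coker_val U].
HB.instance Definition _ U := [Choice of coker U by <:].
HB.instance Definition _ U := [SubChoice_isSubZmodule of coker U by <:].

Lemma coker_eq U (s t : coker U) : (forall x Ux, s x Ux = t x Ux) -> s = t.
Proof. by move=> e; apply: val_inj; exact: sky_eq. Qed.

Lemma coker_loc U (s : coker U) x : opens_set U x ->
  exists W (WU : W `<=` U) (g : G W),
    opens_set W x /\ forall y (Wy : opens_set W y), s y (WU y Wy) = germ_at N Wy g.
Proof. by have := cokerP s; rewrite unfold_in => /asboolP; exact. Qed.

Fact coker_res_subproof U V (VU : V `<=` U) (s : coker U) :
  sky_res VU s \in @loc_germ V.
Proof.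
rewrite unfold_in; apply/asboolP => x Vx.
have [W [WU [g [Wx gE]]]] := coker_loc s (VU x Vx).
exists (opens_setI W V), (@setI_subr _ W V), (res G (@setI_subl _ W V) g).
split=> [//|y [Wy Vy]]; rewrite (germ_res _ _ _ Wy) -gE /=; exact: sky_irr.
Qed.
Definition coker_res U V (VU : V `<=` U) (s : coker U) : coker V :=
  Coker (coker_res_subproof VU s).

Fact coker_res_is_zmod_morphism U V (VU : V `<=` U) : zmod_morphism (coker_res VU).
Proof. by move=> s t; exact: coker_eq. Qed.
HB.instance Definition _ U V (VU : V `<=` U) :=
  GRing.isZmodMorphism.Build (coker U) (coker V) (coker_res VU)
    (coker_res_is_zmod_morphism VU).

Fact coker_res_id U (UU : U `<=` U) (s : coker U) : coker_res UU s = s.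
Proof. by apply: coker_eq => x Ux /=; exact: sky_irr. Qed.

Fact coker_res_comp U V W (VU : V `<=` U) (WV : W `<=` V) (WU : W `<=` U) (s : coker U) :
  coker_res WV (coker_res VU s) = coker_res WU s.
Proof. by apply: coker_eq => x Ux /=; exact: sky_irr. Qed.

Fact coker_sheaf_axiom : sheaf_axiom (fun U V (VU : V `<=` U) => @coker_res U V VU).
Proof.
move=> U J W WU cov s comp.
have [i j T Ti Tj|t [tE tU]] := sky_sheaf_axiom WU cov (s := fun i => s i : sky _ _).
  by have /(congr1 (@coker_val _)) := comp i j T Ti Tj.
have tP : t \in @loc_germ U.
  rewrite unfold_in; apply/asboolP => x Ux; have [i _ Wx] := cov x Ux.
  have [V [VW [g [Vx gE]]]] := coker_loc (s i) Wx.
  exists V, (subset_trans VW (WU i)), g; split=> // y Vy; rewrite -gE -tE /=.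
  exact: sky_irr.
exists (Coker tP); split=> [i|r rE]; apply: val_inj => /=; first exact: tE.
by apply: tU => i; rewrite -rE.
Qed.

Definition coker_sheaf : sheaf X :=
  @Sheaf X (fun U => coker U : zmodType)
    (fun U V VU => @coker_res U V VU : {additive coker U -> coker V})
    coker_res_id coker_res_comp coker_sheaf_axiom.

Fact coker_proj_subproof U (g : G U) :
  Sky (fun x Ux => germ_at N Ux g) \in @loc_germ U.
Proof.
rewrite unfold_in; apply/asboolP => x Ux; exists U, (@subset_refl _ _), g.
by split=> // y Wy /=; congr germ_at; exact: Prop_irrelevance.
Qed.
Definition coker_proj_map U (g : G U) : coker U := Coker (coker_proj_subproof g).

Fact coker_proj_is_zmod_morphism U : zmod_morphism (@coker_proj_map U).
Proof. by move=> s t; apply: coker_eq => x Ux /=; exact: raddfB. Qed.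
HB.instance Definition _ U :=
  GRing.isZmodMorphism.Build (G U) (coker U) (@coker_proj_map U)
    (coker_proj_is_zmod_morphism (U := U)).

Fact coker_proj_res U V (VU : V `<=` U) (s : G U) :
  coker_proj_map (res G VU s) = coker_res VU (coker_proj_map s).
Proof. by apply: coker_eq => x Ux /=; exact: germ_res. Qed.

Definition coker_proj : sheaf_hom G coker_sheaf :=
  @SheafHom X G coker_sheaf
    (fun U => @coker_proj_map U : {additive G U -> coker_sheaf U}) coker_proj_res.

Lemma coker_proj_eq0 U (s : G U) : coker_proj U s = 0 <->
  forall x, opens_set U x -> exists W (WU : W `<=` U), opens_set W x /\ N W (res G WU s).
Proof.
split=> [e x Ux|h].
  by apply/(germ_eq0 N Ux); exact: (congr1 (fun t : coker U => t x Ux) e).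
by apply: coker_eq => x Ux /=; apply/germ_eq0; exact: h.
Qed.

Lemma coker_proj_loc U (s : coker_sheaf U) x : opens_set U x ->
  exists W (WU : W `<=` U) (g : G W),
    opens_set W x /\ coker_proj W g = res coker_sheaf WU s.
Proof.
move=> Ux; have [W [WU [g [Wx gE]]]] := coker_loc s Ux; exists W, WU, g; split=> //.
by apply: coker_eq => y Wy /=; rewrite gE.
Qed.

End Coker.

Section StalkMap.
Variables (X : topologicalType) (G G' : sheaf X) (N : subpre G) (N' : subpre G').
Variable f : sheaf_hom G G'.
Hypothesis fN : forall U (s : G U), N U s -> N' U (f U s).
Implicit Types U V W : opens X.

Definition stalk_map x (a : stalk N x) : stalk N' x :=
  germ_at N' (pg_in (repr a)) (f _ (pg_val (repr a))).

Lemma stalk_mapE x U (Ux : opens_set U x) (s : G U) :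
  stalk_map (germ_at N Ux s) = germ_at N' Ux (f U s).
Proof.
have /germ_atE[S [Sl [Sr [Sx NS]]]] := repr_germ N Ux s.
apply/germ_atE; exists S, Sl, Sr; split=> //.
by rewrite -!sheaf_map_res -raddfB; exact: fN.
Qed.

Fact stalk_map_is_zmod_morphism x : zmod_morphism (@stalk_map x).
Proof.
move=> a b; have [U [Ux [s [t [-> ->]]]]] := germ_at2 a b.
by rewrite -raddfB !stalk_mapE !raddfB.
Qed.
HB.instance Definition _ x := GRing.isZmodMorphism.Build (stalk N x) (stalk N' x)
  (@stalk_map x) (@stalk_map_is_zmod_morphism x).

Definition sky_map U (s : sky (stalk N) U) : sky (stalk N') U :=
  Sky (fun x Ux => stalk_map (s x Ux)).

Fact sky_map_is_zmod_morphism U : zmod_morphism (@sky_map U).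
Proof. by move=> s t; apply: sky_eq => x Ux /=; exact: raddfB. Qed.
HB.instance Definition _ U := GRing.isZmodMorphism.Build (sky (stalk N) U)
  (sky (stalk N') U) (@sky_map U) (@sky_map_is_zmod_morphism U).

Definition sky_hom : sheaf_hom (sky_sheaf (stalk N)) (sky_sheaf (stalk N')) :=
  @SheafHom X (sky_sheaf (stalk N)) (sky_sheaf (stalk N'))
    (fun U => @sky_map U : {additive sky (stalk N) U -> sky (stalk N') U})
    (fun U V VU s => erefl).

Fact coker_map_subproof U (s : coker N U) : sky_map s \in @loc_germ X G' N' U.
Proof.
rewrite unfold_in; apply/asboolP => x Ux.
have [W [WU [g [Wx gE]]]] := coker_loc s Ux.
by exists W, WU, (f W g); split=> // y Wy /=; rewrite gE stalk_mapE.
Qed.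
Definition coker_map U (s : coker N U) : coker N' U := Coker (coker_map_subproof s).

Fact coker_map_is_zmod_morphism U : zmod_morphism (@coker_map U).
Proof. by move=> s t; apply: coker_eq => x Ux /=; exact: raddfB. Qed.
HB.instance Definition _ U := GRing.isZmodMorphism.Build (coker N U) (coker N' U)
  (@coker_map U) (@coker_map_is_zmod_morphism U).

Fact coker_map_res U V (VU : V `<=` U) (s : coker N U) :
  coker_map (coker_res VU s) = coker_res VU (coker_map s).
Proof. exact: coker_eq. Qed.

Definition coker_hom : sheaf_hom (coker_sheaf N) (coker_sheaf N') :=
  @SheafHom X (coker_sheaf N) (coker_sheaf N')
    (fun U => @coker_map U : {additive coker N U -> coker N' U}) coker_map_res.

Lemma coker_hom_proj U (s : G U) :
  coker_hom U (coker_proj N U s) = coker_proj N' U (f U s).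
Proof. by apply: coker_eq => x Ux /=; exact: stalk_mapE. Qed.

End StalkMap.

(** * Short exact sequences and dimension shifting *)

Section Exact.
Variable X : topologicalType.
Implicit Types (U V W : opens X) (F G H : sheaf X).

Definition onto F G (f : sheaf_hom F G) U : Prop := forall s : G U, exists t, f U t = s.

(** Exactness in the middle is stated on sections; for a monomorphism the local form implies it, by
    [mono_loc_im]. Only surjectivity on the right is local. *)
Record ses F G H (f : sheaf_hom F G) (g : sheaf_hom G H) : Prop := Ses {
  ses_mono : sheaf_mono f;
  ses_exact : forall U (s : G U), g U s = 0 <-> exists t, f U t = s;
  ses_epi : forall U (s : H U) x, opens_set U x -> exists W (WU : W `<=` U) (t : G W),
    opens_set W x /\ g W t = res H WU s }.

(** Local preimages under a monomorphism are unique, so they agree on overlaps and glue. *)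
Lemma mono_loc_im F G (f : sheaf_hom F G) U (s : G U) : sheaf_mono f ->
  (forall x, opens_set U x -> exists W (WU : W `<=` U), opens_set W x /\
     exists t, f W t = res G WU s) ->
  exists t, f U t = s.
Proof.
move=> fI loc.
pose P W (t : F W) := exists WU : W `<=` U, f W t = res G WU s.
have [x Ux|W W' t t' [WU e] [WU' e'] T TW TW'|t tE] := sheaf_glue (U := U) (P := P).
- by have [W [WU [Wx [t e]]]] := loc x Ux; exists W, WU, t; split=> //; exists WU.
- by apply: fI; rewrite !sheaf_map_res e e' !res2; exact: res_irr.
exists t; apply: sheaf_sep => x Ux; have [W [WU [Wx [t' e]]]] := loc x Ux.
exists W, WU; split=> //; rewrite -sheaf_map_res -e; congr (f W _).
by apply: tE; exists WU.
Qed.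

Section ZeroIm.
Variables (F G : sheaf X) (f : sheaf_hom F G).

(** For this subgroup, [stalk] is the ordinary stalk of the sheaf. *)
Definition zero_sp : subpre G.
Proof.
by exists (fun U s => s = 0) => [//|U s t -> ->|U V VU s ->]; rewrite ?subrr ?raddf0.
Defined.

Definition im_sp : subpre G.
Proof.
exists (fun U s => exists t, f U t = s) => [U|U _ _ [s <-] [t <-]|U V VU _ [s <-]].
- by exists 0; rewrite raddf0.
- by exists (s - t); rewrite raddfB.
- by exists (res F VU s); rewrite sheaf_map_res.
Defined.

End ZeroIm.

Lemma ses_coker F G (f : sheaf_hom F G) : sheaf_mono f -> ses f (coker_proj (im_sp f)).
Proof.
move=> fI; split=> // [U s|U s x Ux]; last exact: coker_proj_loc.
split=> [/coker_proj_eq0 h|[t <-]].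
  by apply: mono_loc_im => // x /h [W [WU [Wx [t e]]]]; exists W, WU; split=> //; exists t.
apply/coker_proj_eq0 => x Ux; exists U, (@subset_refl _ _); split=> //=.
by exists t; rewrite res_id.
Qed.

(* Discontinuous sections: the first step of the Godement resolution. *)
Definition god F : sheaf X := sky_sheaf (stalk (zero_sp F)).

Section Eta.
Variable F : sheaf X.

Definition god_unit_map U (s : F U) : sky (stalk (zero_sp F)) U :=
  Sky (fun x Ux => germ_at (zero_sp F) Ux s).

Fact god_unit_is_zmod_morphism U : zmod_morphism (@god_unit_map U).
Proof. by move=> s t; apply: sky_eq => x Ux /=; exact: raddfB. Qed.
HB.instance Definition _ U := GRing.isZmodMorphism.Build (F U)
  (sky (stalk (zero_sp F)) U) (@god_unit_map U) (@god_unit_is_zmod_morphism U).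

Fact god_unit_res U V (VU : V `<=` U) (s : F U) :
  god_unit_map (res F VU s) = sky_res VU (god_unit_map s).
Proof. by apply: sky_eq => x Vx /=; exact: germ_res. Qed.

Definition god_unit : sheaf_hom F (god F) :=
  @SheafHom X F (god F)
    (fun U => @god_unit_map U : {additive F U -> sky (stalk (zero_sp F)) U}) god_unit_res.

Lemma god_unit_mono : sheaf_mono god_unit.
Proof.
move=> U s t e; apply: sheaf_sep => x Ux.
have : germ_at (zero_sp F) Ux s = germ_at (zero_sp F) Ux t.
  exact: (congr1 (fun r : sky _ U => r x Ux) e).
case/germ_atE=> T [TU [TU' [Tx /eqP]]]; rewrite subr_eq0 => /eqP eT.
by exists T, TU; rewrite eT; split=> //; exact: res_irr.
Qed.

End Eta.

Definition godQ F : sheaf X := coker_sheaf (im_sp (god_unit F)).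
Definition god_proj F : sheaf_hom (god F) (godQ F) := coker_proj (im_sp (god_unit F)).

Lemma god_ses F : ses (god_unit F) (god_proj F).
Proof. exact/ses_coker/god_unit_mono. Qed.

Section Functoriality.
Variables (F G : sheaf X) (f : sheaf_hom F G).

Fact god_map_subproof U (s : F U) : zero_sp F U s -> zero_sp G U (f U s).
Proof. by move=> /= ->; rewrite raddf0. Qed.
Lemma god_stalk_mapE x U (Ux : opens_set U x) (s : F U) :
  stalk_map (zero_sp G) f (germ_at (zero_sp F) Ux s) = germ_at (zero_sp G) Ux (f U s).
Proof. exact: (stalk_mapE god_map_subproof). Qed.

Definition god_map : sheaf_hom (god F) (god G) := sky_hom god_map_subproof.

Lemma god_map_unit U (s : F U) : god_map U (god_unit F U s) = god_unit G U (f U s).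
Proof. by apply: sky_eq => x Ux /=; exact: god_stalk_mapE. Qed.

Fact godQ_map_subproof U (s : god F U) :
  im_sp (god_unit F) U s -> im_sp (god_unit G) U (god_map U s).
Proof. by move=> [t <-]; exists (f U t); rewrite god_map_unit. Qed.
Definition godQ_map : sheaf_hom (godQ F) (godQ G) := coker_hom godQ_map_subproof.

Lemma godQ_map_proj U (s : god F U) :
  godQ_map U (god_proj F U s) = god_proj G U (god_map U s).
Proof. exact: coker_hom_proj. Qed.

End Functoriality.

Section GodExact.
Variables (F G H : sheaf X) (f : sheaf_hom F G) (g : sheaf_hom G H).
Hypothesis fg : ses f g.

Lemma ses_comp0 U (s : F U) : g U (f U s) = 0.
Proof. by apply/(ses_exact fg); exists s. Qed.

Lemma god_map_mono : sheaf_mono (god_map f).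
Proof.
move=> U s t e; apply/eqP; rewrite -subr_eq0; apply/eqP.
have {e} : god_map f U (s - t) = 0 by rewrite raddfB e subrr.
move: (s - t) => {s t} r e; apply: sky_eq => x Ux /=.
have := congr1 (fun r : sky _ U => r x Ux) e => /=.
elim/germ_atP: (sky_at r Ux) => W Wx a; rewrite god_stalk_mapE => /germ_eq0[T [TW [Tx /= e']]].
apply/germ_eq0; exists T, TW; split=> //=; apply: (ses_mono fg).
by rewrite sheaf_map_res e' raddf0.
Qed.

(** Germs can be lifted independently at each point, so [god] is exact on sections over every open
    set and not just locally. *)
Lemma god_map_exact U (s : god G U) : god_map g U s = 0 -> exists t, god_map f U t = s.
Proof.
move=> e; have h x (Ux : opens_set U x) :
    {a : stalk (zero_sp F) x | stalk_map (zero_sp G) f a = sky_at s Ux}.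
  apply: cid; have := congr1 (fun r : sky _ U => r x Ux) e => /=.
  elim/germ_atP: (sky_at s Ux) => W Wx a.
  rewrite god_stalk_mapE.
  move=> /germ_eq0[T [TW [Tx /= e']]].
  have /(ses_exact fg)[b bE] : g T (res G TW a) = 0 by rewrite sheaf_map_res.
  exists (germ_at (zero_sp F) Tx b); rewrite god_stalk_mapE.
  by rewrite bE (germ_res _ _ _ Wx).
exists (Sky (fun x Ux => projT1 (h x Ux))).
by apply: sky_eq => x Ux /=; case: (h x Ux).
Qed.

Lemma god_map_onto U : onto (god_map g) U.
Proof.
move=> s; have h x (Ux : opens_set U x) :
    {a : stalk (zero_sp G) x | stalk_map (zero_sp H) g a = sky_at s Ux}.
  apply: cid; elim/germ_atP: (sky_at s Ux) => W Wx a.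
  have [V [VW [b [Vx e]]]] := ses_epi fg a Wx.
  exists (germ_at (zero_sp G) Vx b); rewrite god_stalk_mapE.
  by rewrite e (germ_res _ _ _ Wx).
exists (Sky (fun x Ux => projT1 (h x Ux))).
by apply: sky_eq => x Ux /=; case: (h x Ux).
Qed.

Lemma god_map_comp0 U (s : god F U) : god_map g U (god_map f U s) = 0.
Proof.
apply: sky_eq => x Ux /=; elim/germ_atP: (sky_at s Ux) => W Wx a.
by rewrite !god_stalk_mapE ses_comp0 raddf0.
Qed.

(** Inside god G, the sheaf F is the intersection of god F and G: a section of G that lies in god F
    dies in god H, hence in H, and so comes from F. *)
Lemma godQ_map_mono : sheaf_mono (godQ_map f).
Proof.
move=> U s t e; apply/eqP; rewrite -subr_eq0; apply/eqP.
have {e} : godQ_map f U (s - t) = 0 by rewrite raddfB e subrr.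
move: (s - t) => {s t} u e; apply: sheaf_sep => x Ux.
have [W [WU [t [Wx tE]]]] := ses_epi (god_ses F) u Ux.
exists W, WU; split=> //; rewrite raddf0 -tE.
have /(ses_exact (god_ses G))[a aE] : god_proj G W (god_map f W t) = 0.
  by rewrite -godQ_map_proj tE sheaf_map_res e raddf0.
have /(ses_exact fg)[b bE] : g W a = 0.
  by apply: god_unit_mono; rewrite -god_map_unit aE god_map_comp0 raddf0.
apply/(ses_exact (god_ses F)); exists b; apply: god_map_mono.
by rewrite god_map_unit bE.
Qed.

(** The nine lemma: the columns are the Godement sequences of F, G and H, and the first two rows are
    exact. *)
Lemma godQ_ses : ses (godQ_map f) (godQ_map g).
Proof.
split; first exact: godQ_map_mono.
- have comp0 U (s : godQ F U) : godQ_map g U (godQ_map f U s) = 0.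
    apply: sheaf_sep => x Ux; have [W [WU [t [Wx tE]]]] := ses_epi (god_ses F) s Ux.
    exists W, WU; split=> //.
    by rewrite -!sheaf_map_res -tE !godQ_map_proj god_map_comp0 !raddf0.
  move=> U s; split=> [e|[t <-]]; last exact: comp0.
  apply: (mono_loc_im godQ_map_mono) => x Ux; have [W [WU [t [Wx tE]]]] := ses_epi (god_ses G) s Ux.
  have /(ses_exact (god_ses H))[h hE] : god_proj H W (god_map g W t) = 0.
    by rewrite -godQ_map_proj tE sheaf_map_res e raddf0.
  (* Subtracting a local lift a of h does not change the class of t in godQ G, and moves t into the
     kernel of [god_map g]. *)
  have [V [VW [a [Vx aE]]]] := ses_epi fg h Wx.
  have [b bE] : exists b, god_map f V b = res (god G) VW t - god_unit G V a.
    apply: god_map_exact; rewrite raddfB god_map_unit aE sheaf_map_res.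
    by rewrite (sheaf_map_res (god_unit H)) hE subrr.
  exists V, (subset_trans VW WU); split=> //; exists (god_proj F V b).
  rewrite godQ_map_proj bE raddfB -res2 -tE (sheaf_map_res (god_proj G)).
  rewrite [X in _ - X](_ : _ = 0) ?subr0 //.
  by apply/(ses_exact (god_ses G)); exists a.
move=> U s x Ux; have [W [WU [t [Wx tE]]]] := ses_epi (god_ses H) s Ux.
have [a aE] := god_map_onto t.
by exists W, WU, (god_proj G W a); rewrite godQ_map_proj aE.
Qed.

End GodExact.

(* [acyclic_upto n F]: H^i(X, F) = 0 for 1 <= i <= n. *)
Fixpoint acyclic_upto n F : Prop :=
  if n is m.+1 then onto (god_proj F) (opens_setT X) /\ acyclic_upto m (godQ F) else True.

Definition acyclic F : Prop := forall n, acyclic_upto n F.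

Section LongExact.
Variables (F G H : sheaf X) (f : sheaf_hom F G) (g : sheaf_hom G H).
Hypothesis fg : ses f g.
Let T := opens_setT X.

(** The connecting map: the section u of godQ F represents the obstruction to lifting s, and a lift
    of u to god F corrects t to a section of G. *)
Lemma acyclic_onto : acyclic_upto 1 F -> onto g T.
Proof.
move=> [oF _] s; have [t tE] := god_map_onto fg (god_unit H T s).
have /(ses_exact (godQ_ses fg))[u uE] : godQ_map g T (god_proj G T t) = 0.
  by rewrite godQ_map_proj; apply/(ses_exact (god_ses H)); exists s.
have [v vE] := oF u.
have /(ses_exact (god_ses G))[a aE] : god_proj G T (t - god_map f T v) = 0.
  by rewrite raddfB -godQ_map_proj vE uE subrr.
exists a; apply: god_unit_mono; rewrite -god_map_unit aE raddfB tE.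
by rewrite (god_map_comp0 fg) subr0.
Qed.

(** Exactness of H^0(G) -> H^0(H) -> H^1(F) -> H^1(G). *)
Lemma ses_onto_l : onto g T -> onto (god_proj G) T -> onto (god_proj F) T.
Proof.
move=> og oG s; have [t tE] := oG (godQ_map f T s).
have /(ses_exact (god_ses H))[h hE] : god_proj H T (god_map g T t) = 0.
  by rewrite -godQ_map_proj tE (ses_comp0 (godQ_ses fg)).
have [a aE] := og h.
have [|b bE] := god_map_exact fg (s := t - god_unit G T a).
  by rewrite raddfB god_map_unit aE hE subrr.
exists b; apply: (ses_mono (godQ_ses fg)); rewrite godQ_map_proj bE raddfB tE.
rewrite [X in _ - X](_ : _ = 0) ?subr0 //.
by apply/(ses_exact (god_ses G)); exists a.
Qed.

Lemma ses_onto_m :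
  onto (god_proj F) T -> onto (god_proj H) T -> onto (god_proj G) T.
Proof.
move=> oF oH s; have [t tE] := oH (godQ_map g T s); have [a aE] := god_map_onto fg t.
have /(ses_exact (godQ_ses fg))[u uE] : godQ_map g T (s - god_proj G T a) = 0.
  by rewrite raddfB godQ_map_proj aE tE subrr.
have [b bE] := oF u; exists (god_map f T b + a).
by rewrite raddfD -godQ_map_proj bE uE subrK.
Qed.

(** The first hypothesis stands in for H^2(F) = 0, from which it follows by [acyclic_onto] applied
    to the sequence of quotients [godQ]. *)
Lemma ses_onto_r :
  onto (godQ_map g) T -> onto (god_proj G) T -> onto (god_proj H) T.
Proof.
move=> og oG s; have [t <-] := og s; have [u <-] := oG t.
by exists (god_map g T u); rewrite godQ_map_proj.
Qed.

End LongExact.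

Lemma acyclic_upto_l n F G H (f : sheaf_hom F G) (g : sheaf_hom G H) : ses f g ->
  onto g (opens_setT X) -> acyclic_upto n G -> acyclic_upto n H -> acyclic_upto n F.
Proof.
elim: n F G H f g => //= n IH F G H f g fg og [oG aG] [oH aH]; split.
  exact: ses_onto_l fg og oG.
(* The surjectivity hypothesis must be restored for [godQ_map g]: sections of godQ H lift to god H
   as H^1(H) = 0, and from there to god G. *)
apply: (IH _ _ _ _ _ (godQ_ses fg)) => // s.
have [t <-] := oH s; have [u <-] := god_map_onto fg t.
by exists (god_proj G _ u); rewrite godQ_map_proj.
Qed.

Lemma acyclic_upto_m n F G H (f : sheaf_hom F G) (g : sheaf_hom G H) : ses f g ->
  acyclic_upto n F -> acyclic_upto n H -> acyclic_upto n G.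
Proof.
elim: n F G H f g => //= n IH F G H f g fg [oF aF] [oH aH]; split.
  exact: ses_onto_m fg oF oH.
exact: (IH _ _ _ _ _ (godQ_ses fg)).
Qed.

Lemma acyclic_upto_r n F G H (f : sheaf_hom F G) (g : sheaf_hom G H) : ses f g ->
  acyclic_upto n.+1 F -> acyclic_upto n G -> acyclic_upto n H.
Proof.
elim: n F G H f g => // n IH F G H f g fg [oF aF] [oG aG]; split; last first.
  exact: (IH _ _ _ _ _ (godQ_ses fg)).
apply: ses_onto_r oG => //; apply: acyclic_onto (godQ_ses fg) _.
by case: aF.
Qed.

End Exact.

(** * Flasque sheaves and resolutions by them *)

Section Flasque.
Variable X : topologicalType.
Implicit Types (U V W : opens X) (F G H : sheaf X).

Definition flasque F : Prop :=
  forall U V (VU : V `<=` U) (s : F V), exists t, res F VU t = s.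

Section Lift.
Variables (F G H : sheaf X) (f : sheaf_hom F G) (g : sheaf_hom G H).
Hypotheses (fg : ses f g) (flF : flasque F).
Variables (U : opens X) (h : H U).

(** Lifts of h over open subsets of U, preordered by extension, as the domain for Zorn's lemma. A
    chain is bounded by gluing over the union of its domains. *)
Record partial_lift := PartialLift {
  pl_dom : opens X; pl_sub : pl_dom `<=` U; pl_val : G pl_dom;
  pl_eq : g pl_dom pl_val = res H pl_sub h }.

Let R (p q : partial_lift) : bool :=
  `[< exists pq : pl_dom p `<=` pl_dom q, res G pq (pl_val q) = pl_val p >].

Let R_refl p : R p p.
Proof. by apply/asboolP; exists (@subset_refl _ _); rewrite res_id. Qed.

Let R_trans p q r : R p q -> R q r -> R p r.
Proof.
move=> /asboolP[pq e] /asboolP[qr e']; apply/asboolP.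
by exists (subset_trans pq qr); rewrite -res2 e' e.
Qed.

Let R_res p q W (Wp : W `<=` pl_dom p) (Wq : W `<=` pl_dom q) :
  R p q -> res G Wp (pl_val p) = res G Wq (pl_val q).
Proof. by move=> /asboolP[pq <-]; rewrite res2; exact: res_irr. Qed.

Let chain_bound (A : set partial_lift) : total_on A R -> exists q, forall p, A p -> R p q.
Proof.
move=> tot; pose D := Opens (bigcup_open (fun p (_ : A p) => opensP (pl_dom p))).
have pD p : A p -> pl_dom p `<=` D by move=> Ap x px; exists p.
pose P W (t : G W) := exists p (Wp : W `<=` pl_dom p), A p /\ res G Wp (pl_val p) = t.
have [x [p Ap px]|W W' _ _ [p [Wp [Ap <-]]] [q [Wq [Aq <-]]] T TW TW'|t tE] :=
    sheaf_glue (F := G) (U := D) (P := P).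
- exists (pl_dom p), (pD p Ap), (pl_val p); split=> //.
  by exists p, (@subset_refl _ _); rewrite res_id.
- rewrite !res2; case: (tot p q Ap Aq) => pq; first exact: R_res.
  by apply: esym; exact: R_res.
have DU : D `<=` U by move=> x [p _ /pl_sub].
have tp p (Ap : A p) : res G (pD p Ap) t = pl_val p.
  by apply: tE; exists p, (@subset_refl _ _); rewrite res_id.
have te : g D t = res H DU h.
  apply: sheaf_sep => x [p Ap px]; exists (pl_dom p), (pD p Ap); split=> //.
  by rewrite -sheaf_map_res tp pl_eq res2; exact: res_irr.
by exists (PartialLift te) => p Ap; apply/asboolP; exists (pD p Ap); exact: tp.
Qed.

(** Near x there is a local lift a. On the overlap it differs from the maximal lift by a section b
    of F; extending b by flasqueness and subtracting it from a makes the two lifts glue, so x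
    already lies in the maximal domain. *)
Let max_total p : premaximal R p -> U `<=` pl_dom p.
Proof.
move=> max x Ux; have [W [WU [a [Wx aE]]]] := ses_epi fg h Ux.
set D := pl_dom p.
have /(ses_exact fg)[b bE] : g (opens_setI W D)
    (res G (@setI_subl _ W D) a - res G (@setI_subr _ W D) (pl_val p)) = 0.
  rewrite raddfB !sheaf_map_res aE (pl_eq p) !res2.
  by apply/eqP; rewrite subr_eq0; apply/eqP; exact: res_irr.
have [c cE] := flF (@setI_subl _ W D) b.
pose a' := a - f W c.
have a'E : res G (@setI_subl _ W D) a' = res G (@setI_subr _ W D) (pl_val p).
  by rewrite raddfB -sheaf_map_res cE bE subKr.
have a'p (T : opens X) (TW : T `<=` W) (TD : T `<=` D) : res G TW a' = res G TD (pl_val p).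
  have TI : T `<=` opens_setI W D by move=> y Ty; split; [exact: TW|exact: TD].
  have := congr1 (res G TI) a'E; rewrite !res2 => e.
  by rewrite (res_irr TW (subset_trans TI (@setI_subl _ W D))) e; exact: res_irr.
pose E := Opens (openU (opensP W) (opensP D)).
have WE : W `<=` E by move=> y; left.
have DE : D `<=` E by move=> y; right.
pose P T (t : G T) := (exists TD : T `<=` D, res G TD (pl_val p) = t) \/
  (exists TW : T `<=` W, res G TW a' = t).
have [y [Wy|Dy]|T T' t t' Pt Pt' S ST ST'|t tE] :=
    sheaf_glue (F := G) (U := E) (P := P).
- exists W, WE, a'; split=> //; right; exists (@subset_refl _ _); exact: res_id.
- exists D, DE, (pl_val p); split=> //; left; exists (@subset_refl _ _); exact: res_id.
- case: Pt Pt' => -[Ti <-] [] [T'i <-]; rewrite !res2; first exact: res_irr.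
  + by apply: esym; exact: a'p.
  + exact: a'p.
  + exact: res_irr.
have tD : res G DE t = pl_val p.
  by apply: tE; left; exists (@subset_refl _ _); exact: res_id.
have tW : res G WE t = a'.
  by apply: tE; right; exists (@subset_refl _ _); exact: res_id.
have EU : E `<=` U by move=> y [/WU|/pl_sub].
have te : g E t = res H EU h.
  apply: sheaf_sep => y [Wy|Dy].
    exists W, WE; split=> //.
    rewrite -sheaf_map_res tW raddfB (ses_comp0 fg) subr0 aE res2.
    exact: res_irr.
  exists D, DE; split=> //; rewrite -sheaf_map_res tD (pl_eq p) res2.
  exact: res_irr.
have /max/asboolP[ED _] : R p (PartialLift te) by apply/asboolP; exists DE.
by apply: ED; left.
Qed.

Lemma flasque_lift : exists t, g U t = h.
Proof.
have s0 : (Opens open0 : opens X) `<=` U by [].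
have p0 : g (Opens open0) 0 = res H s0 h by apply: sheaf_sep.
have [p /max_total Up] := ZL_preorder (PartialLift p0) R_refl R_trans chain_bound.
exists (res G Up (pl_val p)).
by rewrite sheaf_map_res (pl_eq p) res2 res_id.
Qed.

End Lift.

Lemma flasque_onto F G H (f : sheaf_hom F G) (g : sheaf_hom G H) :
  ses f g -> flasque F -> forall U, onto g U.
Proof. by move=> fg flF U h; exact: flasque_lift fg flF _ _. Qed.

Lemma flasque_quotient F G H (f : sheaf_hom F G) (g : sheaf_hom G H) :
  ses f g -> flasque F -> flasque G -> flasque H.
Proof.
move=> fg flF flG U V VU s; have [t <-] := flasque_onto fg flF s.
by have [r <-] := flG U V VU t; exists (g U r); rewrite sheaf_map_res.
Qed.

Lemma god_flasque F : flasque (god F).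
Proof. by move=> U V VU s; exact: sky_res_onto. Qed.

Lemma flasque_acyclic F : flasque F -> acyclic F.
Proof.
move=> flF n; elim: n F flF => //= n IH F flF; split.
  exact: flasque_onto (god_ses F) flF _.
by apply: IH; exact: flasque_quotient (god_ses F) flF (@god_flasque F).
Qed.

(** The identity of F extends along the Godement embedding, so F is a retract of a flasque sheaf. *)
Lemma injective_flasque F : injective_sheaf F -> flasque F.
Proof.
move=> injF U V VU s.
have [r rE] := injF F (god F) (god_unit F)
  (@SheafHom X F F (fun U => idfun : {additive F U -> F U}) (fun _ _ _ _ => erefl))
  (@god_unit_mono _ F).
have [t tE] := god_flasque VU (god_unit F V s); exists (r U t).
by rewrite -sheaf_map_res tE rE.
Qed.

Section Kernel.
Variables (G H : sheaf X) (g : sheaf_hom G H).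

Definition ker U : {pred G U} := fun s => g U s == 0.

Fact ker_zmod_closed U : zmod_closed (@ker U).
Proof.
split=> [|s t]; rewrite !unfold_in ?raddf0 // => /eqP gs /eqP gt.
by rewrite raddfB gs gt subrr.
Qed.
HB.instance Definition _ U := GRing.isZmodClosed.Build (G U) (@ker U) (@ker_zmod_closed U).

Record kersec U := KerSec { ker_val : G U; ker_valP : ker_val \in @ker U }.
HB.instance Definition _ U := [isSub for @ker_val U].
HB.instance Definition _ U := [Choice of kersec U by <:].
HB.instance Definition _ U := [SubChoice_isSubZmodule of kersec U by <:].

Lemma kerE U (s : kersec U) : g U (ker_val s) = 0.
Proof. by have := ker_valP s; rewrite unfold_in => /eqP. Qed.

Fact ker_res_subproof U V (VU : V `<=` U) (s : kersec U) : res G VU (ker_val s) \in @ker V.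
Proof. by rewrite unfold_in sheaf_map_res kerE raddf0. Qed.
Definition ker_res U V (VU : V `<=` U) (s : kersec U) : kersec V :=
  KerSec (ker_res_subproof VU s).
Fact ker_res_is_zmod_morphism U V (VU : V `<=` U) : zmod_morphism (ker_res VU).
Proof. by move=> s t; apply: val_inj; exact: raddfB. Qed.
HB.instance Definition _ U V (VU : V `<=` U) := GRing.isZmodMorphism.Build
  (kersec U) (kersec V) (ker_res VU) (ker_res_is_zmod_morphism VU).
Fact ker_res_id U (UU : U `<=` U) (s : kersec U) : ker_res UU s = s.
Proof. by apply: val_inj; exact: res_id. Qed.
Fact ker_res_comp U V W (VU : V `<=` U) (WV : W `<=` V) (WU : W `<=` U) (s : kersec U) :
  ker_res WV (ker_res VU s) = ker_res WU s.
Proof. by apply: val_inj; exact: res_comp. Qed.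

Fact ker_sheaf_axiom : sheaf_axiom (fun U V (VU : V `<=` U) => @ker_res U V VU).
Proof.
move=> U I W WU cov s comp.
have [i j T Ti Tj|t [tE tU]] := sheafP WU cov (s := fun i => ker_val (s i)).
  by have /(congr1 (@ker_val _)) := comp i j T Ti Tj.
have tP : t \in @ker U.
  rewrite unfold_in; apply/eqP; apply: sheaf_sep => x Ux; have [i _ Wx] := cov x Ux.
  by exists (W i), (WU i); split=> //; rewrite -sheaf_map_res tE kerE raddf0.
exists (KerSec tP); split=> [i|r rE]; apply: val_inj => /=; first exact: tE.
by apply: tU => i; rewrite -rE.
Qed.

Definition ker_sheaf : sheaf X :=
  @Sheaf X (fun U => kersec U : zmodType)
    (fun U V VU => @ker_res U V VU : {additive kersec U -> kersec V})
    ker_res_id ker_res_comp ker_sheaf_axiom.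

Fact ker_val_is_zmod_morphism U : zmod_morphism (@ker_val U).
Proof. by []. Qed.
HB.instance Definition _ U := GRing.isZmodMorphism.Build (kersec U) (G U)
  (@ker_val U) (@ker_val_is_zmod_morphism U).

Definition ker_incl : sheaf_hom ker_sheaf G :=
  @SheafHom X ker_sheaf G (fun U => @ker_val U : {additive kersec U -> G U})
    (fun _ _ _ _ => erefl).

Lemma ker_incl_mono : sheaf_mono ker_incl.
Proof. by move=> U s t e; exact: val_inj. Qed.

Variables (F : sheaf X) (f : sheaf_hom F G).
Hypothesis gf0 : forall U (s : F U), g U (f U s) = 0.

Fact ker_lift_subproof U (s : F U) : f U s \in @ker U.
Proof. by rewrite unfold_in gf0. Qed.
Definition ker_lift_map U (s : F U) : kersec U := KerSec (ker_lift_subproof s).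
Fact ker_lift_is_zmod_morphism U : zmod_morphism (@ker_lift_map U).
Proof. by move=> s t; apply: val_inj; exact: raddfB. Qed.
HB.instance Definition _ U := GRing.isZmodMorphism.Build (F U) (kersec U)
  (@ker_lift_map U) (@ker_lift_is_zmod_morphism U).
Fact ker_lift_res U V (VU : V `<=` U) (s : F U) :
  ker_lift_map (res F VU s) = ker_res VU (ker_lift_map s).
Proof. by apply: val_inj; exact: sheaf_map_res. Qed.
Definition ker_lift : sheaf_hom F ker_sheaf :=
  @SheafHom X F ker_sheaf
    (fun U => @ker_lift_map U : {additive F U -> kersec U}) ker_lift_res.

End Kernel.

Lemma sheaf_exact0 F G H (f : sheaf_hom F G) (g : sheaf_hom G H) :
  sheaf_exact f g -> forall U (s : F U), g U (f U s) = 0.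
Proof.
move=> ex U s; apply/ex => x Ux; exists U, (@subset_refl _ _), s; split=> //.
by rewrite res_id.
Qed.

(** Cuts a resolution into short exact sequences: by exactness the sheaf of cocycles in E1 is the
    image sheaf of d. *)
Lemma ses_ker F E0 E1 E2 (i : sheaf_hom F E0) (d : sheaf_hom E0 E1) (e : sheaf_hom E1 E2)
    (ex : sheaf_exact d e) :
  sheaf_mono i -> sheaf_exact i d -> ses i (ker_lift (sheaf_exact0 ex)).
Proof.
move=> iI exi; split=> //.
  move=> U s; split=> [/(congr1 (@ker_val _ _ _ _))/= /exi h|[t <-]].
    apply: mono_loc_im => // x /h[W [WU [t [Wx tE]]]].
    by exists W, WU; split=> //; exists t.
  by apply: val_inj; exact: sheaf_exact0 exi _ _.
move=> U s x Ux; have /ex/(_ x Ux)[W [WU [t [Wx tE]]]] : e U (ker_val s) = 0.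
  exact: kerE.
by exists W, WU, t; split=> //; exact: val_inj.
Qed.

Lemma ker_exact E1 E2 (e : sheaf_hom E1 E2) : sheaf_exact (ker_incl e) e.
Proof.
move=> U s; split=> [es x Ux|h].
  have sP : s \in @ker _ _ e U by rewrite unfold_in es.
  by exists U, (@subset_refl _ _), (KerSec sP); rewrite res_id.
apply: sheaf_sep => x /h[W [WU [t [Wx tE]]]]; exists W, WU; split=> //.
by rewrite -sheaf_map_res -tE raddf0; exact: kerE.
Qed.

Section Resolution.
Variable E : nat -> sheaf X.
Variable d : forall n, sheaf_hom (E n) (E n.+1).
Hypothesis flE : forall n, flasque (E n).
Hypothesis exE : forall n, sheaf_exact (d n) (d n.+1).

Lemma acyclic_step F n (i : sheaf_hom F (E n)) :
  sheaf_mono i -> sheaf_exact i (d n) -> acyclic F ->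
  acyclic (ker_sheaf (d n.+1)) /\ onto (ker_lift (sheaf_exact0 (@exE n))) (opens_setT X).
Proof.
move=> iI exi aF; have kses := ses_ker (@exE n) iI exi; split=> [m|].
  apply: acyclic_upto_r kses _ _ => //; exact: flasque_acyclic.
exact: acyclic_onto kses (aF 1%N).
Qed.

(** Acyclicity passes from F to each sheaf of cocycles in turn, as the quotient of a flasque sheaf
    by an acyclic one; it then lifts global cocycles. *)
Lemma acyclic_exact F (i : sheaf_hom F (E 0)) n (s : E n.+1 (opens_setT X)) :
  sheaf_mono i -> sheaf_exact i (d 0) -> acyclic F ->
  d n.+1 _ s = 0 -> exists t, d n _ t = s.
Proof.
move=> iI exi aF; have [_ onto_n] : acyclic (ker_sheaf (d n.+1)) /\
    onto (ker_lift (sheaf_exact0 (@exE n))) (opens_setT X).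
  elim: n {s} => [|n [an _]]; first exact: acyclic_step aF.
  exact: acyclic_step (@ker_incl_mono _ _ (d n.+1)) (@ker_exact _ _ (d n.+1)) an.
move=> ds; have sP : s \in @ker _ _ (d n.+1) (opens_setT X) by rewrite unfold_in ds.
by have [t /(congr1 (@ker_val _ _ _ _)) tE] := onto_n (KerSec sP); exists t.
Qed.

End Resolution.

Lemma acyclic_cohomology F (E : injective_resolution F) j (c : sheaf_cohomology E j) :
  acyclic F -> (1 <= j)%N -> c = 0.
Proof.
case: j c => // n c aF _; rewrite -[c]reprK; move: (repr c) => {}c.
have [|t tE] := acyclic_exact (fun m => injective_flasque (@ir_injective _ _ E m))
  (@ir_exactS _ _ E) (n := n) (s := cocycle_val c) (@ir_aug_mono _ _ E) (@ir_exact0 _ _ E) aF.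
  by apply/eqP; exact: (cocycleP c).
set d := ir_diff E n (opens_setT X); set d' := ir_diff E n.+1 (opens_setT X).
apply/eqP; rewrite -(raddf0 (\pi_(cohomology_group d d'))).
rewrite -Quotient.idealrBE subr0 unfold_in; apply/asboolP; by exists t.
Qed.

End Flasque.

Section Product.
Variables (X : topologicalType) (F G : sheaf X).
Implicit Types U V W : opens X.

Let prod_sec U : zmodType := (F U * G U)%type.

Definition prod_res U V (VU : V `<=` U) (s : prod_sec U) : prod_sec V :=
  (res F VU s.1, res G VU s.2).
Fact prod_res_is_zmod_morphism U V (VU : V `<=` U) : zmod_morphism (prod_res VU).
Proof. by move=> s t; congr pair; exact: raddfB. Qed.
HB.instance Definition _ U V (VU : V `<=` U) := GRing.isZmodMorphism.Build
  (prod_sec U) (prod_sec V) (prod_res VU) (prod_res_is_zmod_morphism VU).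
Fact prod_res_id U (UU : U `<=` U) (s : prod_sec U) : prod_res UU s = s.
Proof. by case: s => s t; congr pair; exact: res_id. Qed.
Fact prod_res_comp U V W (VU : V `<=` U) (WV : W `<=` V) (WU : W `<=` U) (s : prod_sec U) :
  prod_res WV (prod_res VU s) = prod_res WU s.
Proof. by congr pair; exact: res_comp. Qed.
Fact prod_sheaf_axiom : sheaf_axiom (fun U V (VU : V `<=` U) => @prod_res U V VU).
Proof.
move=> U I W WU cov s comp.
have [i j T Ti Tj|a [aE aU]] := sheafP WU cov (s := fun i => (s i).1).
  by have /(congr1 fst) := comp i j T Ti Tj.
have [i j T Ti Tj|b [bE bU]] := sheafP WU cov (s := fun i => (s i).2).
  by have /(congr1 snd) := comp i j T Ti Tj.
exists (a, b); split=> [i|[a' b'] abE]; first by rewrite [RHS]surjective_pairing -aE -bE.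
by congr pair; [apply: aU|apply: bU] => i; rewrite -abE.
Qed.
Definition prod_sheaf : sheaf X :=
  @Sheaf X prod_sec (fun U V VU => @prod_res U V VU : {additive prod_sec U -> prod_sec V})
    prod_res_id prod_res_comp prod_sheaf_axiom.

Definition prod_inl_map U (s : F U) : prod_sec U := (s, 0).
Fact prod_inl_is_zmod_morphism U : zmod_morphism (@prod_inl_map U).
Proof. by move=> s t; congr pair; rewrite /= subr0. Qed.
HB.instance Definition _ U := GRing.isZmodMorphism.Build (F U) (prod_sec U)
  (@prod_inl_map U) (@prod_inl_is_zmod_morphism U).
Fact prod_inl_res U V (VU : V `<=` U) (s : F U) :
  prod_inl_map (res F VU s) = prod_res VU (prod_inl_map s).
Proof. by congr pair; rewrite raddf0. Qed.
Definition prod_inl : sheaf_hom F prod_sheaf :=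
  @SheafHom X F prod_sheaf (fun U => @prod_inl_map U : {additive F U -> prod_sec U})
    prod_inl_res.
Definition prod_snd : sheaf_hom prod_sheaf G :=
  @SheafHom X prod_sheaf G (fun U => snd : {additive prod_sec U -> G U})
    (fun _ _ _ _ => erefl).

Lemma prod_ses : ses prod_inl prod_snd.
Proof.
split=> [U s t [] //|U [s t]|U s x Ux] /=.
  by split=> [->|[r [_ <-]]] //; exists s.
by exists U, (@subset_refl _ _), (0, s); split=> //=; rewrite res_id.
Qed.

Lemma prod_acyclic : acyclic F -> acyclic G -> acyclic prod_sheaf.
Proof. by move=> aF aG n; exact: acyclic_upto_m prod_ses (aF n) (aG n). Qed.

End Product.

Definition id_hom (X : topologicalType) (G : sheaf X) : sheaf_hom G G :=
  @SheafHom X G G (fun U => idfun : {additive G U -> G U}) (fun _ _ _ _ => erefl).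

Section SubPreIncl.
Variables (X : topologicalType) (G : sheaf X) (N N' : subpre G).
Hypothesis NN' : forall U (s : G U), N U s -> N' U s.

Definition coker_incl : sheaf_hom (coker_sheaf N) (coker_sheaf N') :=
  @coker_hom X G G N N' (id_hom G) NN'.

Lemma coker_incl_proj U (s : G U) : coker_incl U (coker_proj N U s) = coker_proj N' U s.
Proof. exact: coker_hom_proj. Qed.

Lemma coker_incl_germ U V x (Ux : opens_set U x) (Vx : opens_set V x)
    (s : coker_sheaf N U) (g : G V) :
  sky_at (coker_val s) Ux = germ_at N Vx g ->
  sky_at (coker_val (coker_incl U s)) Ux = germ_at N' Vx g.
Proof. by move=> /= ->; exact: (@stalk_mapE X G G N N' (id_hom G) NN'). Qed.

End SubPreIncl.

(** * The Mayer-Vietoris sequence for quotients of one sheaf by N1, N2, their intersection N0 and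
    their local sum N12 *)

Section MayerVietoris.
Variables (X : topologicalType) (G : sheaf X) (N0 N1 N2 N12 : subpre G).
Implicit Types U V W : opens X.
Hypothesis N01 : forall U (s : G U), N0 U s -> N1 U s.
Hypothesis N02 : forall U (s : G U), N0 U s -> N2 U s.
Hypothesis N012 : forall U (s : G U), N1 U s -> N2 U s -> N0 U s.
Hypothesis N112 : forall U (s : G U), N1 U s -> N12 U s.
Hypothesis N212 : forall U (s : G U), N2 U s -> N12 U s.
Hypothesis N12D : forall U (s : G U) x, N12 U s -> opens_set U x ->
  exists W (WU : W `<=` U) (a b : G W),
    [/\ opens_set W x, N1 W a, N2 W b & res G WU s = a + b].

Let C0 := coker_sheaf N0.
Let C1 := coker_sheaf N1.
Let C2 := coker_sheaf N2.
Let C12 := coker_sheaf N12.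

Definition mv_diag_map U (s : C0 U) : prod_sheaf C1 C2 U :=
  (coker_incl N01 U s, coker_incl N02 U s).
Fact mv_diag_is_zmod_morphism U : zmod_morphism (@mv_diag_map U).
Proof. by move=> s t; rewrite /mv_diag_map !raddfB. Qed.
HB.instance Definition _ U := GRing.isZmodMorphism.Build (C0 U) (prod_sheaf C1 C2 U)
  (@mv_diag_map U) (@mv_diag_is_zmod_morphism U).
Fact mv_diag_res U V (VU : V `<=` U) (s : C0 U) :
  mv_diag_map (res C0 VU s) = res (prod_sheaf C1 C2) VU (mv_diag_map s).
Proof. by rewrite /mv_diag_map !sheaf_map_res. Qed.
Definition mv_diag : sheaf_hom C0 (prod_sheaf C1 C2) :=
  @SheafHom X C0 (prod_sheaf C1 C2)
    (fun U => @mv_diag_map U : {additive C0 U -> prod_sheaf C1 C2 U}) mv_diag_res.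

Definition mv_diff_map U (s : prod_sheaf C1 C2 U) : C12 U :=
  coker_incl N112 U s.1 - coker_incl N212 U s.2.
Fact mv_diff_is_zmod_morphism U : zmod_morphism (@mv_diff_map U).
Proof. by move=> s t; rewrite /mv_diff_map !raddfB /= addrACA. Qed.
HB.instance Definition _ U := GRing.isZmodMorphism.Build (prod_sheaf C1 C2 U) (C12 U)
  (@mv_diff_map U) (@mv_diff_is_zmod_morphism U).
Fact mv_diff_res U V (VU : V `<=` U) (s : prod_sheaf C1 C2 U) :
  mv_diff_map (res (prod_sheaf C1 C2) VU s) = res C12 VU (mv_diff_map s).
Proof. by rewrite /mv_diff_map raddfB /= -!(sheaf_map_res (coker_incl _)). Qed.
Definition mv_diff : sheaf_hom (prod_sheaf C1 C2) C12 :=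
  @SheafHom X (prod_sheaf C1 C2) C12
    (fun U => @mv_diff_map U : {additive prod_sheaf C1 C2 U -> C12 U}) mv_diff_res.

Lemma coker_proj_sp (N : subpre G) U (s : G U) : N U s -> coker_proj N U s = 0.
Proof.
by move=> Ns; apply/coker_proj_eq0 => x Ux; exists U, (@subset_refl _ _); rewrite res_id.
Qed.

Lemma mv_diag_mono : sheaf_mono mv_diag.
Proof.
move=> U s t e; apply/eqP; rewrite -subr_eq0; apply/eqP.
have {e} : mv_diag U (s - t) = 0 by rewrite raddfB e subrr.
move: (s - t) => {s t} r e; apply: sheaf_sep => x Ux.
have [W [WU [a [Wx aE]]]] := coker_proj_loc r Ux.
have e' : mv_diag W (coker_proj N0 W a) = 0 by rewrite aE sheaf_map_res e raddf0.
have /coker_proj_eq0/(_ x Wx)[V [VW [Vx aV]]] : coker_proj N1 W a = 0.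
  by rewrite -(coker_incl_proj N01); exact: (congr1 fst e').
have /coker_proj_eq0/(_ x Wx)[V' [VW' [Vx' aV']]] : coker_proj N2 W a = 0.
  by rewrite -(coker_incl_proj N02); exact: (congr1 snd e').
pose T := opens_setI V V'; have TV : T `<=` V := @setI_subl _ _ _.
have TV' : T `<=` V' := @setI_subr _ _ _.
have TW := subset_trans TV VW; exists T, (subset_trans TW WU); split; first by split.
rewrite raddf0 -res2 -aE -sheaf_map_res; apply: coker_proj_sp; apply: N012.
  by rewrite -(res_comp VW TV TW); exact: sp_res.
by rewrite -(res_comp VW' TV' TW); exact: sp_res.
Qed.

Lemma mv_ses : ses mv_diag mv_diff.
Proof.
split; first exact: mv_diag_mono.
- move=> U [s t]; split=> [e|[r <-]]; last first.
    apply: sheaf_sep => x Ux; have [W [WU [a [Wx aE]]]] := coker_proj_loc r Ux.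
    exists W, WU; split=> //; rewrite -!sheaf_map_res -aE raddf0.
    by rewrite /= /mv_diff_map /mv_diag_map !coker_incl_proj subrr.
  apply: (mono_loc_im mv_diag_mono) => x Ux.
  have [W [WU [a [Wx aE]]]] := coker_proj_loc s Ux.
  have [V [VW [b [Vx bE]]]] := coker_proj_loc (res C2 WU t) Wx.
  have VU := subset_trans VW WU; pose a' := res G VW a.
  have {}aE : coker_proj N1 V a' = res C1 VU s.
    by rewrite sheaf_map_res aE res2; exact: res_irr.
  have {}bE : coker_proj N2 V b = res C2 VU t by rewrite bE res2; exact: res_irr.
  have /coker_proj_eq0/(_ x Vx)[T [TV [Tx nT]]] : coker_proj N12 V (a' - b) = 0.
    rewrite raddfB -(coker_incl_proj N112) -(coker_incl_proj N212) aE bE.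
    rewrite -(raddf0 (res C12 VU)) -e /= /mv_diff_map.
    by rewrite [LHS]/= -[RHS]mv_diff_res.
  have [S [ST [n1 [n2 [Sx Nn1 Nn2 nE]]]]] := N12D nT Tx.
  have SV := subset_trans ST TV; have SU := subset_trans SV VU.
  (* Since a' - b = n1 + n2, the section a' - n1 = b + n2 represents s modulo N1 and t modulo N2 at
     once. *)
  exists S, SU; split=> //; exists (coker_proj N0 S (res G SV a' - n1)).
  rewrite -[LHS]/(_, _) !coker_incl_proj -[RHS]/(res C1 SU s, res C2 SU t); congr pair.
    rewrite raddfB (coker_proj_sp Nn1) subr0 sheaf_map_res aE res2; exact: res_irr.
  have -> : res G SV a' - n1 = res G SV b + n2.
    apply/eqP; rewrite subr_eq -addrA [n2 + n1]addrC -nE res2 -addrC -subr_eq -raddfB.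
    by rewrite (res_irr SV (subset_trans ST TV)).
  rewrite raddfD (coker_proj_sp Nn2) addr0 sheaf_map_res bE res2; exact: res_irr.
move=> U s x Ux; have [W [WU [a [Wx aE]]]] := coker_proj_loc s Ux.
exists W, WU, (coker_proj N1 W a, 0); split=> //.
by rewrite /= /mv_diff_map /= raddf0 subr0 coker_incl_proj.
Qed.

Lemma mv_acyclic : onto (coker_incl N112) (opens_setT X) ->
  acyclic C1 -> acyclic C2 -> acyclic C12 -> acyclic C0.
Proof.
move=> o a1 a2 a12 n; apply: acyclic_upto_l mv_ses _ _ (a12 n) => [s|].
  by have [t <-] := o s; exists (t, 0); rewrite /= /mv_diff_map /= raddf0 subr0.
exact: prod_acyclic.
Qed.

End MayerVietoris.

(** * Units modulo an ideal *)

Record ideal (A : comPzRingType) := Ideal {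
  ideal_set :> A -> Prop;
  ideal0 : ideal_set 0;
  idealD : forall x y, ideal_set x -> ideal_set y -> ideal_set (x + y);
  idealMl : forall a x, ideal_set x -> ideal_set (a * x) }.

Lemma primeN (A : comPzRingType) (p : Spec A) x : p x -> p (- x).
Proof. by move=> px; rewrite -mulN1r; exact: primeMl. Qed.

Lemma primeMr (A : comPzRingType) (p : Spec A) x y : p x -> p (x * y).
Proof. by move=> px; rewrite mulrC; exact: primeMl. Qed.

Lemma primeB_eq (A : comPzRingType) (p : Spec A) x y : p (x - y) -> p y -> p x.
Proof. by move=> pxy py; rewrite -[x](subrK y); exact: primeD. Qed.

Lemma Spec_eq (A : comPzRingType) (p q : Spec A) : (forall x, p x <-> q x) -> p = q.
Proof.
case: p q => [p p0 pD pM p1 pP] [q q0 qD qM q1 qP] /= e.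
have {}e : p = q by apply: funext => x; apply: propext.
by subst q; congr PrimeIdeal; exact: Prop_irrelevance.
Qed.

Section Zariski.
Variable A : comPzRingType.
Implicit Types (U V W : opens (Spec A)) (p q : Spec A) (a f g u : A).

Fact basic_open_subproof f : open [set p : Spec A | ~ p f].
Proof.
exists [set f]; apply/seteqP; split=> [p /= /contrapT pf _ -> //|p pf /=].
by apply; exact: pf.
Qed.
Definition basic_open f : opens (Spec A) := Opens (basic_open_subproof f).

Lemma basic_open_nbhs U p : opens_set U p ->
  exists2 f, ~ p f & basic_open f `<=` U.
Proof.
move=> Up; have [S US] := opensP U.
have /existsNP[f /not_implyP[Sf pf]] : ~ (S `<=` prime_set p).
  by move=> Sp; have : zero_locus S p by []; rewrite -US; apply.
exists f => // q qf; apply: contrapT => Uq; apply: qf.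
have Sq : zero_locus S q by rewrite -US.
exact: Sq.
Qed.

(** Used to carry neighbourhoods of q over to the generic point and to the prime divisors through
    q. *)
Lemma open_generalize U p q : opens_set U q -> (forall x, p x -> q x) -> opens_set U p.
Proof.
move=> /basic_open_nbhs[f qf fU] pq; apply: fU => /= pf; exact/qf/pq.
Qed.

Section Comap.
Variable r : {rmorphism A -> A}.

Definition comap p : Spec A.
Proof.
exists (fun x => p (r x)).
- by rewrite rmorph0; exact: prime0.
- by move=> x y px py; rewrite rmorphD; exact: primeD.
- by move=> a x px; rewrite rmorphM; exact: primeMl.
- by rewrite rmorph1; exact: prime1.
- by move=> x y; rewrite rmorphM; exact: primeM.
Defined.

Fact comap_open_subproof U : open [set p : Spec A | opens_set U (comap p)].
Proof.
have [S US] := opensP U; exists [set r x | x in S]; apply/seteqP; split=> p /=.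
  move=> Up _ [x Sx <-]; have Sp : zero_locus S (comap p) by rewrite -US.
  exact: Sp.
move=> Sp Up; have : zero_locus S (comap p) by move=> x Sx; apply: Sp; exists x.
by rewrite -US; apply.
Qed.
Definition comap_open U : opens (Spec A) := Opens (comap_open_subproof U).

End Comap.

Definition units := units_sheaf (structure_sheaf A).

Definition unit_germ U (s : units U) p (Up : opens_set U p) : localization p :=
  germ (uval s) Up.

Definition nonvanishing U f : Prop := forall p, opens_set U p -> ~ p f.

Lemma nonvanishing_sub U V f : V `<=` U -> nonvanishing U f -> nonvanishing V f.
Proof. by move=> VU nf p /VU; exact: nf. Qed.

Section Frac.
Variables (U : opens (Spec A)) (a f : A).

Fact frac_section_subproof (nf : nonvanishing U f) :
  locally_fraction (fun p (Up : opens_set U p) => fracl (Frac a (nf p Up))).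
Proof.
move=> p Up; exists U, a, f; split=> // q Uq _; exists (nf q Uq) => //.
Qed.
Definition frac_section nf : section U := Section (frac_section_subproof nf).

End Frac.

Fact frac_unit_subproof U a f (na : nonvanishing U a) (nf : nonvanishing U f) :
  frac_section a nf * frac_section f na = 1.
Proof.
by apply: section_eq => p Up /=; rewrite [LHS]fraclM; apply: fracl_eq => /=; ring.
Qed.
Definition frac_unit U a f (na : nonvanishing U a) (nf : nonvanishing U f) : units U :=
  UnitGroup (frac_unit_subproof na nf).

Lemma unit_germ_eq U (s t : units U) :
  (forall p Up, unit_germ s (p := p) Up = unit_germ t Up) -> s = t.
Proof. by move=> e; apply: uval_inj; exact: section_eq. Qed.

Lemma unit_germB U (s t : units U) p (Up : opens_set U p) :
  unit_germ (s - t) Up = unit_germ s Up * unit_germ (- t) Up.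
Proof. by []. Qed.

Lemma unit_germD U (s t : units U) p (Up : opens_set U p) :
  unit_germ (s + t) Up = unit_germ s Up * unit_germ t Up.
Proof. by []. Qed.

Lemma unit_germN U (s : units U) p (Up : opens_set U p) :
  unit_germ s Up * unit_germ (- s) Up = 1.
Proof. exact: (congr1 (fun t : section U => t p Up) (uvalK s)). Qed.

(** Near p the unit is a / f and its inverse is b / g. At each prime, a * b and f * g agree after
    multiplication by an element outside it, so a does not vanish either. *)
Lemma unit_loc U (s : units U) p : opens_set U p ->
  exists W (WU : W `<=` U) a f (na : nonvanishing W a) (nf : nonvanishing W f),
    opens_set W p /\ res units WU s = frac_unit na nf.
Proof.
move=> Up; have [W1 [a [f [W1p sE]]]] := germP (uval s) Up.
have [W2 [b [g [W2p tE]]]] := germP (uval (- s)) Up.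
pose W := opens_setI U (opens_setI W1 W2).
have WU : W `<=` U by move=> q [].
have nf : nonvanishing W f by move=> q [Uq [W1q W2q]]; have [] := sE q Uq W1q.
have na : nonvanishing W a.
  move=> q [Uq [W1q W2q]] qa; have [fq sq] := sE q Uq W1q; have [gq tq] := tE q Uq W2q.
  have := unit_germN s Uq; rewrite /unit_germ sq tq [LHS]fraclM.
  move=> /fraclE[u qu] /=; rewrite mulr1 mul1r => e.
  have : q (u * (f * g)) by rewrite -e; apply: primeMl; exact: primeMr.
  by move=> /primeM[//|/primeM[]].
exists W, WU, a, f, na, nf; split=> //; apply: unit_germ_eq => q Wq.
have [Uq [W1q W2q]] := Wq; have [fq sq] := sE q Uq W1q.
rewrite /unit_germ /= (Prop_irrelevance (WU q Wq) Uq) sq.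
by congr (fracl (Frac _ _)); exact: Prop_irrelevance.
Qed.

Lemma frac_unitM U a f b g (na : nonvanishing U a) (nf : nonvanishing U f)
    (nb : nonvanishing U b) (ng : nonvanishing U g) (nab : nonvanishing U (a * b))
    (nfg : nonvanishing U (f * g)) :
  frac_unit na nf + frac_unit nb ng = frac_unit nab nfg.
Proof.
apply: unit_germ_eq => p Up; rewrite unit_germD [LHS]fraclM.
exact: fracl_eq.
Qed.

Lemma frac_unitE U a f b g (na : nonvanishing U a) (nf : nonvanishing U f)
    (nb : nonvanishing U b) (ng : nonvanishing U g) :
  a * g = b * f -> frac_unit na nf = frac_unit nb ng.
Proof. by move=> e; apply: unit_germ_eq => p Up; exact: fracl_eq. Qed.

Lemma frac_unitN U a f (na : nonvanishing U a) (nf : nonvanishing U f) :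
  - frac_unit na nf = frac_unit nf na.
Proof. by apply: unit_germ_eq => p Up. Qed.

Lemma frac_unit_res U V (VU : V `<=` U) a f (na : nonvanishing U a)
    (nf : nonvanishing U f) :
  res units VU (frac_unit na nf) =
  frac_unit (nonvanishing_sub VU na) (nonvanishing_sub VU nf).
Proof.
apply: unit_germ_eq => p Up; rewrite /unit_germ /=.
by congr (fracl (Frac _ _)); exact: Prop_irrelevance.
Qed.

(* The elements a/f of the localization at p that become 1 modulo J. *)
Definition one_mod (J : ideal A) p (z : localization p) : Prop :=
  exists a f (fp : ~ p f), z = fracl (Frac a fp) /\ exists2 u, ~ p u & J (u * (a - f)).

(** [one_mod] asks for some representing fraction; this makes the condition independent of the
    choice. *)
Lemma one_modE (J : ideal A) p a f (fp : ~ p f) :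
  one_mod J (fracl (Frac a fp)) <-> exists2 u, ~ p u & J (u * (a - f)).
Proof.
split=> [[b [g [gp [/fraclE /= [v pv e] [w pw Jw]]]]]|h]; last by exists a, f, fp.
exists (v * w * g); first exact: primeNM (primeNM pv pw) gp.
have -> : v * w * g * (a - f) = w * (v * (a * g)) - v * w * g * f by ring.
rewrite e; have -> : w * (v * (b * f)) - v * w * g * f = v * f * (w * (b - g)) by ring.
exact: idealMl.
Qed.

Lemma one_modM (J : ideal A) p (y z : localization p) :
  one_mod J y -> one_mod J z -> one_mod J (y * z).
Proof.
move=> [a [f [fp [-> [u pu Ju]]]]] [b [g [gp [-> [v pv Jv]]]]].
rewrite [_ * _]fraclM; apply/one_modE => /=; exists (u * v); first exact: primeNM.
have -> : u * v * (a * b - f * g) = v * b * (u * (a - f)) + u * f * (v * (b - g)) by ring.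
by apply: idealD; exact: idealMl.
Qed.

Lemma one_modV (J : ideal A) p (y z : localization p) :
  y * z = 1 -> one_mod J y -> one_mod J z.
Proof.
move=> yz [a [f [fp [yE [w pw Jw]]]]]; move: yz; rewrite yE.
elim/fraclP: z => -[b g gp]; rewrite [_ * _]fraclM => /fraclE[v pv] /=.
rewrite mulr1 mul1r => e; apply/one_modE; exists (v * f * w).
  exact: primeNM (primeNM pv fp) pw.
have -> : v * f * w * (b - g) = w * (v * f * b) - w * (v * (f * g)) by ring.
rewrite -e; have -> : w * (v * f * b) - w * (v * (a * b)) = - (v * b) * (w * (a - f)).
  by ring.
exact: idealMl.
Qed.

(** The kernel of reduction of units modulo J, tested at stalks. The condition is vacuous at primes
    not containing J, so the quotient is supported on V(J). *)
Definition congr_one (J : ideal A) : subpre units.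
Proof.
exists (fun U s => forall p (Up : opens_set U p), one_mod J (unit_germ s Up)).
- move=> U p Up; exists 1, 1, (@prime1 A p); split=> //.
  by exists 1; [exact: prime1|rewrite subrr mulr0; exact: ideal0].
- move=> U s t Ns Nt p Up; rewrite unit_germB; apply: one_modM => //.
  exact: one_modV (unit_germN t Up) (Nt p Up).
- by move=> U V VU s Ns p Vp; exact: Ns.
Defined.

(* The sheaf of units of A/J on Spec A. *)
Definition unitsmod (J : ideal A) : sheaf (Spec A) := coker_sheaf (congr_one J).

Lemma congr_one_frac (J : ideal A) U a f (na : nonvanishing U a) (nf : nonvanishing U f) :
  congr_one J U (frac_unit na nf) <->
  forall p, opens_set U p -> exists2 u, ~ p u & J (u * (a - f)).
Proof. by split=> h p Up; apply/(one_modE J a (nf p Up)); exact: h. Qed.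

Lemma congr_one_sub (J J' : ideal A) : (forall x, J x -> J' x) ->
  forall U (s : units U), congr_one J U s -> congr_one J' U s.
Proof.
move=> JJ' U s Ns p Up; have [a [f [fp [e [u pu Ju]]]]] := Ns p Up.
by exists a, f, fp; split=> //; exists u => //; exact: JJ'.
Qed.

Lemma germ_frac_eq0 (J : ideal A) U p (Up : opens_set U p) a f
    (na : nonvanishing U a) (nf : nonvanishing U f) :
  germ_at (congr_one J) Up (frac_unit na nf) = 0 <-> exists2 u, ~ p u & J (u * (a - f)).
Proof.
rewrite germ_eq0; split=> [[W [WU [Wp]]]|[u pu Ju]].
  by rewrite frac_unit_res => /congr_one_frac/(_ p Wp).
exists (opens_setI U (basic_open u)), (@setI_subl _ _ _); split; first by split.
by rewrite frac_unit_res; apply/congr_one_frac => q [Uq qu]; exists u.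
Qed.

Lemma germ_fracE (J : ideal A) U V p (Up : opens_set U p) (Vp : opens_set V p) a f b g
    (na : nonvanishing U a) (nf : nonvanishing U f)
    (nb : nonvanishing V b) (ng : nonvanishing V g) :
  germ_at (congr_one J) Up (frac_unit na nf) = germ_at (congr_one J) Vp (frac_unit nb ng)
  <-> exists2 u, ~ p u & J (u * (a * g - b * f)).
Proof.
pose W := opens_setI U V; have Wp : opens_set W p by [].
have WU : W `<=` U := @setI_subl _ _ _; have WV : W `<=` V := @setI_subr _ _ _.
rewrite -(germ_res _ WU Wp) -(germ_res _ WV Wp Vp) !frac_unit_res.
set s := frac_unit _ _; set t := frac_unit _ _.
have nag : nonvanishing W (a * g).
  by move=> q [Uq Vq]; exact: primeNM (na q Uq) (ng q Vq).
have nfb : nonvanishing W (f * b).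
  by move=> q [Uq Vq]; exact: primeNM (nf q Uq) (nb q Vq).
have e : s - t = frac_unit nag nfb by rewrite frac_unitN; exact: frac_unitM.
rewrite [b * f]mulrC -(germ_frac_eq0 J Wp nag nfb) -e raddfB /=.
by split=> [->|/eqP]; rewrite ?subrr // subr_eq0 => /eqP.
Qed.

Lemma unitsmod_loc (J : ideal A) U (s : unitsmod J U) p : opens_set U p ->
  exists W (WU : W `<=` U) a f (na : nonvanishing W a) (nf : nonvanishing W f),
    opens_set W p /\ forall q (Wq : opens_set W q),
      sky_at (coker_val s) (WU q Wq) = germ_at (congr_one J) Wq (frac_unit na nf).
Proof.
move=> Up; have [W [WU [g [Wp gE]]]] := coker_loc s Up.
have [V [VW [a [f [na [nf [Vp e]]]]]]] := unit_loc g Wp.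
exists V, (subset_trans VW WU), a, f, na, nf; split=> // q Vq.
by rewrite -e (germ_res _ _ _ (VW q Vq)) -gE; exact: sky_irr.
Qed.

Section IdealMayerVietoris.
Variables J0 J1 J2 J12 : ideal A.
Hypothesis J01 : forall x, J0 x -> J1 x.
Hypothesis J02 : forall x, J0 x -> J2 x.
Hypothesis J012 : forall x, J1 x -> J2 x -> J0 x.
Hypothesis J112 : forall x, J1 x -> J12 x.
Hypothesis J212 : forall x, J2 x -> J12 x.
Hypothesis J12D : forall x, J12 x -> exists y z, [/\ J1 y, J2 z & x = y + z].

Lemma congr_one_capI U (s : units U) :
  congr_one J1 U s -> congr_one J2 U s -> congr_one J0 U s.
Proof.
move=> N1 N2 p Up; have [a [f [fp [e [u pu Ju]]]]] := N1 p Up.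
have := N2 p Up; rewrite e => /one_modE[v pv Jv]; apply/one_modE.
exists (u * v); first exact: primeNM.
by apply: J012; [rewrite [u * v]mulrC|]; rewrite -mulrA; exact: idealMl.
Qed.

(* If J1 is not contained in p, then every unit is 1 modulo J1 near p; otherwise
   f + j1 is still invertible near p. *)
Lemma congr_oneD U (s : units U) p : congr_one J12 U s -> opens_set U p ->
  exists W (WU : W `<=` U) (a b : units W),
    [/\ opens_set W p, congr_one J1 W a, congr_one J2 W b & res units WU s = a + b].
Proof.
move=> N12 Up; have [W [WU [a [f [na [nf [Wp e]]]]]]] := unit_loc s Up.
have := sp_res WU N12; rewrite e => /congr_one_frac/(_ p Wp)[u pu /J12D[j1 [j2 [J1j J2j ujE]]]].
case: (pselect (forall x, J1 x -> p x)) => [J1p|/existsNP[j /not_implyP[Jj pj]]]; last first.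
  pose V := opens_setI W (basic_open j); have VW : V `<=` W := @setI_subl _ _ _.
  exists V, (subset_trans VW WU), (res units VW (frac_unit na nf)), 0; split=> //.
  - rewrite frac_unit_res; apply/congr_one_frac => q [Wq qj]; exists j => //.
    by rewrite mulrC; exact: idealMl.
  - exact: sp0.
  - by rewrite addr0 -e res2.
(* Also h = u * a - j2. Hence a / f is the product of h / (u * f), which is 1 modulo J1, and u * a /
   h, which is 1 modulo J2. *)
pose h := u * f + j1.
have ph : ~ p h.
  move=> ph; have : p (u * f).
    by rewrite -[u * f](addrK j1); apply: primeD => //; apply: primeN; exact: J1p.
  by move=> /primeM[//|]; apply: (nf p Wp).
pose V := opens_setI W (basic_open (h * u)); have VW : V `<=` W := @setI_subl _ _ _.
have nh : nonvanishing V h by move=> q [_ /= hq] qh; apply: hq; exact: primeMr.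
have nu : nonvanishing V u by move=> q [_ /= hq] qh; apply: hq; exact: primeMl.
have nuf : nonvanishing V (u * f) by move=> q Vq; exact: primeNM (nu q Vq) (nf q (VW q Vq)).
have nua : nonvanishing V (u * a) by move=> q Vq; exact: primeNM (nu q Vq) (na q (VW q Vq)).
exists V, (subset_trans VW WU), (frac_unit nh nuf), (frac_unit nua nh).
split; first by split=> // /primeM[].
- apply/congr_one_frac => q Vq; exists 1; first exact: prime1.
  by rewrite mul1r /h [_ + j1]addrC addrK.
- apply/congr_one_frac => q Vq; exists 1; first exact: prime1.
  suff -> : 1 * (u * a - h) = j2 by [].
  by rewrite mul1r /h opprD addrA -mulrBr ujE [j1 + j2]addrC addrK.
- have nhua : nonvanishing V (h * (u * a)) by move=> q Vq; exact: primeNM (nh q Vq) (nua q Vq).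
  have nufh : nonvanishing V (u * f * h) by move=> q Vq; exact: primeNM (nuf q Vq) (nh q Vq).
  rewrite (frac_unitM nh nuf nua nh nhua nufh) -res2 e frac_unit_res.
  by apply: frac_unitE; ring.
Qed.

Lemma unitsmod_mv : onto (coker_incl (congr_one_sub J112)) (opens_setT (Spec A)) ->
  acyclic (unitsmod J1) -> acyclic (unitsmod J2) -> acyclic (unitsmod J12) ->
  acyclic (unitsmod J0).
Proof.
exact: (mv_acyclic (congr_one_sub J01) (congr_one_sub J02) (@congr_one_capI)
  (N112 := congr_one_sub J112) (congr_one_sub J212) (@congr_oneD)).
Qed.

End IdealMayerVietoris.

(* Pullback of sections along the endomorphism of Spec A induced by r, which maps
   A/J' to A/J and is the identity modulo J'. *)
Lemma unitsmod_retract (r : {rmorphism A -> A}) (J J' : ideal A)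
    (JJ' : forall x, J x -> J' x) :
  (forall x, J' x -> J (r x)) -> (forall x, J' (x - r x)) ->
  onto (coker_incl (congr_one_sub JJ')) (opens_setT (Spec A)).
Proof.
move=> rJ r1 t.
have loc p : {W : opens (Spec A) & {a : A & {f : A & {na : nonvanishing W a &
    {nf : nonvanishing W f | opens_set W (comap r p) /\ forall q (Wq : opens_set W q),
      sky_at (coker_val t) (I : opens_set (opens_setT _) q) =
      germ_at (congr_one J') Wq (frac_unit na nf)}}}}}.
  have := unitsmod_loc t (I : opens_set (opens_setT _) (comap r p)).
  move=> /cid[W /cid[WU /cid[a /cid[f /cid[na /cid[nf [Wp e]]]]]]].
  by exists W, a, f, na, nf; split=> // q Wq; rewrite -e; exact: sky_irr.
have nr W a : nonvanishing W a -> nonvanishing (comap_open r W) (r a).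
  by move=> na p Wp; exact: (na _ Wp).
pose s := Sky (fun p (_ : opens_set (opens_setT _) p) =>
  let: existT W (existT a (existT f (existT na (exist nf (conj Wp _))))) := loc p in
  germ_at (congr_one J) (Wp : opens_set (comap_open r W) p) (frac_unit (nr _ _ na) (nr _ _ nf))).
(* The fractions were chosen separately at each point. At [comap r q] two choices agree modulo J',
   so their images under r agree at q modulo J. *)
have sP : s \in @loc_germ _ _ (congr_one J) (opens_setT _).
  rewrite unfold_in; apply/asboolP => p Tp.
  case: (loc p) => W [a [f [na [nf [Wp tE]]]]].
  exists (comap_open r W), (@subT _ _), (frac_unit (nr _ _ na) (nr _ _ nf)).
  split=> // q Wq /=; case: (loc q) => W' [a' [f' [na' [nf' [Wq' tE']]]]].
  have /germ_fracE[u qu Ju] := etrans (esym (tE' _ Wq')) (tE _ Wq).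
  apply/germ_fracE; exists (r u) => //.
  by rewrite -!rmorphM -rmorphB -rmorphM; exact: rJ.
exists (Coker sP); apply: coker_eq => p Tp.
have [W [a [f [na [nf [Wp tE sE]]]]]] : exists W a f (na : nonvanishing W a)
    (nf : nonvanishing W f), exists2 Wp : opens_set W (comap r p),
    forall q (Wq : opens_set W q), sky_at (coker_val t) (I : opens_set (opens_setT _) q) =
      germ_at (congr_one J') Wq (frac_unit na nf) &
    sky_at s Tp = germ_at (congr_one J) (Wp : opens_set (comap_open r W) p)
      (frac_unit (nr _ _ na) (nr _ _ nf)).
  by rewrite /=; case: (loc p) => W [a [f [na [nf [Wp tE]]]]]; exists W, a, f, na, nf, Wp.
rewrite (coker_incl_germ (congr_one_sub JJ') (s := Coker sP) sE).
(* Off V(J') all germs of units modulo J' coincide. On V(J') the map [comap r] fixes p, because r is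
   the identity modulo J'. *)
case: (pselect (forall x, J' x -> p x)) => [Jp|/existsNP[j /not_implyP[Jj pj]]]; last first.
  have [V [VU [b [g [nb [ng [Vp e]]]]]]] := unitsmod_loc t Tp.
  rewrite (sky_irr _ Tp (VU p Vp)) e; apply/germ_fracE; exists j => //.
  by rewrite mulrC; exact: idealMl.
have rp : comap r p = p.
  apply: Spec_eq => x /=; split=> [pr|px]; first exact: primeB_eq (Jp _ (r1 x)) pr.
  apply: (primeB_eq (y := x)) => //; rewrite -opprB; apply: primeN; exact/Jp.
have Wp' : opens_set W p by rewrite -rp; apply: (Wp).
rewrite (sky_irr _ Tp I) (tE p Wp'); apply/germ_fracE; exists 1; first exact: prime1.
have -> : 1 * (r a * f - a * r f) = a * (f - r f) + - f * (a - r a) by ring.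
by apply: idealD; exact: idealMl.
Qed.

End Zariski.

(** * Units modulo a prime with factorial quotient *)

Lemma subrBB (V : zmodType) (x y z : V) : x - z - (y - z) = x - y.
Proof. by rewrite opprB addrA subrK. Qed.

Section FactorialQuotient.
Variables (A : comPzRingType) (B : idomainType) (pi : {rmorphism A -> B}) (J : ideal A).
Hypothesis piS : forall b, exists a, pi a = b.
Hypothesis JE : forall a, J a <-> pi a = 0.
Hypothesis factB : factorial_domain B.
Implicit Types (U V W : opens (Spec A)) (p q : Spec A).

Definition generic : Spec A.
Proof.
exists J.
- exact: ideal0.
- exact: idealD.
- exact: idealMl.
- by move=> /JE/eqP; rewrite rmorph1 oner_eq0.
- by move=> x y /JE/eqP; rewrite rmorphM mulf_eq0 => /orP[]/eqP/JE; [left|right].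
Defined.

Definition prime_divisor (c : B) (cp : prime_elt c) : Spec A.
Proof.
exists (fun a => divides c (pi a)).
- by exists 0; rewrite rmorph0 mul0r.
- by move=> x y [z e] [w e']; exists (z + w); rewrite rmorphD e e' mulrDl.
- by move=> a x h; rewrite rmorphM; exact: divides_mull.
- by rewrite rmorph1; apply: prime_elt_ndvd_unit => //; exact: unitr1.
- by move=> x y; rewrite rmorphM; case: cp => _ _; exact.
Defined.

Definition above q : Prop := forall x, J x -> q x.

(** Points of Spec B are represented by the primes q of A above J; this is the corresponding prime
    of B. *)
Definition pimage q (b : B) : Prop := exists2 a, pi a = b & q a.

Lemma over_generic U q : above q -> opens_set U q -> opens_set U generic.
Proof. by move=> qJ Uq; exact: (open_generalize (p := generic) Uq qJ). Qed.

Lemma pimageE q a : above q -> pimage q (pi a) <-> q a.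
Proof.
move=> qJ; split=> [[b e qb]|qa]; last by exists a.
by apply: primeB_eq qb; apply/qJ/JE; rewrite rmorphB e subrr.
Qed.

Lemma pimageM q x y : above q -> pimage q (x * y) -> pimage q x \/ pimage q y.
Proof.
move=> qJ; have [a <-] := piS x; have [b <-] := piS y.
by rewrite -rmorphM !pimageE //; exact: primeM.
Qed.

Lemma pimage_mull q x y : above q -> pimage q y -> pimage q (x * y).
Proof.
by move=> qJ; have [a <-] := piS x; have [b <-] := piS y;
  rewrite -rmorphM !pimageE //; exact: primeMl.
Qed.

Lemma pimage_unit q u : above q -> u \is a GRing.unit -> ~ pimage q u.
Proof.
move=> qJ uu /(pimage_mull u^-1 qJ); rewrite mulVr // -(rmorph1 pi) pimageE //.
exact: prime1.
Qed.

Lemma over_prime_divisor c (cp : prime_elt c) : above (prime_divisor cp).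
Proof. by move=> x /JE e /=; exists 0; rewrite e mul0r. Qed.

Lemma pimage_prime_divisor c (cp : prime_elt c) x :
  pimage (prime_divisor cp) x <-> divides c x.
Proof. by have [a <-] := piS x; rewrite pimageE //; exact: over_prime_divisor. Qed.

Lemma prime_divisor_sub q c (cp : prime_elt c) : above q -> pimage q c ->
  forall x, prime_divisor cp x -> q x.
Proof. by move=> qJ qc x [z e]; apply/pimageE => //; rewrite e; exact: pimage_mull. Qed.

(* The stalk at the generic point of V(J) is the group of nonzero fractions x/y in the
   fraction field of B. *)
Definition rat_units : zmodType := stalk (congr_one J) generic.

Definition represents (m : rat_units) (x y : B) : Prop :=
  exists U (Ux : opens_set U generic) a f (na : nonvanishing U a) (nf : nonvanishing U f),
    [/\ m = germ_at _ Ux (frac_unit na nf), pi a = x & pi f = y].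

Lemma represents_neq0 m x y : represents m x y -> x != 0 /\ y != 0.
Proof.
move=> [U [Ux [a [f [na [nf [_ <- <-]]]]]]]; split; apply/eqP => /JE.
  exact: (na _ Ux).
exact: (nf _ Ux).
Qed.

Lemma represents_ex m : exists x y, represents m x y.
Proof.
elim/germ_atP: m => U Ux s; have [W [WU [a [f [na [nf [Wx e]]]]]]] := unit_loc s Ux.
by exists (pi a), (pi f), W, Wx, a, f, na, nf; rewrite -e; split=> //; rewrite germ_res.
Qed.

Lemma represents_mk x y : x != 0 -> y != 0 -> exists m, represents m x y.
Proof.
have [a <-] := piS x; have [f <-] := piS y => /eqP a0 /eqP f0.
have Ux : opens_set (basic_open (a * f)) generic.
  by move=> /(@primeM _ generic)[/JE|/JE].
have na : nonvanishing (basic_open (a * f)) a by move=> q qaf qa; apply: qaf; exact: primeMr.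
have nf : nonvanishing (basic_open (a * f)) f by move=> q qaf qf; apply: qaf; exact: primeMl.
by exists (germ_at _ Ux (frac_unit na nf)), _, Ux, a, f, na, nf.
Qed.

Lemma represents_eq m n x y z w : represents m x y -> represents n z w ->
  m = n <-> x * w = z * y.
Proof.
move=> [U [Ux [a [f [na [nf [-> <- <-]]]]]]] [V [Vx [b [g [nb [ng [-> <- <-]]]]]]].
rewrite germ_fracE -!rmorphM; split=> [[u uJ /JE/eqP]|e].
  rewrite rmorphM mulf_eq0 rmorphB subr_eq0 => /orP[/eqP/JE//|/eqP//].
by exists 1; [exact: (@prime1 _ generic)|apply/JE; rewrite mul1r rmorphB e subrr].
Qed.

Lemma represents_cross m x y z w : represents m x y -> z != 0 -> w != 0 ->
  x * w = z * y -> represents m z w.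
Proof.
move=> mxy z0 w0 e; have [n nzw] := represents_mk z0 w0.
by have /(represents_eq mxy nzw) -> : x * w = z * y.
Qed.

Lemma representsN m x y : represents m x y -> represents (- m) y x.
Proof.
move=> [U [Ux [a [f [na [nf [-> <- <-]]]]]]].
by exists U, Ux, f, a, nf, na; rewrite -raddfN frac_unitN.
Qed.

Lemma representsD m n x y z w : represents m x y -> represents n z w ->
  represents (m + n) (x * z) (y * w).
Proof.
move=> [U [Ux [a [f [na [nf [-> <- <-]]]]]]] [V [Vx [b [g [nb [ng [-> <- <-]]]]]]].
pose W := opens_setI U V; have Wx : opens_set W generic by [].
have WU : W `<=` U := @setI_subl _ _ _; have WV : W `<=` V := @setI_subr _ _ _.
rewrite -(germ_res _ WU Wx) -(germ_res _ WV Wx Vx) !frac_unit_res.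
have nab : nonvanishing W (a * b) by move=> q [Uq Vq]; exact: primeNM (na q Uq) (nb q Vq).
have nfg : nonvanishing W (f * g) by move=> q [Uq Vq]; exact: primeNM (nf q Uq) (ng q Vq).
exists W, Wx, (a * b), (f * g), nab, nfg; rewrite !rmorphM -raddfD; split=> //.
by congr germ_at; exact: frac_unitM.
Qed.

(* At a prime divisor c this says that the valuation of m at c vanishes. *)
Definition unit_at q (m : rat_units) : Prop :=
  exists x y, [/\ represents m x y, ~ pimage q x & ~ pimage q y].

Lemma unit_atB q m n : above q -> unit_at q m -> unit_at q n -> unit_at q (m - n).
Proof.
move=> qJ [x [y [mxy qx qy]]] [z [w [nzw qz qw]]].
exists (x * w), (y * z); split; first exact: representsD (representsN nzw).
  by move/(pimageM qJ) => [].
by move/(pimageM qJ) => [].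
Qed.

Lemma unit_at_generalize p q m : above q -> (forall x, p x -> q x) -> unit_at q m ->
  unit_at p m.
Proof.
move=> qJ pq [x [y [mxy qx qy]]]; exists x, y.
by split=> // -[a e pa]; [apply: qx|apply: qy]; exists a => //; exact: pq.
Qed.

(** Clears q from the numerator one prime factor c at a time. If c lies in q, vanishing valuation at
    c forces c to divide y as well, and it cancels. Otherwise c is a unit at q: m is divided by it
    and it is restored at the end. *)
Lemma unit_at_prime_num q x : above q -> factored x -> forall m y,
  (forall c (cp : prime_elt c), pimage q c -> unit_at (prime_divisor cp) m) ->
  represents m x y -> exists x' y', represents m x' y' /\ ~ pimage q x'.
Proof.
move=> qJ; elim=> [u uu|c z cp _ IH] m y mP mxy.
  by exists u, y; split=> //; exact: pimage_unit.
have [cz0 y0] := represents_neq0 mxy.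
have [c0 cu cP] := cp; have z0 : z != 0 by apply: contraNneq cz0 => ->; rewrite mulr0.
case: (pselect (pimage q c)) => [qc|qc].
  have [s [t [mst cs ct]]] := mP c cp qc.
  have /(represents_eq mxy mst) e : m = m by [].
  have : divides c (s * y) by exists (z * t); rewrite -e; ring.
  case/cP => [/(pimage_prime_divisor cp)//|[w yE]].
  have w0 : w != 0 by apply: contraNneq y0 => w0; rewrite yE w0 mul0r.
  apply: (IH m w mP); apply: (represents_cross mxy) => //.
  by rewrite yE; ring.
have [n nc] := represents_mk c0 (oner_neq0 B).
have [||x' [y' [mn qx']]] := IH (m - n) y.
- move=> d dp qd; apply: unit_atB (mP d dp qd) _; first exact: over_prime_divisor.
  apply: (unit_at_generalize qJ (prime_divisor_sub qJ qd)).
  by exists c, 1; split=> //; apply: pimage_unit; rewrite ?unitr1.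
- apply: (represents_cross (representsD mxy (representsN nc))) => //; ring.
exists (x' * c), (y' * 1); split; last by move/(pimageM qJ) => [].
by rewrite -[m](subrK n); exact: representsD.
Qed.

Lemma pimage_factored q x : above q -> factored x -> pimage q x ->
  exists c, [/\ prime_elt c, divides c x & pimage q c].
Proof.
move=> qJ; elim=> [u uu /(pimage_unit qJ uu)//|c y cp _ IH /(pimageM qJ)[qc|/IH]].
  by exists c; split=> //; exists y; rewrite mulrC.
by move=> [d [dp dy qd]]; exists d; split=> //; exact: divides_mull.
Qed.

(** A fraction is a unit at q once its valuations at the primes through q vanish. With the numerator
    x outside q, a prime factor c of y lying in q would also divide x. *)
Lemma unit_at_primes q m : above q ->
  (forall c (cp : prime_elt c), pimage q c -> unit_at (prime_divisor cp) m) -> unit_at q m.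
Proof.
move=> qJ mP; have [x0 [y0 m0]] := represents_ex m.
have [x [y [mxy qx]]] := unit_at_prime_num qJ (factB (represents_neq0 m0).1) mP m0.
exists x, y; split=> // qy.
have [c [cp cy qc]] := pimage_factored qJ (factB (represents_neq0 mxy).2) qy.
have [s [t [mst cs ct]]] := mP c cp qc.
have /(represents_eq mxy mst) e : m = m by [].
have /(_ x t)[] : forall x y, divides c (x * y) -> divides c x \/ divides c y.
- by have [] := cp.
- by rewrite e; exact: divides_mull.
- move=> [z xE]; apply: qx; rewrite xE; exact: pimage_mull.
- by move/pimage_prime_divisor.
Qed.

(* Pic of every open subset of Spec B vanishes: a Cartier divisor on U, given by the local
   equations m q, is principal.  Induction on the factorization of an element g outside
   whose zero locus the divisor is already trivial. *)
Lemma cartier_principal U g : factored g -> forall m : Spec A -> rat_units,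
  (forall q, opens_set U q -> above q -> exists2 W : opens (Spec A), opens_set W q &
     forall p, opens_set U p -> above p -> opens_set W p -> unit_at p (m p - m q)) ->
  (forall q, opens_set U q -> above q -> ~ pimage q g -> unit_at q (m q)) ->
  exists n, forall q, opens_set U q -> above q -> unit_at q (m q - n).
Proof.
elim=> [u uu|c h cp _ IH] m mC mT.
  by exists 0 => q Uq qJ; rewrite subr0; apply: mT => //; exact: pimage_unit.
have [c0 cu cP] := cp; pose b := prime_divisor cp.
have bJ : above b := over_prime_divisor cp.
(* If b is not in U, no point of U above J contains c, and the divisor is already trivial outside
   the zero locus of h. *)
case: (pselect (opens_set U b)) => Ub; last first.
  apply: IH => // q Uq qJ qh; apply: mT => // /(pimageM qJ)[qc|//].
  apply: Ub; exact: open_generalize Uq (prime_divisor_sub qJ qc).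
have [x [y mxy]] := represents_ex (m b); have [x0 y0] := represents_neq0 mxy.
(* The fraction n = c ^+ i / c ^+ j carries the whole valuation of m b at c and is a unit wherever c
   is. *)
have [i [x' [xE cx']]] := factored_pow cp (factB x0).
have [j [y' [yE cy']]] := factored_pow cp (factB y0).
have ci0 k : c ^+ k != 0 by exact: expf_neq0.
have [n nc] := represents_mk (ci0 i) (ci0 j).
have nP q : above q -> ~ pimage q c -> unit_at q n.
  move=> qJ qc; have qck k : ~ pimage q (c ^+ k).
    elim: k => [|k IHk]; first by rewrite expr0; apply: pimage_unit; rewrite ?unitr1.
    by rewrite exprS => /(pimageM qJ)[].
  by exists (c ^+ i), (c ^+ j).
have bn : unit_at b (m b - n).
  exists x', y'; split; try by move/pimage_prime_divisor.
  have x'0 : x' != 0 by apply: contraNneq x0 => e; rewrite xE e mulr0.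
  have y'0 : y' != 0 by apply: contraNneq y0 => e; rewrite yE e mulr0.
  apply: (represents_cross (representsD mxy (representsN nc))) => //.
  by rewrite xE yE; ring.
have [|q Uq qJ qh|k kP] := IH (fun q => m q - n).
- move=> q Uq qJ; have [W Wq WP] := mC q Uq qJ; exists W => // p Up pJ Wp.
  by rewrite [X in unit_at p X](subrBB (m p) (m q) n); exact: WP.
(* Only the primes d through q matter, and there m q may be replaced by m e. Either d is associate
   to c, where n was fitted, or c is a unit at d and both m e and n are units. *)
- apply: unit_at_primes => // d dp qd; set e := prime_divisor dp.
  have eJ : above e := over_prime_divisor dp.
  have eq : forall x, e x -> q x := prime_divisor_sub qJ qd.
  have Ue : opens_set U e := open_generalize Uq eq.
  have [W Wq WP] := mC q Uq qJ; have We := open_generalize Wq eq.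
  have eh : ~ pimage e h by move=> [a ah ea]; apply: qh; exists a => //; exact: eq.
  suff en : unit_at e (m e - n).
    rewrite [X in unit_at _ X](_ : _ = (m e - n) - (m e - m q)); last first.
      by rewrite -[X in X - n](subKr (m e)) addrAC.
    by apply: unit_atB => //; exact: WP.
  case: (pselect (pimage e c)) => [ec|ec]; last first.
    by apply: unit_atB; [|apply: mT => // /(pimageM eJ)[]|exact: nP].
  have /pimage_prime_divisor dc := ec; have cd := prime_elt_assoc dp cp dc.
  have -> : e = b; last exact: bn.
  apply: Spec_eq => z; split; apply: prime_divisor_sub => //.
  exact/pimage_prime_divisor.
- exists (n + k) => q Uq qJ; rewrite opprD addrA; exact: kP.
Qed.

End FactorialQuotient.

(** * Rational functions and Cartier divisors on V(J) *)

Section FactorialSheaf.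
Variables (A : comPzRingType) (B : idomainType) (pi : {rmorphism A -> B}) (J : ideal A).
Hypothesis piS : forall b, exists a, pi a = b.
Hypothesis JE : forall a, J a <-> pi a = 0.
Hypothesis factB : factorial_domain B.
Implicit Types (U V W : opens (Spec A)) (p q : Spec A).

Let xi : Spec A := generic JE.
Let M : zmodType := rat_units JE.

(* The constant sheaf on V(J) with stalk M, as a skyscraper at the generic point. *)
Definition rat_sheaf : sheaf (Spec A) := sky_sheaf (fun x => (x = xi -> M) : zmodType).

Definition rat_eval U (Ux : opens_set U xi) (l : rat_sheaf U) : M := sky_at l Ux erefl.

Lemma rat_sheaf_eq U (l l' : rat_sheaf U) :
  (forall Ux : opens_set U xi, rat_eval Ux l = rat_eval Ux l') -> l = l'.
Proof.
move=> h; apply: sky_eq => x Ux; apply: funext => e; subst x.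
exact: h.
Qed.

Lemma rat_evalB U (Ux : opens_set U xi) (l l' : rat_sheaf U) :
  rat_eval Ux (l - l') = rat_eval Ux l - rat_eval Ux l'.
Proof. by []. Qed.

Lemma rat_eval_res U V (VU : V `<=` U) (Ux : opens_set U xi) (Vx : opens_set V xi)
  (l : rat_sheaf U) : rat_eval Vx (res rat_sheaf VU l) = rat_eval Ux l.
Proof. by rewrite /rat_eval /= (sky_irr _ _ Ux). Qed.

Definition rat_const U (m : M) : rat_sheaf U := Sky (fun _ _ _ => m).

Definition rat_map_fun U (s : unitsmod J U) : rat_sheaf U :=
  Sky (fun x Ux (e : x = xi) =>
    sky_at (coker_val s) (eq_ind x (opens_set U) Ux xi e) : M).

Fact rat_map_is_zmod_morphism U : zmod_morphism (@rat_map_fun U).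
Proof. by move=> s t; apply: sky_eq => x Ux; apply: funext. Qed.
HB.instance Definition _ U := GRing.isZmodMorphism.Build (unitsmod J U) (rat_sheaf U)
  (@rat_map_fun U) (@rat_map_is_zmod_morphism U).

Fact rat_map_res U V (VU : V `<=` U) (s : unitsmod J U) :
  rat_map_fun (res (unitsmod J) VU s) = res rat_sheaf VU (rat_map_fun s).
Proof.
apply: rat_sheaf_eq => Vx; rewrite /rat_eval /=; exact: sky_irr.
Qed.

Definition rat_map : sheaf_hom (unitsmod J) rat_sheaf :=
  @SheafHom _ (unitsmod J) rat_sheaf
    (fun U => @rat_map_fun U : {additive unitsmod J U -> rat_sheaf U}) rat_map_res.

Lemma rat_evalE U (Ux : opens_set U xi) (s : unitsmod J U) :
  rat_eval Ux (rat_map U s) = sky_at (coker_val s) Ux.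
Proof. by []. Qed.

(** J is prime: if u * (a - f) is in J with u outside J, then a - f is in J. So triviality at the
    generic point spreads to all of V(J). *)
Lemma rat_map_mono : sheaf_mono rat_map.
Proof.
move=> U s t e; apply/eqP; rewrite -subr_eq0; apply/eqP.
have {e} : rat_map U (s - t) = 0 by rewrite raddfB e subrr.
move: (s - t) => {s t} s e; apply: coker_eq => p Up.
have [W [WU [a [f [na [nf [Wp sE]]]]]]] := unitsmod_loc s Up.
rewrite (sky_irr _ Up (WU p Wp)) sE [RHS]/=; apply/germ_frac_eq0.
case: (pselect (above J p)) => [Jp|/existsNP[j /not_implyP[Jj pj]]]; last first.
  by exists j => //; rewrite mulrC; exact: idealMl.
have Wx : opens_set W xi := over_generic JE Jp Wp.
have : sky_at (coker_val s) (WU xi Wx) = 0 by rewrite -rat_evalE e.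
rewrite sE => /germ_frac_eq0[u xu Ju]; exists 1; first exact: prime1.
by have [//|xaf] := @primeM _ xi _ _ Ju; rewrite mul1r.
Qed.

Let N := im_sp rat_map.

(** A section d of the quotient is a Cartier divisor; choosing a local equation m q at each point
    puts it in the form treated by [cartier_principal]. *)
Lemma rat_proj_onto U : onto (coker_proj N) U.
Proof.
move=> d.
have loc q (Uq : opens_set U q) := coker_proj_loc d Uq.
case: (pselect (opens_set U xi)) => Ux; last first.
  exists 0; rewrite raddf0; apply: sheaf_sep => q Uq.
  have [W [WU [l [Wq lE]]]] := loc q Uq; exists W, WU; split=> //.
  rewrite raddf0 -lE (_ : l = 0) ?raddf0 //.
  by apply: rat_sheaf_eq => Wx; case: Ux; apply: (WU xi Wx).
have /choice[m mP] : forall q, exists m : M, opens_set U q -> above J q ->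
    exists W (WU : W `<=` U) (l : rat_sheaf W) (Wx : opens_set W xi),
      [/\ opens_set W q, coker_proj N W l = res (coker_sheaf N) WU d & rat_eval Wx l = m].
  move=> q; case: (pselect (opens_set U q /\ above J q)) => [[Uq Jq]|h]; last first.
    by exists 0 => Uq Jq; case: h.
  have [W [WU [l [Wq lE]]]] := loc q Uq; have Wx : opens_set W xi := over_generic JE Jq Wq.
  by exists (rat_eval Wx l) => _ _; exists W, WU, l, Wx.
have coh q p W (WU : W `<=` U) (l : rat_sheaf W) (Wx : opens_set W xi) :
    opens_set U p -> above J p -> opens_set W p ->
    coker_proj N W l = res (coker_sheaf N) WU d -> rat_eval Wx l = m q ->
    unit_at p (m p - m q).
  move=> Up Jp Wp lE lm; have [W' [WU' [l' [Wx' [W'p lE' <-]]]]] := mP p Up Jp.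
  rewrite -lm; pose V := opens_setI W' W; have VU := subset_trans (@setI_subr _ W' W) WU.
  have : coker_proj N V (res rat_sheaf (@setI_subl _ W' W) l' -
      res rat_sheaf (@setI_subr _ W' W) l) = 0.
    rewrite raddfB !sheaf_map_res lE lE' !res2.
    by rewrite (res_irr (subset_trans _ WU') VU) (res_irr (subset_trans _ WU) VU) subrr.
  move=> /coker_proj_eq0/(_ p (conj W'p Wp))[T [TV [Tp [s sE]]]].
  have Tx : opens_set T xi := over_generic JE Jp Tp.
  have [W2 [W2T [a [f [na [nf [W2p tE]]]]]]] := unitsmod_loc s Tp.
  have W2x : opens_set W2 xi := over_generic JE Jp W2p.
  exists (pi a), (pi f); split; [|rewrite (pimageE JE) //; exact: (na p W2p)|
    rewrite (pimageE JE) //; exact: (nf p W2p)].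
  exists W2, W2x, a, f, na, nf; split=> //; rewrite -tE.
  rewrite -(rat_evalE (W2T xi W2x)) sE (rat_eval_res _ (conj Wx' Wx : opens_set V xi)).
  by rewrite rat_evalB !(rat_eval_res _ Wx) (rat_eval_res _ Wx').
(* The equation chosen at the generic point is valid on a basic open set of some g. After division
   by m xi the divisor is trivial there, and the factorization of pi g drives the induction in
   [cartier_principal]. *)
have [g xg gP] : exists2 g, ~ xi g & forall q, opens_set U q -> above J q -> ~ q g ->
    unit_at q (m q - m xi).
  have [W [WU [l [Wx [_ lE lm]]]]] := mP xi Ux (fun _ => id).
  have [g xg gW] := basic_open_nbhs Wx; exists g => // q Uq Jq qg.
  by apply: (coh xi q W WU l Wx) => //; exact: gW.
have g0 : pi g != 0 by apply/eqP => /JE.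
have [||n nP] := cartier_principal piS factB (U := U) (factB g0) (m := fun q => m q - m xi).
- move=> q Uq Jq; have [W [WU [l [Wx [Wq lE lm]]]]] := mP q Uq Jq.
  exists W => // p Up Jp Wp; rewrite [X in unit_at p X](subrBB (m p) (m q) (m xi)).
  exact: (coh q p W WU l Wx).
- by move=> q Uq Jq; rewrite (pimageE JE) // => qg; exact: gP.
exists (rat_const U (n + m xi)); apply: sheaf_sep => q Uq.
(* Off V(J), inverting an element of J removes the generic point, and rational functions vanish on
   what is left. *)
case: (pselect (above J q)) => [Jq|/existsNP[j /not_implyP[Jj qj]]]; last first.
  have [W [WU [l [Wq lE]]]] := loc q Uq.
  have VW : opens_setI W (basic_open j) `<=` W := @setI_subl _ _ _.
  exists (opens_setI W (basic_open j)), (subset_trans VW WU); split=> //.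
  rewrite -res2 -res2 -sheaf_map_res -lE -!sheaf_map_res; congr (coker_proj N _ _).
  by apply: rat_sheaf_eq => -[Wx].
have [W [WU [l [Wx [Wq lE lm]]]]] := mP q Uq Jq.
have [x [y [[U0 [U0x [a [f [na [nf [aE ax fy]]]]]]] qx qy]]] := nP q Uq Jq.
pose V := opens_setI W (basic_open (a * f)); have VW : V `<=` W := @setI_subl _ _ _.
have naV : nonvanishing V a by move=> p [_ paf] pa; apply: paf; exact: primeMr.
have nfV : nonvanishing V f by move=> p [_ paf] pa; apply: paf; exact: primeMl.
have Vq : opens_set V q.
  by split=> //= /primeM[qa|qf]; [apply: qx|apply: qy]; [exists a|exists f].
exists V, (subset_trans VW WU); split=> //.
rewrite -[RHS]res2 -lE -!sheaf_map_res; apply/eqP; rewrite eq_sym -subr_eq0 -raddfB.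
apply/eqP; apply: coker_proj_sp; exists (coker_proj _ V (frac_unit naV nfV)).
apply: rat_sheaf_eq => Vx; rewrite rat_evalB (rat_eval_res _ Wx) lm.
rewrite (_ : rat_eval Vx (res _ _ (rat_const U _)) = m xi + n); last by rewrite [m xi + n]addrC.
rewrite opprD addrA [RHS]aE.
by apply/germ_fracE; exists 1; [exact: prime1|rewrite subrr mulr0; exact: ideal0].
Qed.

(** Divisors lift to rational functions over every open set, so they inherit flasqueness; the units
    are then the kernel in a flasque resolution of length one. *)
Lemma unitsmod_factorial_acyclic : acyclic (unitsmod J).
Proof.
have rses := ses_coker rat_map_mono.
have flR : flasque rat_sheaf by move=> U V VU s; exact: sky_res_onto.
have flC : flasque (coker_sheaf N).
  move=> U V VU s; have [t <-] := rat_proj_onto s; have [r <-] := flR U V VU t.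
  by exists (coker_proj N U r); rewrite sheaf_map_res.
move=> n; apply: acyclic_upto_l rses _ _ _; first exact: rat_proj_onto.
  exact: flasque_acyclic.
exact: flasque_acyclic.
Qed.

End FactorialSheaf.

(** * Gluing along commuting retractions *)

Section Retractions.
Variables (A : comPzRingType) (I : eqType) (meet : I -> I -> I).
Variable rho : I -> {rmorphism A -> A}.
Hypothesis rhoM : forall i j x, rho i (rho j x) = rho (meet i j) x.
Hypothesis meetC : commutative meet.
Hypothesis meetI : idempotent_op meet.
Implicit Types s : seq I.

(** For the face restrictions below, A modulo this ideal is the Stanley-Reisner ring of the
    subcomplex generated by the faces in s. The empty list gives the unit ideal. *)
Definition ker_rho s : ideal A.
Proof.
exists (fun x => forall i, i \in s -> rho i x = 0).
- by move=> i _; exact: rmorph0.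
- by move=> x y hx hy i si; rewrite rmorphD hx ?hy ?addr0.
- by move=> a x hx i si; rewrite rmorphM hx ?mulr0.
Defined.

Lemma unitsmod_all_eq0 (J : ideal A) U (s : unitsmod J U) : (forall x, J x) -> s = 0.
Proof.
move=> Jall; apply: coker_eq => p Up.
have [W [WU [a [f [na [nf [Wp sE]]]]]]] := unitsmod_loc s Up.
rewrite (sky_irr _ Up (WU p Wp)) sE; apply/germ_frac_eq0.
by exists 1; first exact: prime1.
Qed.

Lemma unitsmod_all_acyclic (J : ideal A) : (forall x, J x) -> acyclic (unitsmod J).
Proof.
move=> Jall; apply: flasque_acyclic => U V VU s.
by exists 0; rewrite raddf0 (unitsmod_all_eq0 s Jall).
Qed.

Lemma ker_rho_retract i s x : ker_rho (map (meet i) s) x -> ker_rho s (rho i x).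
Proof. by move=> h j js; rewrite rhoM meetC h // map_f. Qed.

Lemma ker_rho_retractB i s x : ker_rho (map (meet i) s) (x - rho i x).
Proof.
by move=> _ /mapP[j js ->]; rewrite meetC rmorphB -!rhoM (rhoM i i) meetI subrr.
Qed.

Variable good : pred I.
Hypothesis good_meet : forall i j, good i -> good j -> good (meet i j).
Hypothesis good_acyclic : forall i, good i -> acyclic (unitsmod (ker_rho [:: i])).

(* A/ker(i :: s) is the fibre product of A/ker(i) and A/ker(s) over A/ker(meet i s), and
   rho i lifts A/ker(meet i s) back to A/ker(s). *)
Lemma ker_rho_acyclic s : all good s -> acyclic (unitsmod (ker_rho s)).
Proof.
(* Induction on the length, because [map (meet i) s] is shorter than [i :: s] but consists of other
   indices. *)
have [n] := ubnP (size s); elim: n s => // n IH [_ _|i s /= sn /andP[gi gs]].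
  exact: unitsmod_all_acyclic.
have sub1 x : ker_rho s x -> ker_rho (map (meet i) s) x.
  by move=> h _ /mapP[j js ->]; rewrite -rhoM h // rmorph0.
apply: (@unitsmod_mv A (ker_rho (i :: s)) (ker_rho s) (ker_rho [:: i])
  (ker_rho (map (meet i) s)) _ _ _ sub1).
- by move=> x h j js; apply: h; rewrite inE js orbT.
- by move=> x h j; rewrite inE => /eqP ->; apply: h; rewrite inE eqxx.
- move=> x h1 h2 j; rewrite inE => /orP[/eqP ->|]; last exact: h1.
  by apply: h2; rewrite inE.
- by move=> x h _ /mapP[j js ->]; rewrite meetC -rhoM h ?inE // rmorph0.
(* The retraction also shows that the kernel for the intersection is the sum of the two kernels. *)
- move=> x h; exists (rho i x), (x - rho i x); split.
  + exact: ker_rho_retract.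
  + by move=> j; rewrite inE => /eqP ->; rewrite rmorphB rhoM meetI subrr.
  + by rewrite addrC subrK.
- apply: (@unitsmod_retract _ (rho i)) => x; first exact: ker_rho_retract.
  exact: ker_rho_retractB.
- exact: IH.
- exact: good_acyclic.
- apply: IH; first by rewrite size_map.
  by apply/allP => _ /mapP[j js ->]; apply: good_meet => //; exact: (allP gs).
Qed.

(** With J zero, [unitsmod J] is the sheaf of units up to isomorphism. The isomorphism is used as a
    short exact sequence whose third term, the units of the zero ring, vanishes. *)
Lemma units_acyclic s : (forall x, ker_rho s x -> x = 0) -> all good s -> acyclic (units A).
Proof.
move=> s0 gs; pose J := ker_rho s.
have subT' x : J x -> ker_rho [::] x by [].
have pI : sheaf_mono (coker_proj (congr_one J)).
  move=> U t t' e; apply/eqP; rewrite -subr_eq0; apply/eqP.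
  have {e} : coker_proj (congr_one J) U (t - t') = 0 by rewrite raddfB e subrr.
  move: (t - t') => {}t /coker_proj_eq0 loc; apply: sheaf_sep => p /loc[W [WU [Wp Nt]]].
  exists W, WU; split=> //; apply: unit_germ_eq => q Wq; rewrite raddf0.
  have [a [f [qf [-> [u qu /s0 Ju]]]]] := Nt q Wq.
  apply/fraclE; exists u => //=; rewrite mulr1 mul1r.
  by apply/eqP; rewrite -subr_eq0 -mulrBr Ju.
have pses : ses (coker_proj (congr_one J)) (coker_incl (congr_one_sub subT')).
  split=> // [U t|U t x Ux].
    split=> _; last exact: unitsmod_all_eq0.
    apply: (mono_loc_im pI) => x Ux; have [W [WU [g [Wx gE]]]] := coker_proj_loc t Ux.
    by exists W, WU; split=> //; exists g.
  exists U, (@subset_refl _ _), 0; split=> //.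
  by rewrite raddf0 res_id; apply: esym; exact: unitsmod_all_eq0.
move=> n; apply: (acyclic_upto_l pses) => [t||].
- by exists 0; rewrite raddf0; apply: esym; exact: unitsmod_all_eq0.
- exact: ker_rho_acyclic.
- exact: unitsmod_all_acyclic.
Qed.

End Retractions.

(** * Stanley-Reisner rings *)

Local Close Scope classical_set_scope.

Lemma mpoly_rmorph_ext2 n (R : comNzRingType) (S T : pzRingType)
    (f : {rmorphism S -> T}) (g : {rmorphism {mpoly R[n]} -> S})
    (h : {rmorphism {mpoly R[n]} -> T}) :
  (forall c, f (g c%:MP) = h c%:MP) -> (forall i, f (g 'X_i) = h 'X_i) ->
  forall p, f (g p) = h p.
Proof. exact: (mpoly_rmorph_ext (f := f \o g) (g := h)). Qed.

Section FaceRestriction.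
Variables (K : comNzRingType) (V : finType).
Implicit Types (F G H : {set V}).

Definition face_var F (i : 'I_#|V|) : {mpoly K[#|V|]} := if enum_val i \in F then 'X_i else 0.

Definition face_restr F : {mpoly K[#|V|]} -> {mpoly K[#|V|]} :=
  mmap (@mpolyC #|V| K) (face_var F).
HB.instance Definition _ F := GRing.RMorphism.copy (face_restr F)
  (mmap (@mpolyC #|V| K) (face_var F)).

Lemma face_restrC F c : face_restr F c%:MP = c%:MP.
Proof. exact: mmapC. Qed.

Lemma face_restrXU F i : face_restr F 'X_i = face_var F i.
Proof. by rewrite /face_restr mmapX mmap1U. Qed.

Lemma face_restrM F G p : face_restr F (face_restr G p) = face_restr (F :&: G)%SET p.
Proof.
apply: mpoly_rmorph_ext2 p => [c|i] /=.
  by rewrite !face_restrC.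
rewrite !face_restrXU /face_var inE; case: ifP => _; last by rewrite andbF rmorph0.
by rewrite andbT face_restrXU.
Qed.

Definition monomial_support (m : 'X_{1..#|V|}) : {set V} :=
  [set v | m (enum_rank v) != 0%N]%SET.

Lemma face_restrX F m :
  face_restr F 'X_[m] = (monomial_support m \subset F)%:R * 'X_[m].
Proof.
rewrite /face_restr mmapX /mmap1.
case: (boolP (_ \subset F)) => [/fintype.subsetP mF|/fintype.subsetPn[v]].
  rewrite mul1r mpolyXE_id; apply: eq_bigr => i _; rewrite /face_var.
  have [->|mi] := eqVneq (m i) 0%N; first by rewrite !expr0.
  by rewrite mF // inE enum_valK.
rewrite inE => mv vF; rewrite mul0r (bigD1 (enum_rank v)) //= /face_var enum_rankK.
by rewrite (negbTE vF) expr0n (negbTE mv) mul0r.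
Qed.

Lemma mcoeff_face_restr F f m :
  (face_restr F f)@_m = (monomial_support m \subset F)%:R * f@_m.
Proof.
rewrite {1}(mpolyE f) rmorph_sum raddf_sum [in RHS](mpolyE f) raddf_sum mulr_sumr.
apply: eq_bigr => m' _ /=; rewrite -mul_mpolyC rmorphM /= face_restrC face_restrX.
rewrite !mcoeffCM mulrCA; congr (_ * _).
have [mF|mF] := boolP (monomial_support m' \subset F).
  rewrite mul1r mcoeffX; have [<-|_] := eqVneq m' m; last by rewrite mulr0.
  by rewrite mF mul1r.
rewrite mul0r mcoeff0 mcoeffX; have [<-|_] := eqVneq m' m; last by rewrite mulr0.
by rewrite (negbTE mF) mul0r.
Qed.

Section Face.
Variable F : {set V}.

(** A vertex outside F has index #|F| in [enum F]; then [insub] fails and the variable goes to 0. *)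
Definition face_coord (i : 'I_#|V|) : {mpoly K[#|F|]} :=
  oapp (fun j => 'X_j) 0 (insub (index (enum_val i) (enum F)) : option 'I_#|F|).

Definition face_proj : {mpoly K[#|V|]} -> {mpoly K[#|F|]} :=
  mmap (@mpolyC #|F| K) face_coord.
HB.instance Definition _ := GRing.RMorphism.copy face_proj
  (mmap (@mpolyC #|F| K) face_coord).

Definition face_lift : {mpoly K[#|F|]} -> {mpoly K[#|V|]} :=
  mmap (@mpolyC #|V| K) (fun j => 'X_(enum_rank (enum_val j))).
HB.instance Definition _ := GRing.RMorphism.copy face_lift
  (mmap (@mpolyC #|V| K) (fun j => 'X_(enum_rank (enum_val j)))).

Lemma face_liftK p : face_proj (face_lift p) = p.
Proof.
apply: (mpoly_rmorph_ext2 (h := idfun)) p => [c|j]; rewrite /= /face_proj /face_lift.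
  by rewrite !mmapC.
rewrite mmapX mmap1U mmapX mmap1U /face_coord enum_rankK.
rewrite (enum_val_nth (enum_val j)) index_uniq ?enum_uniq -?cardE //.
by rewrite valK.
Qed.

Lemma face_projK p : face_lift (face_proj p) = face_restr F p.
Proof.
apply: mpoly_rmorph_ext2 p => [c|i]; rewrite /= /face_proj /face_lift /face_restr.
  by rewrite !mmapC.
rewrite !mmapX !mmap1U /face_coord /face_var.
have [iF|iF] := boolP (enum_val i \in F); last first.
  by rewrite insubN ?rmorph0 //= -leqNgt cardE leqNgt index_mem mem_enum.
have lt : (index (enum_val i) (enum F) < #|F|)%N by rewrite cardE index_mem mem_enum.
rewrite insubT /= mmapX mmap1U (enum_val_nth (enum_val i)) /= nth_index ?mem_enum //.
by rewrite enum_valK.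
Qed.

End Face.

End FaceRestriction.

Section StanleyReisner.
Variables (K : fieldType) (V : finType) (D : simplicial_complex V).
Let P := {mpoly K[#|V|]}.
Let A := SR_ring K D.
Implicit Types (F G H : {set V}) (f p : P).

Lemma face_restr_monomial F H :
  face_restr F (face_monomial K H) = (H \subset F)%:R * face_monomial K H.
Proof.
rewrite rmorph_prod.
case: (boolP (H \subset F)) => [/fintype.subsetP HF|/fintype.subsetPn[v vH vF]].
  rewrite mul1r; apply: eq_bigr => v vH /=.
  by rewrite face_restrXU /face_var enum_rankK HF.
by rewrite mul0r (bigD1 v) //= face_restrXU /face_var enum_rankK (negbTE vF) mul0r.
Qed.

Lemma face_restr_ideal F f : f \in SR_ideal D -> face_restr F f \in SR_ideal D.
Proof.
move=> /asboolP[c ->]; apply/asboolP.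
exists (fun H => face_restr F (c H) * (H \subset F)%:R).
rewrite rmorph_sum; apply: eq_bigr => H _.
by rewrite rmorphM /= face_restr_monomial mulrA.
Qed.

Lemma face_restr_ideal0 F f : F \in faces D -> f \in SR_ideal D -> face_restr F f = 0.
Proof.
move=> FD /asboolP[c ->]; rewrite rmorph_sum big1 // => H HD.
rewrite rmorphM /= face_restr_monomial; case: (boolP (H \subset F)) => [HF|_].
  by rewrite (faces_sub FD HF) in HD.
by rewrite mul0r mulr0.
Qed.

Definition face_endo_fun F (x : A) : A := SR_pi D (face_restr F (repr x)).

Lemma face_endo_funE F f : face_endo_fun F (SR_pi D f) = SR_pi D (face_restr F f).
Proof.
apply/SR_piE; rewrite -rmorphB; apply: face_restr_ideal; apply/SR_piE.
exact: reprK.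
Qed.

Fact face_endo_is_zmod_morphism F : zmod_morphism (face_endo_fun F).
Proof.
elim/SR_piP => f; elim/SR_piP => g.
by rewrite -[X in face_endo_fun _ X](raddfB (\pi_A)) !face_endo_funE rmorphB; exact: raddfB.
Qed.
Fact face_endo_is_monoid_morphism F : monoid_morphism (face_endo_fun F).
Proof.
split; first by rewrite [LHS]face_endo_funE rmorph1.
elim/SR_piP => f; elim/SR_piP => g.
by rewrite [X in face_endo_fun _ X]SR_piM !face_endo_funE rmorphM [RHS]SR_piM.
Qed.
HB.instance Definition _ F := GRing.isZmodMorphism.Build A A (face_endo_fun F)
  (face_endo_is_zmod_morphism F).
HB.instance Definition _ F := GRing.isMonoidMorphism.Build A A (face_endo_fun F)
  (face_endo_is_monoid_morphism F).
Definition face_endo F : {rmorphism A -> A} := face_endo_fun F.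

Lemma face_endoM F G x : face_endo F (face_endo G x) = face_endo (F :&: G)%SET x.
Proof. by elim/SR_piP: x => f; rewrite /= !face_endo_funE face_restrM. Qed.

Lemma face_endo_eq0 F f : F \in faces D ->
  face_endo F (SR_pi D f) = 0 <-> face_restr F f = 0.
Proof.
move=> FD; rewrite /= face_endo_funE; split=> [|->]; last exact: raddf0.
rewrite -[0 : A](raddf0 (\pi_A)) => /SR_piE; rewrite subr0 => /(face_restr_ideal0 FD).
by rewrite face_restrM finset.setIid.
Qed.

Section Face.
Variables (F : {set V}) (FD : F \in faces D).
Let B := {mpoly K[#|F|]}.

Definition face_quot_fun (x : A) : B := face_proj F (repr x).

Lemma face_quot_funE f : face_quot_fun (SR_pi D f) = face_proj F f.
Proof.
rewrite /face_quot_fun -[LHS]face_liftK -[RHS]face_liftK !face_projK.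
congr (face_proj F _); apply/eqP; rewrite -subr_eq0 -rmorphB /=.
by rewrite (face_restr_ideal0 FD) //; apply/SR_piE; exact: reprK.
Qed.

Fact face_quot_is_zmod_morphism : zmod_morphism face_quot_fun.
Proof.
elim/SR_piP => f; elim/SR_piP => g.
by rewrite -[X in face_quot_fun X](raddfB (\pi_A)) !face_quot_funE rmorphB.
Qed.
Fact face_quot_is_monoid_morphism : monoid_morphism face_quot_fun.
Proof.
split; first by rewrite [LHS]face_quot_funE rmorph1.
elim/SR_piP => f; elim/SR_piP => g.
by rewrite [X in face_quot_fun X]SR_piM !face_quot_funE rmorphM.
Qed.
HB.instance Definition _ := GRing.isZmodMorphism.Build A B face_quot_fun
  face_quot_is_zmod_morphism.
HB.instance Definition _ := GRing.isMonoidMorphism.Build A B face_quot_fun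
  face_quot_is_monoid_morphism.
Definition face_quot : {rmorphism A -> B} := face_quot_fun.

Lemma face_quot_onto b : exists a, face_quot a = b.
Proof. by exists (SR_pi D (face_lift b)); rewrite /= face_quot_funE face_liftK. Qed.

Lemma face_quot_ker a : ker_rho face_endo [:: F] a <-> face_quot a = 0.
Proof.
elim/SR_piP: a => f; rewrite /= face_quot_funE; split=> [h|e G].
  have /(face_endo_eq0 f FD) e : face_endo F (SR_pi D f) = 0 by apply: h; rewrite inE.
  by rewrite -[LHS]face_liftK face_projK e rmorph0.
by rewrite inE => /eqP ->; apply/face_endo_eq0; rewrite // -face_projK e rmorph0.
Qed.

Lemma face_acyclic : acyclic (unitsmod (ker_rho face_endo [:: F])).
Proof.
exact: (unitsmod_factorial_acyclic face_quot_onto face_quot_ker (@mpoly_factorial _ K)).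
Qed.

End Face.

Lemma monomial_ideal m : monomial_support m \notin faces D -> ('X_[m] : P) \in SR_ideal D.
Proof.
set S := monomial_support m => SD.
(* Exponents are positive on the support S, so one copy of each of its variables splits off and
   forms the monomial of the nonface S. *)
have -> : 'X_[m] = (\prod_(v in S) 'X_(enum_rank v) ^+ (m (enum_rank v)).-1) *
    face_monomial K S :> P.
  rewrite /face_monomial -big_split mpolyXE_id (reindex enum_rank) /=; last first.
    exact/onW_bij/enum_rank_bij.
  rewrite (bigID (mem S)) /= [X in _ * X]big1 ?mulr1 => [|v]; last first.
    by rewrite inE negbK => /eqP ->; rewrite expr0.
  by apply: eq_bigr => v; rewrite inE => mv; rewrite -exprSr prednK // lt0n.
apply: SR_idealMl; apply/asboolP; exists (fun H => (H == S)%:R).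
rewrite (bigD1 S) //= eqxx mul1r big1 ?addr0 // => H /andP[_ /negbTE ->].
by rewrite mul0r.
Qed.

(** K[D] embeds in the product of the rings of its faces: restriction to a face keeps the
    coefficient of each monomial supported on it, so only monomials with nonface support survive in
    f, and these lie in the ideal. *)
Lemma face_endo_ker0 x : ker_rho face_endo (enum (faces D)) x -> x = 0.
Proof.
elim/SR_piP: x => f h; rewrite -[0 : A](raddf0 (\pi_A)); apply/SR_piE; rewrite subr0.
rewrite (mpolyE f) rpred_sum // => m _; rewrite -mul_mpolyC.
have [->|fm] := eqVneq f@_m 0; first by rewrite rmorph0 mul0r rpred0.
apply: SR_idealMl; apply: monomial_ideal; apply/negP => mD.
have /(face_endo_eq0 f mD) e : face_endo (monomial_support m) (SR_pi D f) = 0.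
  by apply: h; rewrite mem_enum.
have := mcoeff_face_restr (monomial_support m) f m.
by rewrite e mcoeff0 subxx mul1r => e'; rewrite -e' eqxx in fm.
Qed.

Lemma SR_units_acyclic : acyclic (units_sheaf (structure_sheaf A)).
Proof.
apply: (units_acyclic face_endoM (@finset.setIC V) (@finset.setIid V) _ face_acyclic
  face_endo_ker0).
  by move=> F G FD GD; exact: faces_sub FD (finset.subsetIl F G).
by apply/allP => F; rewrite mem_enum.
Qed.

End StanleyReisner.

Theorem theorem4p13 (K : fieldType) (V : finType) (D : simplicial_complex V)
    (E : injective_resolution (units_sheaf (structure_sheaf (SR_ring K D)))) (j : nat) :
  (1 <= j)%N -> forall c : sheaf_cohomology E j, c = 0.
Proof.
by move=> j1 c; exact: acyclic_cohomology (@SR_units_acyclic K V D) j1.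
Qed.
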